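(* Let $S\ge 3$ and let $K\in\mathcal K_2$ be a plane convex body containing the origin $o$ in its interior and having exactly $S$ stable points with respect to $o$. Then $$\rho^{ex}(K,o)\le \frac{\tan\frac{\pi}{S}-\frac{\pi}{S}}{S\tan\frac{\pi}{S}},$$ with equality if, and only if, $K$ is a regular $S$-gon and $o$ is its center.
   Context: A convex body is a compact convex set with nonempty interior. $\mathcal K_2$ denotes the family of convex bodies in $\mathbb R^2$ with piecewise smooth ($C^\infty$) boundary. Let $K\in\mathcal K_2$ and $p\in\operatorname{int}K$. A point $q\in\operatorname{bd}K$ is an equilibrium point of $K$ with respect to $p$ if the line through $q$ perpendicular to $q-p$ supports $K$ (at a smooth boundary point this means that $q$ is a critical point of $z\mapsto|z-p|$, $z\in\operatorname{bd}K$). The equilibrium point $q$ is nondegenerate if: when $\operatorname{bd}K$ is smooth at $q$, the second derivative of $z\mapsto|z-p|$, $z\in\operatorname{bd}K$, at $q$ is not zero; when $\operatorname{bd}K$ is not smooth at $q$, both angles between $p-q$ and the two one-sided tangent half lines of $\operatorname{bd}K$ at $q$ are acute. A nondegenerate equilibrium point at a smooth boundary point is stable (resp. unstable) if that second derivative is positive (resp. negative); a nondegenerate equilibrium point at a nonsmooth boundary point is unstable. Standing assumption: all bodies considered have only nondegenerate equilibrium points with respect to the reference point in question. If $K$ has $S$ stable points with respect to $p$, let $\mathcal F_{<}(K,p)$ be the family of convex bodies $K'\in\mathcal K_2$ with $K'\subseteq K$, $p\in\operatorname{int}K'$, having strictly fewer than $S$ stable points with respect to $p$. The (downward) external robustness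 of $K$ with respect to $p$ is $$\rho^{ex}(K,p)=\frac{\inf\{\operatorname{area}(K\setminus K'):K'\in\mathcal F_{<}(K,p)\}}{\operatorname{area}(K)}.$$ *)

(* Defs.v *)
(* MathComp / MathComp-Analysis *)
From HB Require Import structures.
From mathcomp Require Import all_boot all_order all_algebra.
From mathcomp Require Import all_classical all_reals all_analysis.

Set Implicit Arguments.
Unset Strict Implicit.
Unset Printing Implicit Defensive.

Import Order.TTheory GRing.Theory Num.Theory.
Import numFieldNormedType.Exports.

Local Open Scope classical_set_scope.
Local Open Scope ring_scope.

(* The library norm on R * R is the sup norm; it is used below only through
   the product topology it induces.  Lengths and angles come from [dot]. *)
Notation plane R := (R * R)%type.

Definition dot (R : realType) (u v : plane R) : R := u.1 * v.1 + u.2 * v.2.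

Definition dist (R : realType) (u v : plane R) : R :=
  Num.sqrt (dot (u - v) (u - v)).

Definition area (R : realType) (A : set (plane R)) : \bar R :=
  (lebesgue_measure \x lebesgue_measure)%E A.

Definition bd (R : realType) (A : set (plane R)) : set (plane R) :=
  closure A `\` A°.

Definition convex_body (R : realType) (K : set (plane R)) : Prop :=
  [/\ compact K, convex_set K & K° !=set0].

Definition smooth_curve (R : realType) (g : R -> plane R) : Prop :=
  forall (n : nat) (t : R), derivable (derive1n n g) t 1.

(* [A] is a simple closed curve c made of finitely many regular C^oo arcs: each
   closed arc is the restriction of a C^oo curve defined on the whole line
   (equivalently, it has one-sided derivatives of all orders at its ends).
   Consecutive arcs share an endpoint, so c is continuous. *)
Definition piecewise_smooth_closed_curve (R : realType) (A : set (plane R)) :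
    Prop :=
  exists (c : R -> plane R) (m : nat) (s : nat -> R),
    [/\ c @` `[0, 1] = A,
        c 0 = c 1,
        {in `[0, 1[ &, injective c},
        s 0%N = 0 /\ s m = 1 &
        forall i : nat, (i < m)%N ->
          s i < s i.+1 /\
          exists g : R -> plane R, smooth_curve g /\
            {in `[s i, s i.+1], forall t, c t = g t /\ derive1 g t != 0}].

Definition K2 (R : realType) : set (set (plane R)) :=
  [set K | convex_body K /\ piecewise_smooth_closed_curve (bd K)].

(* [g] is a regular C^oo parametrization of bd K near q = g 0 *)
Definition local_param (R : realType) (K : set (plane R)) (q : plane R)
    (g : R -> plane R) : Prop :=
  [/\ smooth_curve g, g 0 = q, derive1 g 0 != 0 &
      exists e : R, [/\ 0 < e, g @` `]-e, e[ `<=` bd K &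
        \forall z \near q, bd K z -> (g @` `]-e, e[) z]].

Definition smooth_at (R : realType) (K : set (plane R)) (q : plane R) : Prop :=
  exists g : R -> plane R, local_param K q g.

(* [v] spans a one-sided tangent half line of bd K at [q]: it is the right
   derivative at q of a curve in bd K issuing from q. *)
Definition tangent_half_line (R : realType) (K : set (plane R))
    (q v : plane R) : Prop :=
  v != 0 /\
  exists g : R -> plane R,
    (\forall t \near 0^'+, bd K (g t)) /\
    t^-1 *: (g t - q) @[t --> 0^'+] --> v.

Definition equilibrium (R : realType) (K : set (plane R)) (p q : plane R) :
    Prop :=
  bd K q /\
  ((forall z, K z -> dot (z - q) (q - p) <= 0) \/
   (forall z, K z -> 0 <= dot (z - q) (q - p))).

(* Second derivative of z |-> |z - p| along bd K in the parametrization [g].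
   At an equilibrium point g 0 the first derivative vanishes, so changing the
   regular parametrization only multiplies this number by a positive factor:
   its vanishing and its sign do not depend on [g]. *)
Definition dist_deriv2 (R : realType) (p : plane R) (g : R -> plane R) : R :=
  derive1n 2 (fun t : R => dist (g t) p) 0.

Definition nondegenerate (R : realType) (K : set (plane R)) (p q : plane R) :
    Prop :=
  (smooth_at K q ->
     exists2 g : R -> plane R, local_param K q g & dist_deriv2 p g != 0) /\
  (~ smooth_at K q ->
     forall v, tangent_half_line K q v -> 0 < dot (p - q) v).

Definition all_nondegenerate (R : realType) (K : set (plane R)) (p : plane R) :
    Prop :=
  forall q, equilibrium K p q -> nondegenerate K p q.

(* Nondegenerate equilibria at nonsmooth boundary points are unstable, hence
   only smooth boundary points occur here. *)
Definition stable_points (R : realType) (K : set (plane R)) (p : plane R) :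
    set (plane R) :=
  [set q | equilibrium K p q /\
     exists2 g : R -> plane R, local_param K q g & 0 < dist_deriv2 p g].

(* The last two conditions say that K' has strictly fewer stable points. *)
Definition fewer_stable (R : realType) (K : set (plane R)) (p : plane R) :
    set (set (plane R)) :=
  [set K' | [/\ K2 K', K' `<=` K, (K'°) p, all_nondegenerate K' p &
     (stable_points K' p #<= stable_points K p)%card /\
     ~ (stable_points K p #<= stable_points K' p)%card]].

Definition external_robustness (R : realType) (K : set (plane R))
    (p : plane R) : \bar R :=
  (ereal_inf [set area (K `\` K') | K' in fewer_stable K p] / area K)%E.

Definition convex_hull (R : realType) (A : set (plane R)) : set (plane R) :=
  smallest (@convex_set R (plane R)) A.

Definition regular_polygon (R : realType) (n : nat) (c : plane R)
    (K : set (plane R)) : Prop :=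
  exists (r a : R), 0 < r /\
    K = convex_hull
      [set (c + (r * cos (a + 2 * pi * k%:R / n%:R),
                 r * sin (a + 2 * pi * k%:R / n%:R)) : plane R) | k in `I_n].

(* Main.v *)
Require Import Defs.
From HB Require Import structures.
From mathcomp Require Import all_boot all_order all_algebra.
From mathcomp Require Import all_classical all_reals all_analysis.
From mathcomp Require Import ring lra.

(* Write K = {z | N z <= 1} with N a gauge, and let a < b be consecutive stable
   angles, r the larger of the distances from o of the two stable points, T the area
   of K over the arc [a, b], D the area over the arc of the intersection of K with
   the disc of radius r.  Cutting K over the arc along a discrete spiral of lines
   that starts just inside the farther stable point (along two such spirals meeting
   in the middle if the distances are equal) destroys a stable point, creates no new
   equilibrium point outside the middle, and removes an area as close to T - D as we
   please.  For an arc of half-angle h < pi/2 one has D >= (h / tan h) T, because over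
   each half of the arc the projection of the boundary point on the direction of the
   stable point decreases; equality forces the two halves to be right triangles.  As
   h |-> (1 - h / tan h)^-1, continued by 1 for h >= pi/2, lies strictly above its
   tangent line at pi/S, the sum over the S arcs shows that some T - D is at most the
   bound times the area of K, and that K is a regular S-gon if all are at least that.
   Conversely, if a body inside the regular S-gon has fewer than S stable points, then
   over some arc between consecutive feet it lies in the inscribed disc: otherwise
   it would have a local maximum of its gauge near each foot. *)

Set Implicit Arguments.
Unset Strict Implicit.
Unset Printing Implicit Defensive.

Import Order.TTheory GRing.Theory Num.Theory.
Import numFieldNormedType.Exports.

Local Open Scope classical_set_scope.
Local Open Scope ring_scope.

(** * Plane vectors in polar form *)

Section PlaneGeometry.
Variable R : realType.
Implicit Types (a b r s t x y : R) (u v w z : plane R).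

(** The foot of a single cutting line would be a new stable point, and a circular cut would consist
    of degenerate equilibria. Hence many lines, turned by a step [s] and moved towards [o] by the
    factor [kappa s = 1 - s ^+ 2]. As [kappa s < cos s], each line removes the foot of its
    predecessor; as [n * s] is fixed, [n] lines shrink the distance by a factor that tends to 1.
    Finitely many half-planes keep the boundary piecewise smooth. The last line has no successor:
    either it misses the body, being beyond the support line of the nearer stable point, or, for
    equal distances, both spirals share it, and its foot is one new stable point in exchange for two
    lost ones. Everything is read off the gauge on the unit circle: the boundary point in direction
    [t] has distance [(N (uvec t))^-1], so stable points are strict local maxima of [N], and a cut
    replaces [N] by its maximum with a linear form. The averaging uses reciprocals,
    [gain * (T - D) <= T], because the areas [T] add up to the area of K and the half-angles to
    [pi], so that the linear part of the tangent line cancels. *)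

Definition uvec t : plane R := (cos t, sin t).

Definition cross u v : R := u.1 * v.2 - u.2 * v.1.

Definition enorm z : R := Num.sqrt (dot z z).

Lemma scale_pairE r x y : r *: ((x, y) : plane R) = (r * x, r * y).
Proof. by []. Qed.

Lemma dotDl u v w : dot (u + v) w = dot u w + dot v w.
Proof. by rewrite /dot /=; ring. Qed.

Lemma dotZl r u w : dot (r *: u) w = r * dot u w.
Proof. by rewrite /dot /= /GRing.scale /=; ring. Qed.

Lemma dotC u w : dot u w = dot w u.
Proof. by rewrite /dot; ring. Qed.

Lemma dotZr r u w : dot u (r *: w) = r * dot u w.
Proof. by rewrite dotC dotZl dotC. Qed.

Lemma dotBl u v w : dot (u - v) w = dot u w - dot v w.
Proof. by rewrite /dot /=; ring. Qed.

Lemma crossZl r u w : cross (r *: u) w = r * cross u w.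
Proof. by rewrite /cross /= /GRing.scale /=; ring. Qed.

Lemma crossZr r u w : cross u (r *: w) = r * cross u w.
Proof. by rewrite /cross /= /GRing.scale /=; ring. Qed.

Lemma dot_uvec s t : dot (uvec s) (uvec t) = cos (t - s).
Proof. by rewrite /dot /= cosB; ring. Qed.

Lemma cross_uvec s t : cross (uvec s) (uvec t) = sin (t - s).
Proof. by rewrite /cross /= sinB; ring. Qed.

Lemma dot_ge0 z : 0 <= dot z z.
Proof. by rewrite /dot -!expr2 addr_ge0 ?sqr_ge0. Qed.

Lemma dot_eq0 z : (dot z z == 0) = (z == 0).
Proof.
case: z => x y; rewrite /dot /= -!expr2 paddr_eq0 ?sqr_ge0// !sqrf_eq0.
by apply/andP/eqP => [[/eqP -> /eqP ->]//|[-> ->]].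
Qed.

Lemma uvec_neq0 t : uvec t != 0.
Proof. by rewrite -dot_eq0 dot_uvec subrr cos0 oner_neq0. Qed.

Lemma enorm_ge0 z : 0 <= enorm z.
Proof. exact: sqrtr_ge0. Qed.

Lemma enorm_gt0 z : z != 0 -> 0 < enorm z.
Proof. by move=> z0; rewrite sqrtr_gt0 lt_def dot_eq0 z0 dot_ge0. Qed.

Lemma enorm2 z : enorm z ^+ 2 = dot z z.
Proof. by rewrite sqr_sqrtr// dot_ge0. Qed.

Lemma enormZ r z : 0 <= r -> enorm (r *: z) = r * enorm z.
Proof.
move=> r0; rewrite /enorm dotZl dotZr mulrA -expr2 sqrtrM ?sqr_ge0//.
by rewrite sqrtr_sqr ger0_norm.
Qed.

Lemma enorm_uvec t : enorm (uvec t) = 1.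
Proof. by rewrite /enorm dot_uvec subrr cos0 sqrtr1. Qed.

Lemma enorm_polar r t : 0 <= r -> enorm (r *: uvec t) = r.
Proof. by move=> r0; rewrite enormZ// enorm_uvec mulr1. Qed.

Lemma dist0 z : dist z 0 = enorm z.
Proof. by rewrite /dist subr0. Qed.

Lemma dot_le_enorm u v : dot u v <= enorm u * enorm v.
Proof.
apply: le_trans (ler_norm _) _.
rewrite -(@ler_pXn2r _ 2)// ?nnegrE ?mulr_ge0 ?enorm_ge0//.
rewrite exprMn !enorm2 real_normK ?num_real// -subr_ge0.
rewrite [X in 0 <= X](_ : _ = cross u v ^+ 2) ?sqr_ge0//.
by rewrite /dot /cross; ring.
Qed.

Lemma enormD u v : enorm (u + v) <= enorm u + enorm v.
Proof.
rewrite -(@ler_pXn2r _ 2)// ?nnegrE ?addr_ge0 ?enorm_ge0//.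
rewrite sqrrD !enorm2 dotDl ![dot _ (u + v)]dotC !dotDl (dotC v u).
have := dot_le_enorm u v; lra.
Qed.

Lemma uvec_period t (k : int) : uvec (t + 2 * pi * k%:~R) = uvec t.
Proof.
have nat_period (n : nat) s : uvec (s + 2 * pi * n%:R) = uvec s.
  elim: n s => [|n IH] s; first by rewrite mulr0 addr0.
  rewrite -[n.+1%:R]natr1 mulrDr mulr1 addrA -(IH s) /uvec.
  by rewrite mulr_natl cosD2pi sinD2pi.
case: k => n; first exact: nat_period.
by rewrite NegzE mulrNz mulrN -(nat_period n.+1) pmulrn subrK.
Qed.

Lemma angle_shift a t : exists k : int, a <= t + 2 * pi * k%:~R < a + 2 * pi.
Proof.
have pi2 : 0 < 2 * pi :> R by rewrite mulr_gt0 ?pi_gt0.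
exists (- Num.floor ((t - a) / (2 * pi))); set f := Num.floor _.
have := floor_le_tmp ((t - a) / (2 * pi)); rewrite ler_pdivlMr// => h1.
have := floorD1_gt ((t - a) / (2 * pi)).
rewrite ltr_pdivrMr// intrD mulrDl mul1r => h2.
rewrite mulrNz mulrN mulrC; apply/andP; split; lra.
Qed.

Lemma unit_uvec z : enorm z = 1 -> exists t, z = uvec t.
Proof.
case: z => x y h; have {}h : x ^+ 2 + y ^+ 2 = 1.
  by have := enorm2 (x, y); rewrite h expr1n /dot /= !expr2.
have x1 : -1 <= x <= 1.
  rewrite -ler_norml -(@ler_pXn2r _ 2)// ?nnegrE//.
  by rewrite expr1n real_normK ?num_real// -h lerDl sqr_ge0.
have cx : cos (acos x) = x by rewrite acosK// in_itv.
have sx : sin (acos x) = `|y|.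
  by rewrite sin_acos// -h addrAC subrr add0r sqrtr_sqr.
have [y0|y0] := leP 0 y.
  by exists (acos x); rewrite /uvec cx sx ger0_norm.
by exists (- acos x); rewrite /uvec cosN sinN cx sx ltr0_norm// opprK.
Qed.

Lemma polar_decomp a z : z != 0 ->
  exists t, a <= t < a + 2 * pi /\ z = enorm z *: uvec t.
Proof.
move=> z0; have n0 := enorm_gt0 z0.
have [t ht] : exists t, (enorm z)^-1 *: z = uvec t.
  by apply: unit_uvec; rewrite enormZ ?invr_ge0 ?ltW// mulVf ?gt_eqF.
have [k hk] := angle_shift a t; exists (t + 2 * pi * k%:~R); split=> //.
by rewrite uvec_period -ht scalerA mulfV ?scale1r ?gt_eqF.
Qed.

Lemma sin_eq0_lt t : - pi < t < pi -> sin t = 0 -> t = 0.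
Proof.
move=> /andP[t1 t2] st; have [t0|t0|//] := ltgtP t 0.
  have : 0 < sin (- t) by apply: sin_gt0_pi; rewrite oppr_gt0 t0 ltrNl t1.
  by rewrite sinN st oppr0 ltxx.
by have := @sin_gt0_pi R t; rewrite t0 t2 st ltxx => /(_ isT).
Qed.

Lemma cos_eq1_lt t : - (2 * pi) < t < 2 * pi -> cos t = 1 -> t = 0.
Proof.
move=> /andP[t1 t2] ct; set s := t / 2.
have h2 : t = s + s by rewrite /s; lra.
have : sin s = 0.
  move: ct; rewrite h2 cosD -!expr2 => ct; have e := cos2Dsin2 s.
  by apply/eqP; rewrite -sqrf_eq0; apply/eqP; lra.
by move/sin_eq0_lt => h; rewrite h2 h ?addr0//; apply/andP; split; lra.
Qed.

Lemma uvec_inj a s t : a <= s < a + 2 * pi -> a <= t < a + 2 * pi ->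
  uvec s = uvec t -> s = t.
Proof.
move=> hs ht e; have := dot_uvec s t; rewrite e dot_uvec subrr cos0.
move=> /esym/cos_eq1_lt h; apply/eqP; rewrite eq_sym -subr_eq0; apply/eqP.
by apply: h; lra.
Qed.

Lemma polar_inj r r' s t : 0 < r -> 0 < r' ->
  r *: uvec s = r' *: uvec t -> r = r' /\ uvec s = uvec t.
Proof.
move=> r0 r'0 e; have rr : r = r'.
  by rewrite -(enorm_polar s (ltW r0)) e enorm_polar// ltW.
by split=> //; move: e; rewrite -rr; apply: scalerI; rewrite gt_eqF.
Qed.

End PlaneGeometry.

(** * Gauges of convex bodies around the origin *)

Section Gauge.
Variable R : realType.
Implicit Types (N : plane R -> R) (z w : plane R) (K : set (plane R)).
Implicit Types (a b r s t x y : R).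

(** Homogeneity is asked for nonnegative factors only: the body need not be symmetric, so [N (- z)]
    and [N z] may differ. *)
Definition gauge N :=
  [/\ forall a z, 0 <= a -> N (a *: z) = a * N z,
      forall z w, N (z + w) <= N z + N w &
      forall z, z != 0 -> 0 < N z].

Definition body N : set (plane R) := [set z | N z <= 1].

Lemma gaugeZ N a z : gauge N -> 0 <= a -> N (a *: z) = a * N z.
Proof. by case=> + _ _; exact. Qed.

Lemma gaugeD N z w : gauge N -> N (z + w) <= N z + N w.
Proof. by case=> _ + _; exact. Qed.

Lemma gauge_gt0 N z : gauge N -> z != 0 -> 0 < N z.
Proof. by case=> _ _; exact. Qed.

Lemma gauge0 N : gauge N -> N 0 = 0.
Proof. by move=> hN; rewrite -(scale0r 0) gaugeZ// mul0r. Qed.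

Lemma gauge_ge0 N z : gauge N -> 0 <= N z.
Proof.
by move=> hN; have [->|/(gauge_gt0 hN)/ltW//] := eqVneq z 0; rewrite gauge0.
Qed.

Lemma gauge_uvec_gt0 N t : gauge N -> 0 < N (uvec t).
Proof. by move=> hN; rewrite gauge_gt0// uvec_neq0. Qed.

Lemma gauge_enorm : gauge (@enorm R).
Proof. by split; [move=> a z; exact: enormZ|exact: enormD|exact: enorm_gt0]. Qed.

Lemma gauge_scale N a : gauge N -> 0 < a -> gauge (fun z => a * N z).
Proof.
move=> hN a0; split=> [b z b0|z w|z z0]; first by rewrite gaugeZ// mulrCA.
  by rewrite -mulrDr ler_pM2l// gaugeD.
by rewrite mulr_gt0// gauge_gt0.
Qed.

Lemma gauge_max N (f : plane R -> R) : gauge N ->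
  (forall a z, 0 <= a -> f (a *: z) = a * f z) ->
  (forall z w, f (z + w) <= f z + f w) ->
  gauge (fun z => Num.max (N z) (f z)).
Proof.
move=> hN fZ fD; split=> [a z a0|z w|z z0]; first by rewrite gaugeZ// fZ// maxr_pMr.
  rewrite ge_max (le_trans (gaugeD _ _ hN)) ?(le_trans (fD _ _))//.
    by rewrite lerD// le_max lexx ?orbT.
  by rewrite lerD// le_max lexx ?orbT.
by rewrite lt_max gauge_gt0.
Qed.

(** Split [z] along the axes and use subadditivity; all four half-axes enter because [N] is not
    even. Applied to differences, the bound gives continuity. *)
Lemma gauge_bound N : gauge N ->
  exists M, 0 < M /\ forall z, N z <= M * (`|z.1| + `|z.2|).
Proof.
move=> hN; pose e1 : plane R := (1, 0); pose e2 : plane R := (0, 1).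
pose M := N e1 + N (- e1) + N e2 + N (- e2) + 1.
have g0 z := @gauge_ge0 N z hN.
have M0 : 0 < M by rewrite /M; have := g0 e1; have := g0 (- e1);
  have := g0 e2; have := g0 (- e2); lra.
exists M; split=> // -[x y] /=.
have -> : (x, y) = x *: e1 + y *: e2.
  rewrite /e1 /e2 !scale_pairE; congr pair; rewrite /=; ring.
have side c z : N z + N (- z) <= M -> N (c *: z) <= M * `|c|.
  move=> h; have [c0|c0] := leP 0 c.
    by rewrite gaugeZ// mulrC ger0_norm// ler_wpM2r//; have := g0 (- z); lra.
  rewrite -(opprK c) scaleNr -scalerN gaugeZ//; last by rewrite oppr_ge0 ltW.
  by rewrite opprK mulrC ltr0_norm// ler_wpM2r// ?oppr_ge0 ?(ltW c0)//; have := g0 z; lra.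
apply: le_trans (gaugeD _ _ hN) _; rewrite mulrDr lerD// side// /M.
  by have := g0 e2; have := g0 (- e2); lra.
by have := g0 e1; have := g0 (- e1); lra.
Qed.

Lemma gauge_continuous N : gauge N -> continuous N.
Proof.
move=> hN w; have [M [M0 hM]] := gauge_bound hN.
apply/cvgrPdist_lt => e e0.
have d0 : 0 < e / (2 * M) by rewrite divr_gt0// mulr_gt0.
have h1 : \forall z \near w, `|w.1 - z.1| < e / (2 * M).
  have /cvgrPdist_lt : (fun z : plane R => z.1) z @[z --> w] --> w.1 by exact: cvg_fst.
  exact.
have h2 : \forall z \near w, `|w.2 - z.2| < e / (2 * M).
  have /cvgrPdist_lt : (fun z : plane R => z.2) z @[z --> w] --> w.2 by exact: cvg_snd.
  exact.
near=> z.
have z1 : `|w.1 - z.1| < e / (2 * M) by near: z.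
have z2 : `|w.2 - z.2| < e / (2 * M) by near: z.
have [A B] : N w - N z <= M * (`|w.1 - z.1| + `|w.2 - z.2|) /\
             N z - N w <= M * (`|w.1 - z.1| + `|w.2 - z.2|).
  split; rewrite lerBlDr.
    by apply: le_trans (lerD (hM (w - z)) (lexx _)); rewrite -{1}(subrK z w) gaugeD.
  rewrite (distrC w.1) (distrC w.2).
  by apply: le_trans (lerD (hM (z - w)) (lexx _)); rewrite -{1}(subrK w z) gaugeD.
have : M * (`|w.1 - z.1| + `|w.2 - z.2|) < e.
  rewrite mulrC -ltr_pdivlMr//; have -> : e / M = e / (2 * M) + e / (2 * M).
    by field; rewrite gt_eqF.
  by rewrite ltrD.
move=> C; rewrite ltr_norml; apply/andP; split; lra.
Unshelve. all: by end_near. Qed.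

Lemma continuous_uvec : continuous (@uvec R).
Proof. move=> t; exact: (cvg_pair (@continuous_cos R t) (@continuous_sin R t)). Qed.

Lemma gauge_uvec_continuous N : gauge N -> continuous (fun t => N (uvec t)).
Proof.
move=> hN t; apply: (@continuous_comp _ _ _ (@uvec R) N).
  exact: continuous_uvec.
exact: gauge_continuous.
Qed.

(** Compactness of the unit circle: [m] is the minimum of [N] there. It bounds the body and thereby
    makes all areas finite. *)
Lemma gauge_lower N : gauge N -> exists m, 0 < m /\ forall z, m * enorm z <= N z.
Proof.
move=> hN; have pi2 : 0 <= 2 * pi :> R by rewrite mulr_ge0// pi_ge0.
have [|c _ hc] := @EVT_min R (fun t => N (uvec t)) _ _ pi2.
  by apply: continuous_subspaceT; exact: gauge_uvec_continuous.
exists (N (uvec c)); split=> [|z]; first exact: gauge_uvec_gt0.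
have [->|z0] := eqVneq z 0.
  by rewrite /enorm /dot /= !mulr0 addr0 sqrtr0 mulr0 gauge_ge0.
have [t [/andP[t1 t2] zE]] := polar_decomp 0 z0.
rewrite [in leRHS]zE gaugeZ ?enorm_ge0// mulrC ler_wpM2l ?enorm_ge0//.
by apply: hc; rewrite in_itv /= t1 ltW// -[2 * pi]add0r.
Qed.

Lemma body_closed N : gauge N -> closed (body N).
Proof.
move=> hN; apply: (@closed_comp _ _ N [set x | x <= 1]).
  by move=> z _; exact: gauge_continuous.
exact: closed_le.
Qed.

Lemma coord_le_enorm z : `|z.1| <= enorm z /\ `|z.2| <= enorm z.
Proof.
by split; rewrite -(@ler_pXn2r _ 2)// ?nnegrE ?enorm_ge0// enorm2;
  rewrite real_normK ?num_real// /dot -!expr2 ?lerDl ?lerDr sqr_ge0.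
Qed.

Lemma body_compact N : gauge N -> compact (body N).
Proof.
move=> hN; have [m [m0 hm]] := gauge_lower hN.
apply: (@subclosed_compact _ _ (`[- m^-1, m^-1] `*` `[- m^-1, m^-1])).
- exact: body_closed.
- by apply: compact_setX; exact: segment_compact.
move=> z; rewrite /body /= => hz; have : enorm z <= m^-1.
  rewrite -[_^-1]mul1r ler_pdivlMr// mulrC; exact: le_trans (hm z) hz.
move=> h; have [h1 h2] := coord_le_enorm z.
by split; rewrite /= in_itv /= -ler_norml (le_trans _ h).
Qed.

Lemma body_convex N : gauge N -> convex_set (body N).
Proof.
move=> hN z w l; rewrite !inE /body /= => hz hw.
rewrite /conv /=.
apply: le_trans (gaugeD _ _ hN) _.
have l0 : 0 <= l%:num by [].
have l1 : 0 <= 1 - l%:num by rewrite subr_ge0.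
rewrite !gaugeZ//=; move: (l%:num) l0 l1 => x x0 x1.
rewrite -[1 in leRHS](_ : x * 1 + (1 - x) * 1 = 1); last by ring.
by rewrite lerD// ler_wpM2l.
Qed.

Lemma body_interior N : gauge N -> (body N)° = [set z | N z < 1].
Proof.
move=> hN; apply/seteqP; split=> [z|z hz]; last first.
  have : open [set z | N z < 1].
    apply: (@open_comp _ _ N [set x | x < 1]); last exact: open_lt.
    by move=> w _; exact: gauge_continuous.
  move=> /(_ z hz); apply: filterS => w; exact: ltW.
move=> hz; have /= := interior_subset hz; rewrite /body /= le_eqVlt.
move=> /orP[/eqP e|//]; exfalso.
have : \forall x \near (1 : R), body N (x *: z).
  have : (fun x : R => x *: z) x @[x --> (1 : R)] --> z.
    by rewrite -[X in _ --> X]scale1r; apply: cvgZr_tmp; exact: cvg_id.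
  by apply.
move=> /nbhs_ballP[d /= d0 /(_ (1 + d / 2))] h.
have : body N ((1 + d / 2) *: z).
  by apply: h; rewrite /ball /= opprD addrA subrr add0r normrN ger0_norm; lra.
have d2 : 0 <= 1 + d / 2 by lra.
by rewrite /body /= (gaugeZ _ hN d2) e; lra.
Qed.

Lemma body_bd N : gauge N -> bd (body N) = [set z | N z = 1].
Proof.
move=> hN; rewrite /bd body_interior// -(closure_id _).1; last exact: body_closed.
apply/seteqP; split=> [z [] /= h1 /negP|z /= h].
  by rewrite -leNgt => h2; apply/eqP; rewrite eq_le; apply/andP.
by split; rewrite /body /= h// ltxx.
Qed.

Lemma body0 N : gauge N -> (body N)° 0.
Proof. by move=> hN; rewrite body_interior//= gauge0. Qed.

Lemma body_convex_body N : gauge N -> convex_body (body N).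
Proof.
move=> hN; split; [exact: body_compact|exact: body_convex|].
by exists 0; exact: body0.
Qed.

(** The Minkowski functional, the infimum of the [s > 0] with [s^-1 *: z] in K. The origin being
    interior makes it finite, boundedness makes it positive off 0, convexity makes it subadditive,
    and closedness recovers K as its unit body. *)
Lemma convex_body_gauge K : convex_body K -> K° 0 -> exists N, gauge N /\ K = body N.
Proof.
move=> [cK vK _] K0.
have K00 : K 0 := interior_subset K0.
have cvx z w a : 0 <= a <= 1 -> K z -> K w -> K (a *: z + (1 - a) *: w).
  move=> ha Kz Kw; have := vK z w (Itv01 (andP ha).1 (andP ha).2).
  by rewrite !inE => /(_ Kz Kw).
have star z a : 0 <= a <= 1 -> K z -> K (a *: z).
  by move=> ha Kz; have := cvx _ _ _ ha Kz K00; rewrite scaler0 addr0.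
have [B [B0 hB]] : exists B, 0 < B /\ forall z, K z -> enorm z <= B.
  have [|c _ hc] := @compact_EVT_max _ R (@enorm R) K (ex_intro _ 0 K00) cK.
    by apply: continuous_subspaceT; exact: gauge_continuous (gauge_enorm).
  exists (enorm c + 1); split=> [|z Kz]; first by have := enorm_ge0 c; lra.
  by apply: le_trans (hc z _) _; rewrite ?inE// lerDl.
pose E z := [set s | 0 < s /\ K (s^-1 *: z)].
have E0 z : E z !=set0.
  have : \forall x \near (0 : R), K (x *: z).
    have : (fun x : R => x *: z) x @[x --> (0 : R)] --> (0 : plane R).
      by rewrite -[X in _ --> X](scale0r z); apply: cvgZr_tmp; exact: cvg_id.
    by apply; exact: K0.
  move=> /nbhs_ballP[d /= d0 /(_ (d / 2))] h.
  exists (d / 2)^-1; split; first by rewrite invr_gt0 divr_gt0.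
  by rewrite invrK; apply: h; rewrite /ball /= sub0r normrN ger0_norm; lra.
have Elb z : lbound (E z) 0 by move=> s [/ltW].
have EB z s : E z s -> enorm z / B <= s.
  move=> [s0 /hB]; rewrite enormZ ?invr_ge0 ?(ltW s0)// => h.
  by rewrite ler_pdivrMr// -ler_pdivrMl.
have up z s s' : E z s -> s <= s' -> E z s'.
  move=> [s0 Ks] ss; have s'0 := lt_le_trans s0 ss; split=> //.
  have -> : s'^-1 *: z = (s / s') *: (s^-1 *: z).
    by rewrite scalerA mulrAC mulfV ?mul1r ?gt_eqF.
  apply: star => //; rewrite divr_ge0 ?(ltW s0) ?(ltW s'0)//=.
  by rewrite ler_pdivrMr// mul1r.
pose N z := inf (E z).
have hasinf z : has_inf (E z) by split; [exact: E0|exists 0; exact: Elb].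
have ED z w s t : E z s -> E w t -> E (z + w) (s + t).
  move=> [s0 Ks] [t0 Kt]; have st0 := addr_gt0 s0 t0; split=> //.
  (* A convex combination with weights [s / (s + t)] and [t / (s + t)]. *)
  have -> : (s + t)^-1 *: (z + w) =
      (s / (s + t)) *: (s^-1 *: z) + (1 - s / (s + t)) *: (t^-1 *: w).
    have -> : 1 - s / (s + t) = t / (s + t) by field; rewrite gt_eqF.
    rewrite scalerDr !scalerA; congr (_ *: _ + _ *: _); field;
    by rewrite !gt_eqF.
  apply: cvx => //; rewrite divr_ge0 ?(ltW s0) ?(ltW st0)//=.
  by rewrite ler_pdivrMr// mul1r lerDl ltW.
have NE z s : N z < s -> E z s.
  move=> h; have [s' Es' /ltW] := inf_lt (E0 z) h; exact: up.
have EN z s : E z s -> N z <= s by apply: ge_inf; exact: (hasinf z).2.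
have N0 z : 0 <= N z by apply: lb_le_inf.
have hN : gauge N.
  have NZ a z : 0 < a -> N (a *: z) <= a * N z.
    move=> a0; rewrite -ler_pdivrMl//; apply: lb_le_inf => // s [s0 Ks].
    rewrite ler_pdivrMl//; apply: EN; split; first exact: mulr_gt0.
    by rewrite scalerA invfM mulrAC mulVf ?mul1r ?gt_eqF.
  split=> [a z|z w|z z0].
  - rewrite le_eqVlt => /orP[/eqP <-|a0].
      rewrite scale0r mul0r; apply/eqP; rewrite eq_le N0 andbT.
      apply/ler_addgt0Pl => e e0; rewrite addr0; apply: EN; split=> //.
      by rewrite scaler0.
    apply/eqP; rewrite eq_le NZ//= -ler_pdivlMl//.
    by rewrite -{1}(scalerK (lt0r_neq0 a0) z) NZ ?invr_gt0.
  - apply/ler_addgt0Pl => e e0.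
    have -> : e + (N z + N w) = (N z + e / 2) + (N w + e / 2) by lra.
    by apply: EN; apply: ED; apply: NE; lra.
  - by apply: lt_le_trans (lb_le_inf (E0 z) (EB z)); rewrite divr_gt0// enorm_gt0.
exists N; split=> //; apply/seteqP; split=> [z Kz|z hz].
  by apply: EN; split=> //; rewrite invr1 scale1r.
have cl : closed K by apply: compact_closed => //; exact: norm_hausdorff.
apply: cl => U Uz.
have : (fun x : R => x *: z) x @[x --> (1 : R)] --> z.
  by rewrite -[X in _ --> X]scale1r; apply: cvgZr_tmp; exact: cvg_id.
move=> /(_ _ Uz) /nbhs_ballP[d /= d0 hd].
(* A point with [N z = 1] need not attain the infimum, but its contractions [x *: z] with [x < 1]
   lie in K; [x] is taken so close to 1 that [x *: z] is in the given neighbourhood. *)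
pose x := 1 - Num.min (d / 2) (1 / 2).
have x01 : 0 < x < 1 by rewrite /x; case: (leP (d / 2) (1 / 2)) => ?; lra.
exists (x *: z); split.
  have [|x0] := NE z x^-1; last by rewrite invrK.
  by apply: le_lt_trans hz _; rewrite invf_gt1//; lra.
apply: hd; rewrite /ball /= /x opprB addrC subrK ger0_norm.
  by case: (leP (d / 2) (1 / 2)) => ?; lra.
by case: (leP (d / 2) (1 / 2)) => ?; lra.
Qed.

End Gauge.

(** * Area under linear maps *)

Section PlaneArea.
Variable R : realType.
Implicit Types (a b c k r s t x y : R) (z : plane R) (A B : set (plane R)).

Notation pmeasurable := (@measurable _ (R * R)%type).

(** The product sigma-algebra is given by measurable rectangles, so the open set is exhausted by the
    countably many rational boxes that it contains. *)
Lemma open_plane_measurable (U : set (plane R)) : open U -> pmeasurable U.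
Proof.
move=> oU.
pose box (q : (rat * rat) * (rat * rat)) : set (plane R) :=
  `]ratr q.1.1, ratr q.1.2[%classic `*` `]ratr q.2.1, ratr q.2.2[%classic.
pose F q := [set z | box q `<=` U /\ box q z].
have -> : U = \bigcup_q F q.
  apply/seteqP; split=> [[x y] Uz|z [q _] [] h]; last exact: h.
  have [[P Q]/= [hP hQ] PQ] : nbhs (x, y) U by exact: open_nbhs_nbhs.
  move: hP hQ => /nbhs_ballP[d /= d0 hP] /nbhs_ballP[e /= e0 hQ].
  have [q1 /[!in_itv]/= /andP[q11 q12]] := @rat_in_itvoo R (x - d) x ltac:(lra).
  have [q2 /[!in_itv]/= /andP[q21 q22]] := @rat_in_itvoo R x (x + d) ltac:(lra).
  have [q3 /[!in_itv]/= /andP[q31 q32]] := @rat_in_itvoo R (y - e) y ltac:(lra).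
  have [q4 /[!in_itv]/= /andP[q41 q42]] := @rat_in_itvoo R y (y + e) ltac:(lra).
  exists ((q1, q2), (q3, q4)) => //; split; last first.
    by split; rewrite /= in_itv/=; apply/andP.
  move=> [u v] []; rewrite /= !in_itv/= => /andP[u1 u2] /andP[v1 v2].
  apply: (PQ (u, v)); split=> /=.
    by apply: hP; rewrite /ball /= ltr_norml; apply/andP; split; lra.
  by apply: hQ; rewrite /ball /= ltr_norml; apply/andP; split; lra.
apply: countable_bigcupT_measurable => [|q]; first exact: countableP.
have [h|h] := pselect (box q `<=` U); last first.
  by rewrite (_ : F q = set0) ?measurable0//; apply/seteqP; split=> z [].
rewrite (_ : F q = box q); last by apply/seteqP; split=> z // [].
by apply: measurableX; exact: measurable_itv.
Qed.

Lemma closed_plane_measurable A : closed A -> pmeasurable A.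
Proof.
by move=> cA; rewrite -[A]setCK; apply: measurableC; apply: open_plane_measurable;
  exact: closed_openC.
Qed.

(** The pushforward under the affine map, scaled by [a], agrees with Lebesgue measure on half-open
    intervals, hence everywhere. *)
Lemma lebesgue_affine a k (A : set R) : 0 < a -> measurable A ->
  lebesgue_measure ((fun y => a * y + k) @^-1` A) =
  ((a^-1)%:E * lebesgue_measure A)%E.
Proof.
move=> a0 mA; pose f : measurableTypeR R -> measurableTypeR R := fun y => a * y + k.
rewrite -/f.
have mf : measurable_fun [set: measurableTypeR R] f.
  exact: measurable_realfun.measurable_funD.
have an0 : 0 <= a by exact: ltW.
pose nu : measure (measurableTypeR R) R := pushforward (@lebesgue_measure R) f.
pose mu : measure (measurableTypeR R) R := mscale (NngNum an0) (nu mf).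
have : lebesgue_measure A = mu A.
  apply: (@lebesgue_measure_unique R mu) => // X [[x y] _ <-] /=.
  rewrite /mu /mscale /= /nu /= /pushforward.
  have -> : f @^-1` `]x, y] = `](x - k) / a, (y - k) / a]%classic.
    apply/seteqP; split=> z; rewrite /f /= !in_itv /= ltr_pdivrMr// ler_pdivlMr//;
      rewrite ltrBlDr lerBrDr mulrC //.
  rewrite !lebesgue_measure_itv /= !lte_fin ltr_pM2r ?invr_gt0// ltrD2r.
  case: ifP => _; last by rewrite mule0.
  rewrite -[LHS]/((y - x)%:E) -[RHS]/((a * ((y - k) / a - (x - k) / a))%:E).
  by congr EFin; field; rewrite gt_eqF.
rewrite /mu /mscale /= /nu /= /pushforward => ->.
by rewrite muleA -EFinM mulVf ?mul1e// gt_eqF.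
Qed.

(** Fubini: every vertical section of B is an affine preimage of that of A. This covers vertical
    shears and dilations, from which the other linear maps are composed. *)
Lemma area_xsection a (g : R -> R) A B : 0 < a -> pmeasurable A -> pmeasurable B ->
  (forall x y, B (x, y) <-> A (x, a * y + g x)) ->
  area B = ((a^-1)%:E * area A)%E.
Proof.
move=> a0 mA mB h; rewrite /area /product_measure1.
rewrite -ge0_integralZl//; last 2 first.
- exact: measurable_fun_xsection.
- by rewrite lee_fin invr_ge0 ltW.
apply: eq_integral => x _ /=.
rewrite -(@lebesgue_affine a (g x))//; last exact: measurable_xsection.
congr lebesgue_measure; apply/seteqP; split=> y; rewrite /xsection /= !inE.
  by move/h.
by move/h.
Qed.

Definition lin_map a b c k (z : plane R) : plane R :=
  (a * z.1 + b * z.2, c * z.1 + k * z.2).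

Lemma lin_map_measurable a b c k A : pmeasurable A ->
  pmeasurable (lin_map a b c k @^-1` A).
Proof.
move=> mA; rewrite -[X in measurable X]setTI.
have h (x y : R) : measurable_fun [set: R * R] (fun z : R * R => x * z.1 + y * z.2).
  apply: measurable_realfun.measurable_funD; apply: measurable_realfun.measurable_funM => //.
by have := measurable_fun_pair (h a b) (h c k); exact.
Qed.

Lemma area_swap A : pmeasurable A -> area (lin_map 0 1 1 0 @^-1` A) = area A.
Proof.
move=> mA.
pose T := (measurableTypeR R * measurableTypeR R)%type.
pose f : T -> T := lin_map 0 1 1 0.
have mf : measurable_fun [set: T] f.
  by move=> _ Y mY; rewrite setTI; exact: lin_map_measurable.
pose mu : measure T R := pushforward (@lebesgue_measure R \x @lebesgue_measure R)%E f.
have := @product_measure_unique _ _ _ _ R lebesgue_measure lebesgue_measure (mu mf).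
move=> h; rewrite /area; symmetry; rewrite [LHS]h//.
move=> X Y mX mY; rewrite /mu /= /pushforward.
have -> : lin_map 0 1 1 0 @^-1` (X `*` Y) = Y `*` X.
  by apply/seteqP; split=> -[x y]; rewrite /lin_map /= !(mul0r, mul1r, add0r, addr0) => -[].
by rewrite product_measure1E// muleC.
Qed.

Lemma lin_map_preimage a b c k A (f g : plane R -> plane R) :
  (forall z, g (f z) = lin_map a b c k z) ->
  f @^-1` (g @^-1` A) = lin_map a b c k @^-1` A.
Proof. by move=> h; apply/seteqP; split=> z /=; rewrite h. Qed.

Lemma area_lower a c A : 0 < a -> pmeasurable A ->
  area (lin_map 1 0 c a @^-1` A) = ((a^-1)%:E * area A)%E.
Proof.
move=> a0 mA; apply: (@area_xsection _ ( *%R c)) => //.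
  exact: lin_map_measurable.
by move=> x y; rewrite /lin_map /= mul1r mul0r addr0 addrC.
Qed.

Lemma area_upper a b A : 0 < a -> pmeasurable A ->
  area (lin_map a b 0 1 @^-1` A) = ((a^-1)%:E * area A)%E.
Proof.
move=> a0 mA; have mS := lin_map_measurable 0 1 1 0 mA.
have mL := lin_map_measurable 1 0 b a mS.
rewrite -(area_swap mA) -(area_lower b a0 mS) -(area_swap mL).
congr area; symmetry; apply/seteqP; split=> -[x y];
  by rewrite /lin_map /= !(mul0r, mul1r, add0r, addr0) [a * x + _]addrC.
Qed.

Lemma area_scale a A : 0 < a -> pmeasurable A ->
  area (lin_map a 0 0 a @^-1` A) = ((a ^- 2)%:E * area A)%E.
Proof.
move=> a0 mA.
rewrite -(@lin_map_preimage a 0 0 a A (lin_map a 0 0 1) (lin_map 1 0 0 a)).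
  rewrite area_upper//; last exact: lin_map_measurable.
  by rewrite area_lower// muleA -EFinM -expr2 exprVn.
by move=> [x y]; rewrite /lin_map /=; congr pair; ring.
Qed.

(** A rotation is a product of three shears with parameters [tan (t / 2)], [sin t], [tan (t / 2)] up
    to sign, and each shear preserves area. *)
Lemma area_rotation_aux t A : cos (t / 2) != 0 -> pmeasurable A ->
  area (lin_map (cos t) (- sin t) (sin t) (cos t) @^-1` A) = area A.
Proof.
move=> c0 mA; set u := sin (t / 2) / cos (t / 2).
have ht : t = t / 2 + t / 2 by lra.
have hc : 1 - u * sin t = cos t.
  rewrite ht sinD cosD /u -[X in X - _ = _](cos2Dsin2 (t / 2)); field; exact: c0.
have hs : u + u * cos t = sin t.
  have -> : u + u * cos t = u * (1 + cos t) by ring.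
  rewrite ht sinD cosD -[X in _ * (X + _)](cos2Dsin2 (t / 2)) /u; field; exact: c0.
pose f := lin_map 1 (- u) 0 1; pose g := lin_map 1 0 (sin t) 1.
rewrite -(@lin_map_preimage _ _ _ _ A (g \o f) f); last first.
  move=> [x y]; rewrite /f /g /lin_map /= -{3}hs -hc; congr pair; ring.
rewrite (_ : (g \o f) @^-1` (f @^-1` A) = f @^-1` (g @^-1` (f @^-1` A)))//.
have m1 : pmeasurable (f @^-1` A) by exact: lin_map_measurable.
have m2 : pmeasurable (g @^-1` (f @^-1` A)) by exact: lin_map_measurable.
by rewrite area_upper// area_lower// area_upper// invr1 !mul1e.
Qed.

Definition rotation t := lin_map (cos t) (- sin t) (sin t) (cos t).

Lemma rotationD s t z : rotation s (rotation t z) = rotation (s + t) z.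
Proof.
by case: z => x y; rewrite /rotation /lin_map /= cosD sinD; congr pair; ring.
Qed.

Lemma rotation0 z : rotation 0 z = z.
Proof. by case: z => x y; rewrite /rotation /lin_map /= cos0 sin0; congr pair; ring. Qed.

Lemma rotation_uvec s r t : rotation s (r *: uvec t) = r *: uvec (t + s).
Proof.
by rewrite /rotation /lin_map /= /uvec scale_pairE cosD sinD /GRing.scale /=;
  congr pair; ring.
Qed.

Lemma area_rotation t A : pmeasurable A -> area (rotation t @^-1` A) = area A.
Proof.
move=> mA; have [c0|c0] := eqVneq (cos (t / 2)) 0; last exact: area_rotation_aux.
(* When [tan (t / 2)] is undefined, rotate twice by [t / 2]. *)
have c1 : cos (t / 2 / 2) != 0.
  apply/eqP; move: c0; set u := t / 2 / 2; have -> : t / 2 = u + u by rewrite /u; lra.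
  by rewrite cosD => h1 h2; have := cos2Dsin2 u; move: h1; rewrite h2; lra.
have -> : rotation t @^-1` A = rotation (t / 2) @^-1` (rotation (t / 2) @^-1` A).
  by apply/seteqP; split=> z /=; rewrite rotationD -splitr.
rewrite /rotation area_rotation_aux//; first exact: area_rotation_aux.
exact: lin_map_measurable.
Qed.

End PlaneArea.

(** * Angular sectors and their areas *)

Section Sectors.
Variable R : realType.
Implicit Types (a b c k r s t x y : R) (z : plane R) (A B : set (plane R)).
Implicit Types (N M : plane R -> R).

Notation pmeasurable := (@measurable _ (R * R)%type).

(** Half-open, and without the origin, so that consecutive sectors are disjoint and one full turn
    gives exactly the punctured plane. *)
Definition sector a b : set (plane R) :=
  [set z | exists r t, [/\ 0 < r, a <= t < b & z = r *: uvec t]].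

Lemma sectorU a b c : a <= b -> b <= c -> sector a c = sector a b `|` sector b c.
Proof.
move=> ab bc; apply/seteqP; split=> [z [r [t [r0 /andP[t1 t2] ->]]]|z].
  have [tb|tb] := ltP t b; [left|right]; exists r, t; split=> //.
    by rewrite t1.
  by rewrite tb.
by move=> [|] [r [t [r0 /andP[t1 t2] ->]]]; exists r, t; split=> //; apply/andP; split; lra.
Qed.

Lemma sector_disjoint a b c : a <= b -> b <= c -> c <= a + 2 * pi ->
  sector a b `&` sector b c = set0.
Proof.
move=> ab bc ca; apply/seteqP; split=> // z [].
move=> [r [t [r0 /andP[t1 t2] ->]]] [r' [t' [r'0 /andP[t1' t2']]]].
move=> /(polar_inj r0 r'0)[_ /(@uvec_inj _ a) h]; suff: t = t' by lra.
by apply: h; apply/andP; split; lra.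
Qed.

(** Below a half turn the sector is the intersection of a closed and an open half-plane, expressed
    by the signs of two cross products. *)
Lemma sector_small_measurable a b : b < a + pi -> pmeasurable (sector a b).
Proof.
move=> ba; have [ab|ab] := leP a b; last first.
  rewrite (_ : sector a b = set0) ?measurable0//; apply/seteqP; split=> // z.
  by move=> [r [t [_ /andP[t1 t2] _]]]; lra.
pose f z := cross (uvec a) z; pose g z := cross z (uvec b).
have cf : continuous f.
  move=> z; apply: cvgB; apply: cvgM; try exact: cvg_cst; [exact: cvg_snd|exact: cvg_fst].
have cg : continuous g.
  move=> z; apply: cvgB; apply: cvgM; try exact: cvg_cst; [exact: cvg_fst|exact: cvg_snd].
have -> : sector a b = f @^-1` [set x | 0 <= x] `&` g @^-1` [set x | 0 < x].
  apply/seteqP; split=> [z [r [t [r0 /andP[t1 t2] ->]]]|z [/= fz gz]].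
    split; rewrite /f /g /= ?crossZr ?crossZl ?cross_uvec.
      by rewrite mulr_ge0 ?(ltW r0)// sin_ge0_pi//; apply/andP; split; lra.
    by rewrite mulr_gt0// sin_gt0_pi//; apply/andP; split; lra.
  have z0 : z != 0 by apply: contraTneq gz => ->; rewrite /g /cross /= !mul0r subrr ltxx.
  have [t [/andP[t1 t2] zE]] := polar_decomp a z0; have n0 := enorm_gt0 z0.
  move: fz gz; rewrite zE /f /g crossZl crossZr !cross_uvec pmulr_rge0// pmulr_rgt0//.
  move=> h1 h2; exists (enorm z), t; split=> //; rewrite t1/= ltNge; apply/negP => bt.
  have [ta|ta] := leP t (a + pi).
    have := @sin_ge0_pi _ (t - b); have -> : sin (t - b) = - sin (b - t) by rewrite -sinN opprB.
    move=> /(_ ltac:(apply/andP; split; lra)).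
    by rewrite oppr_ge0 leNgt h2.
  have := @sin_gt0_pi _ (- (t - a) + pi *+ 2); rewrite mulr2n.
  by move=> /(_ ltac:(apply/andP; split; lra)); rewrite -mulr2n sinD2pi sinN oppr_gt0 ltNge h1.
apply: measurableI.
  by apply: closed_plane_measurable; apply: closed_comp => [w _|]; [exact: cf|exact: closed_ge].
by apply: open_plane_measurable; apply: open_comp => [w _|]; [exact: cg|exact: open_gt].
Qed.

Lemma sector_measurable a b : b <= a + 2 * pi -> pmeasurable (sector a b).
Proof.
move=> ba; have pi0 := pi_gt0 R; have [ab|ab] := leP a b; last first.
  by apply: sector_small_measurable; lra.
(* Three equal pieces of at most a full turn have openings below [pi]. *)
pose d := (b - a) / 3; have d0 : 0 <= d by rewrite /d; lra.
have h1 : a <= a + d by lra.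
have h2 : a + d <= a + d + d by lra.
have h3 : a + d + d <= b by rewrite /d; lra.
rewrite (sectorU h1 (le_trans h2 h3)) (sectorU h2 h3).
by apply: measurableU; [|apply: measurableU]; apply: sector_small_measurable;
  rewrite /d; lra.
Qed.

Lemma sector_full a : sector a (a + 2 * pi) = ~` [set 0].
Proof.
apply/seteqP; split=> [z [r [t [r0 _ ->]]] /= /eqP|z /= /eqP z0].
  by rewrite scaler_eq0 (gt_eqF r0) (negbTE (uvec_neq0 t)).
have [t [ht zE]] := polar_decomp a z0; exists (enorm z), t.
by split=> //; exact: enorm_gt0.
Qed.

Lemma sector_rotation s a b : rotation s @^-1` sector a b = sector (a - s) (b - s).
Proof.
apply/seteqP; split=> [z [r [t [r0 ht e]]]|z [r [t [r0 ht ->]]]].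
  exists r, (t - s); split=> //; first by rewrite lerD2r ltrD2r.
  by rewrite -(rotation0 z) -(addNr s) -rotationD e rotation_uvec.
exists r, (t + s); split=> //; last exact: rotation_uvec.
by rewrite -lerBlDr -ltrBrDr.
Qed.

Definition sarea N a b : R := fine (area (body N `&` sector a b)).

Lemma body_measurable N : gauge N -> pmeasurable (body N).
Proof. by move=> hN; apply: closed_plane_measurable; exact: body_closed. Qed.

Lemma bodyI_measurable N a b : gauge N -> b <= a + 2 * pi ->
  pmeasurable (body N `&` sector a b).
Proof.
by move=> hN ab; apply: measurableI; [exact: body_measurable|exact: sector_measurable].
Qed.

Lemma le_area A B : pmeasurable A -> pmeasurable B -> A `<=` B -> (area A <= area B)%E.
Proof. by move=> mA mB AB; apply: le_measure; rewrite ?inE. Qed.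

Lemma area_ge0 A : pmeasurable A -> (0 <= area A)%E.
Proof. by move=> mA; exact: measure_ge0. Qed.

Lemma areaU A B : pmeasurable A -> pmeasurable B -> A `&` B = set0 ->
  area (A `|` B) = (area A + area B)%E.
Proof. by move=> mA mB AB; apply: measureU. Qed.

Lemma area_rect a b c k :
  area (`[a, b]%classic `*` `[c, k]%classic) = ((Num.max (b - a) 0 * Num.max (k - c) 0)%:E)%E.
Proof.
have len x y : lebesgue_measure (`[x, y]%classic : set R) = (Num.max (y - x) 0)%:E.
  rewrite lebesgue_measure_itv /= lte_fin; case: (ltP x y) => xy.
    by rewrite -EFinD; congr EFin; apply/esym/max_idPl; lra.
  by congr EFin; apply/esym/max_idPr; lra.
by rewrite /area product_measure1E// EFinM; congr (_ * _)%E; exact: len.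
Qed.

Lemma body_area_fin N A : gauge N -> pmeasurable A -> A `<=` body N ->
  area A \is a fin_num.
Proof.
move=> hN mA AN; have [m [m0 hm]] := gauge_lower hN.
rewrite ge0_fin_numE ?area_ge0//.
apply: le_lt_trans (@le_area _ (`[- m^-1, m^-1]%classic `*` `[- m^-1, m^-1]%classic) _ _ _) _ => //.
- by apply: measurableX; exact: measurable_itv.
- move=> z /AN; rewrite /body /= => hz; have h : enorm z <= m^-1.
    by rewrite -[_^-1]mul1r ler_pdivlMr// mulrC; exact: le_trans (hm z) hz.
  have [h1 h2] := coord_le_enorm z.
  by split; rewrite /= in_itv /= -ler_norml (le_trans _ h).
by rewrite area_rect ltry.
Qed.

Lemma sareaE N a b : gauge N -> b <= a + 2 * pi ->
  area (body N `&` sector a b) = (sarea N a b)%:E.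
Proof.
move=> hN ab; rewrite fineK//; apply: (body_area_fin hN); last exact: subIsetl.
exact: bodyI_measurable.
Qed.

Lemma sarea_ge0 N a b : gauge N -> b <= a + 2 * pi -> 0 <= sarea N a b.
Proof. by move=> hN ab; rewrite fine_ge0// area_ge0//; exact: bodyI_measurable. Qed.

Lemma sarea_cat N a b c : gauge N -> a <= b -> b <= c -> c <= a + 2 * pi ->
  sarea N a c = sarea N a b + sarea N b c.
Proof.
move=> hN ab bc ca.
have ba : b <= a + 2 * pi by lra.
have cb : c <= b + 2 * pi by lra.
have mb := bodyI_measurable hN ba; have mc := bodyI_measurable hN cb.
apply/EFin_inj; rewrite EFinD -(sareaE hN ca) -(sareaE hN ba) -(sareaE hN cb).
rewrite -areaU//; first by rewrite (sectorU ab bc) setIUr.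
by rewrite setIACA (sector_disjoint ab bc ca) setI0.
Qed.

Lemma sarea_id N a : gauge N -> sarea N a a = 0.
Proof.
move=> hN; have aa : a <= a + 2 * pi by rewrite lerDl mulr_ge0// pi_ge0.
have := sarea_cat hN (lexx _) (lexx _) aa.
by move: (sarea _ _ _) => x; clear; lra.
Qed.

Lemma le_sarea N M a b : gauge N -> gauge M -> b <= a + 2 * pi ->
  (forall t, a <= t < b -> M (uvec t) <= N (uvec t)) -> sarea N a b <= sarea M a b.
Proof.
move=> hN hM ab h; rewrite -lee_fin -!sareaE//; apply: le_area.
- exact: bodyI_measurable.
- exact: bodyI_measurable.
move=> z [hz [r [t [r0 ht zE]]]]; split; last by exists r, t.
move: hz; rewrite /body /= zE !gaugeZ ?(ltW r0)//; apply: le_trans.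
by rewrite ler_pM2l// h.
Qed.

Lemma sarea_total N a : gauge N -> area (body N) = (sarea N a (a + 2 * pi))%:E.
Proof.
move=> hN; rewrite -sareaE// sector_full.
have -> : body N = (body N `&` ~` [set 0]) `|` [set 0].
  apply/seteqP; split=> [z hz|z]; first by have [->|/eqP z0] := eqVneq z 0; [right|left].
  by move=> [[]//|->]; exact: interior_subset (body0 hN).
have m0 : pmeasurable [set (0 : plane R)].
  by apply: closed_plane_measurable; apply: accessible_closed_set1; exact: hausdorff_accessible (@norm_hausdorff _ _).
rewrite areaU//; last 2 first.
- by apply: measurableI; [exact: body_measurable|exact: measurableC].
- by apply/seteqP; split=> // z [[_]].
have -> : [set 0] = `[(0 : R), 0]%classic `*` `[(0 : R), 0]%classic.
  apply/seteqP; split=> [z ->|[x y]]; first by split; rewrite /= in_itv /= lexx.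
  by rewrite !set_itv1 => -[/= -> ->].
rewrite area_rect subrr maxxx mulr0 adde0; congr area.
apply/seteqP; split=> z.
  by move=> [h1 h2]; split=> //; left.
by move=> [[[h1 h2]|h1] h3].
Qed.

End Sectors.

(** * The polar area formula in differential form *)

Section PolarArea.
Variable R : realType.
Implicit Types (a b c d k r s t x y v : R) (z : plane R) (A B : set (plane R)).
Implicit Types (N M : plane R -> R).

Lemma bounded_multiples_eq0 x y : (forall n : nat, n%:R * `|x| <= y) -> x = 0.
Proof.
move=> h; apply/eqP; apply/negPn/negP => x0.
have x1 : 0 < `|x| by rewrite normr_gt0.
have := archi_boundP (divr_ge0 (le_trans (mulr_ge0 (ler0n R 0) (normr_ge0 x)) (h 0%N)) (ltW x1)).
by rewrite ltr_pdivrMr// ltNge h.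
Qed.

(** Cauchy's equation on an interval: nonnegativity makes [f] monotone, so comparison at the
    multiples of [L / n] puts [f] within [f L / n] of the linear function for every [n]. *)
Lemma additive_ge0_linear (f : R -> R) (L x : R) : 0 < L ->
  (forall y w, 0 <= y -> 0 <= w -> y + w <= L -> f (y + w) = f y + f w) ->
  (forall y, 0 <= y -> y <= L -> 0 <= f y) ->
  0 <= x -> x <= L -> f x = f L / L * x.
Proof.
move=> L0 fD f_ge0 x0 x1.
have fM y (n : nat) : 0 <= y -> n%:R * y <= L -> f (n%:R * y) = n%:R * f y.
  move=> y0; elim: n => [|n IH] h.
    rewrite !mul0r; have := fD 0 0 (lexx _) (lexx _); rewrite addr0.
    by move=> /(_ (ltW L0)); clear; lra.
  have e (w : R) : n.+1%:R * w = n%:R * w + w by rewrite -[n.+1%:R]natr1; ring.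
  by move: h; rewrite !e => h; rewrite fD ?mulr_ge0// IH//; lra.
have fmono y w : 0 <= y -> y <= w -> w <= L -> f y <= f w.
  move=> y0 yw w1; have -> : w = y + (w - y) by lra.
  by rewrite fD ?lerDl ?f_ge0//; lra.
apply/eqP; rewrite -subr_eq0; apply/eqP.
apply: (@bounded_multiples_eq0 _ (f L)) => n.
have fpos := f_ge0 _ (ltW L0) (lexx L).
have [->|n0] := posnP n; first by rewrite mul0r.
have n1 : 0 < n%:R :> R by rewrite ltr0n.
pose u : R := L / n%:R; have u0 : 0 < u by rewrite divr_gt0.
have nu : n%:R * u = L by rewrite /u; field; rewrite gt_eqF.
have fu : n%:R * f u = f L by rewrite -nu fM ?nu// ltW.
have cst : f L / L = f u / u.
  by rewrite -fu -nu; field; rewrite !gt_eqF.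
have fu0 : 0 <= f u by rewrite -(pmulr_rge0 _ n1) fu.
have [->|x2] := eqVneq x L.
  by rewrite divfK ?gt_eqF// subrr normr0 mulr0.
have {x2} x2 : x < L by rewrite lt_neqAle x2.
have /andP[k1 k2] := truncn_itv (divr_ge0 x0 (ltW u0)).
move: (Num.truncn _) k1 k2 => k; rewrite ler_pdivlMr// ltr_pdivrMr// => k1 k2.
have kn : (k < n)%N.
  by rewrite -(ltr_nat R) -(ltr_pM2r u0) nu; exact: le_lt_trans k1 x2.
have kn' : k.+1%:R * u <= L by rewrite -nu ler_pM2r// ler_nat.
have ku0 : 0 <= k%:R * u by rewrite mulr_ge0// ltW.
have e w : k.+1%:R * w = k%:R * w + w by rewrite -[k.+1%:R]natr1 mulrDl mul1r.
have A1 : k%:R * f u <= f x.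
  rewrite -fM ?(ltW u0)//; first exact: fmono.
  exact: le_trans k1 x1.
have A2 : f x <= k.+1%:R * f u.
  rewrite -fM ?(ltW u0)//; apply: fmono => //; exact: ltW.
have xu : f L / L * x = x / u * f u by rewrite cst; field; rewrite gt_eqF.
have A3 : k%:R * f u <= x / u * f u by rewrite ler_wpM2r// ler_pdivlMr.
have A4 : x / u * f u <= k.+1%:R * f u by rewrite ler_wpM2r// ler_pdivrMr// ltW.
rewrite xu -fu ler_pM2l//; move: A2 A4; rewrite e ler_norml => A2 A4.
by apply/andP; split; move: A1 A2 A3 A4; clear; lra.
Qed.

Lemma is_derive_squeeze (F : R -> R) t v :
  (forall e, 0 < e -> exists d, 0 < d /\
     forall x, 0 < `|x| < d -> `|F (t + x) - F t - v * x| <= e * `|x|) ->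
  is_derive t 1 F v.
Proof.
move=> h.
have cv : (fun x : R => x^-1 *: (F (x *: (1 : R) + t) - F t)) @ 0^' --> v.
  apply/cvgrPdist_le => e e0; have [d [d0 hd]] := h e e0.
  near=> x.
  have x0 : x != 0 by near: x; exact: nbhs_dnbhs_neq.
  have xd : `|x| < d.
    by near: x; apply: dnbhs0_lt.
  have := hd x; rewrite normr_gt0 x0 xd => /(_ isT) hx.
  rewrite /GRing.scale /= mulr1 [x + t]addrC -normrN opprB.
  have -> : x^-1 * (F (t + x) - F t) - v = x^-1 * (F (t + x) - F t - v * x).
    by rewrite [in RHS]mulrBr mulrCA mulVf// mulr1.
  by rewrite normrM normfV ler_pdivrMl ?normr_gt0// [leRHS]mulrC.
apply: DeriveDef.
  by apply: cvgP; exact: cv.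
exact: cvg_lim cv.
Unshelve. all: by end_near. Qed.

Lemma sarea_rotate s a b : b <= a + 2 * pi ->
  sarea (@enorm R) (a - s) (b - s) = sarea (@enorm R) a b.
Proof.
move=> ab; rewrite /sarea -(area_rotation s (bodyI_measurable (gauge_enorm R) ab)).
congr (fine (area _)); rewrite preimage_setI sector_rotation; congr (_ `&` _).
apply/seteqP; split=> -[x y];
  rewrite /body /= /rotation /lin_map /= /enorm /dot /=;
  rewrite -!expr2 !(sqrrD, exprMn) ; have := cos2Dsin2 s => e;
  suff -> : cos s ^+ 2 * x ^+ 2 + cos s * x * (- sin s * y) *+ 2 +
    (- sin s) ^+ 2 * y ^+ 2 + (sin s ^+ 2 * x ^+ 2 + sin s * x * (cos s * y) *+ 2 +
    cos s ^+ 2 * y ^+ 2) = x ^+ 2 + y ^+ 2 by [].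
  by rewrite -[RHS]mul1r -e; ring.
by rewrite -[RHS]mul1r -e; ring.
Qed.

(* Its value is 1/2, but only its positivity matters: every area is compared with
   another one. *)
Definition polar_cst : R := sarea (@enorm R) 0 (2 * pi) / (2 * pi).

(** Rotation invariance makes the area of a disc sector an additive function of its opening. *)
Lemma sarea_disc a b : a <= b -> b <= a + 2 * pi ->
  sarea (@enorm R) a b = polar_cst * (b - a).
Proof.
move=> ab ba; rewrite -(sarea_rotate a ba) subrr.
have : b - a <= 2 * pi by lra.
have : 0 <= b - a by lra.
move: (b - a) => x x0 x1 {a b ab ba}; have pi0 := pi_gt0 R.
pose f y := sarea (@enorm R) 0 y.
have gE := gauge_enorm R.
have fD y w : 0 <= y -> 0 <= w -> y + w <= 2 * pi -> f (y + w) = f y + f w.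
  move=> y0 w0 yw; have h1 : y <= y + w by rewrite lerDl.
  have h2 : y + w <= 0 + 2 * pi by rewrite add0r.
  rewrite /f (sarea_cat gE y0 h1 h2) -(@sarea_rotate y y) ?subrr.
    by rewrite addrAC subrr add0r.
  by rewrite add0r in h2; apply: le_trans h2 _; rewrite lerDr.
rewrite -/(f x) (@additive_ge0_linear f (2 * pi)) ?mulr_gt0// => y y0 yL.
by apply: sarea_ge0 => //; rewrite add0r.
Qed.

Lemma polar_cst_gt0 : 0 < polar_cst.
Proof.
have pi0 := pi_gt0 R; have gE := gauge_enorm R.
rewrite divr_gt0//; last by lra.
have := sarea_total 0 gE; rewrite add0r => e; rewrite -lte_fin -e.
apply: lt_le_trans (@le_area _ (`[0, 1 / 2]%classic `*` `[0, 1 / 2]%classic) _ _ _ _).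
- by rewrite area_rect lte_fin subr0 (max_idPl _) ?mulr_gt0//; lra.
- by apply: measurableX; exact: measurable_itv.
- exact: body_measurable.
move=> [x y] [/=]; rewrite !in_itv /= => /andP[x0 x1] /andP[y0 y1].
rewrite /body /= -(@ler_pXn2r _ 2)// ?nnegrE ?enorm_ge0// enorm2 /dot /= expr1n.
nra.
Qed.

Lemma sarea_scale N k a b : gauge N -> 0 < k -> b <= a + 2 * pi ->
  sarea (fun z => k * N z) a b = k ^- 2 * sarea N a b.
Proof.
move=> hN k0 ba; rewrite /sarea (_ : k ^- 2 = fine (k ^- 2)%:E)// -fineM//; last first.
  by apply: (body_area_fin hN); [exact: bodyI_measurable|exact: subIsetl].
rewrite -area_scale//; last exact: bodyI_measurable.
have E z : lin_map k 0 0 k z = k *: z.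
  by case: z => x y; rewrite /lin_map /= !mul0r addr0 add0r.
congr (fine (area _)); apply/seteqP; split=> z.
  move=> [hz [s [t [s0 ht zE]]]]; split; first by rewrite /preimage E /body /= gaugeZ// ltW.
  by exists (k * s), t; rewrite mulr_gt0// E zE scalerA.
rewrite /= E => -[hz [s [t [s0 ht zE]]]]; split.
  by move: hz; rewrite /body /= gaugeZ// ltW.
exists (k^-1 * s), t; split; rewrite ?mulr_gt0 ?invr_gt0//.
by rewrite -scalerA -zE scalerA mulVf ?scale1r ?gt_eqF.
Qed.

Lemma sarea_scaled r a b : 0 < r -> a <= b -> b <= a + 2 * pi ->
  sarea (fun z => r * enorm z) a b = polar_cst * r ^- 2 * (b - a).
Proof.
by move=> r0 ab ba; rewrite sarea_scale// ?sarea_disc//; [ring|exact: gauge_enorm].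
Qed.

Lemma sarea_le N a b v : gauge N -> a <= b -> b <= a + 2 * pi -> 0 < v ->
  (forall t, a <= t < b -> N (uvec t) ^- 2 <= v) ->
  sarea N a b <= polar_cst * v * (b - a).
Proof.
(* The body of [r * enorm] is the disc of squared radius [v], with which the sector is compared. *)
move=> hN ab ba v0 h; pose r := Num.sqrt v^-1.
have r0 : 0 < r by rewrite sqrtr_gt0 invr_gt0.
have r2 : r ^- 2 = v by rewrite /r sqr_sqrtr ?invrK// invr_ge0 ltW.
rewrite -r2 -sarea_scaled//; apply: le_sarea => //.
  exact: gauge_scale (gauge_enorm R) r0.
move=> t /h; rewrite enorm_uvec mulr1 -r2 lef_pV2 ?posrE ?exprn_gt0 ?gauge_uvec_gt0//.
by rewrite ler_pXn2r// nnegrE ltW// gauge_uvec_gt0.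
Qed.

Lemma sarea_ge N a b v : gauge N -> a <= b -> b <= a + 2 * pi ->
  (forall t, a <= t < b -> v <= N (uvec t) ^- 2) ->
  polar_cst * v * (b - a) <= sarea N a b.
Proof.
move=> hN ab ba h; have c0 := polar_cst_gt0.
have [v0|v0] := leP v 0.
  apply: le_trans (sarea_ge0 hN ba); rewrite mulr_le0_ge0 ?subr_ge0//.
  by rewrite mulr_ge0_le0// ltW.
pose r := Num.sqrt v^-1.
have r0 : 0 < r by rewrite sqrtr_gt0 invr_gt0.
have r2 : r ^- 2 = v by rewrite /r sqr_sqrtr ?invrK// invr_ge0 ltW.
rewrite -r2 -sarea_scaled//; apply: le_sarea => //.
  exact: gauge_scale (gauge_enorm R) r0.
move=> t /h; rewrite enorm_uvec mulr1 -r2 lef_pV2 ?posrE ?exprn_gt0 ?gauge_uvec_gt0//.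
by rewrite ler_pXn2r// nnegrE ltW// gauge_uvec_gt0.
Qed.

(** Over a short arc the body is squeezed between two discs whose squared radii are close to
    [N (uvec t) ^- 2], the squared distance of the boundary point. All later area estimates compare
    such derivatives. *)
Lemma sarea_is_derive N a t : gauge N -> a < t < a + 2 * pi ->
  is_derive t 1 (sarea N a) (polar_cst * N (uvec t) ^- 2).
Proof.
move=> hN /andP[t1 t2]; have c0 := polar_cst_gt0.
apply: is_derive_squeeze => e e0.
have cts : (fun s => N (uvec s) ^- 2) s @[s --> t] --> N (uvec t) ^- 2.
  apply: cvgV; first by rewrite expf_neq0// gt_eqF// gauge_uvec_gt0.
  by apply: cvgM; exact: gauge_uvec_continuous.
move/cvgrPdist_le : cts => /(_ (e / polar_cst)); rewrite divr_gt0// => /(_ isT).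
move=> /nbhs_ballP[d /= d0 hd].
pose m := Num.min d (Num.min (t - a) (a + 2 * pi - t)).
exists m; split; first by rewrite !lt_min; apply/and3P; split=> //; lra.
move=> x; rewrite !lt_min => /and4P[x0 xd xa xb].
set v := N (uvec t) ^- 2.
have v0 : 0 < v by rewrite invr_gt0 exprn_gt0// gauge_uvec_gt0.
have dist_le s : `|s - t| <= `|x| -> `|v - N (uvec s) ^- 2| <= e / polar_cst.
  by move=> h; apply: hd; rewrite /ball /= distrC; exact: le_lt_trans h xd.
have ce : polar_cst * (e / polar_cst) = e by field; rewrite gt_eqF.
have key p q : p <= q -> q <= p + 2 * pi ->
    (forall s, p <= s < q -> `|v - N (uvec s) ^- 2| <= e / polar_cst) ->
    `|sarea N p q - polar_cst * v * (q - p)| <= e * (q - p).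
  move=> pq qp h; rewrite ler_norml; apply/andP; split.
    rewrite lerBrDl; apply: le_trans (@sarea_ge _ _ _ (v - e / polar_cst) _ _ _ _) => //.
      by rewrite [polar_cst * (v - _)]mulrBr ce mulrBl.
    by move=> s /h; rewrite ler_norml => /andP[_]; lra.
  rewrite lerBlDr; apply: le_trans (@sarea_le _ _ _ (v + e / polar_cst) _ _ _ _ _) _ => //.
  - by rewrite addr_gt0// divr_gt0.
  - by move=> s /h; rewrite ler_norml => /andP[]; lra.
  by rewrite [polar_cst * (v + _)]mulrDr ce mulrDl addrC.
have [xp|xn] := leP 0 x.
  move: (x0) (xd) (xa) (xb) dist_le; rewrite ger0_norm// => {}x0 {}xd {}xa {}xb dist_le.
  rewrite (@sarea_cat _ _ a t (t + x))//; try lra.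
  rewrite [sarea N a t + _]addrC addrK; have := key t (t + x).
  rewrite [t + x - t]addrAC subrr add0r; apply; try lra.
  by move=> s /andP[s1 s2]; apply: dist_le; rewrite ler_norml; apply/andP; split; lra.
move: (x0) (xd) (xa) (xb) dist_le; rewrite ltr0_norm// => {}x0 {}xd {}xa {}xb dist_le.
rewrite (@sarea_cat _ _ a (t + x) t)//; try lra.
have := key (t + x) t; rewrite opprD addrA subrr add0r.
rewrite -normrN => h; rewrite [X in `|X|](_ : _ = - (sarea N (t + x) t - polar_cst * v * - x)); last by ring.
apply: h; try lra.
by move=> s /andP[s1 s2]; apply: dist_le; rewrite ler_norml; apply/andP; split; lra.
Qed.

(** The derivative is available inside the interval only; the mean value arguments need the
    endpoints as well, which a Lipschitz bound supplies. *)
Lemma sarea_continuous N a : gauge N ->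
  {within `[a, a + 2 * pi], continuous (sarea N a)}.
Proof.
move=> hN; have [m [m0 hm]] := gauge_lower hN; have c0 := polar_cst_gt0.
have lip s t : a <= s -> s <= t -> t <= a + 2 * pi ->
    0 <= sarea N a t - sarea N a s <= polar_cst * m ^- 2 * (t - s).
  move=> as_ st ta; rewrite (@sarea_cat _ _ a s t)// [sarea N a s + _]addrC addrK.
  apply/andP; split; first by apply: sarea_ge0 => //; lra.
  apply: sarea_le => //; [by lra|by rewrite invr_gt0 exprn_gt0|].
  move=> u _ /=; rewrite lef_pV2 ?posrE ?exprn_gt0//; last exact: gauge_uvec_gt0.
  have := hm (uvec u); rewrite enorm_uvec mulr1 => h.
  by apply: lerXn2r => //; rewrite nnegrE ltW// (lt_le_trans m0).
have ab : a < a + 2 * pi by have := pi_gt0 R; lra.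
apply/(continuous_within_itvP _ ab).
have L0 : 0 < polar_cst * m ^- 2 by rewrite mulr_gt0// invr_gt0 exprn_gt0.
split.
- move=> t; rewrite in_itv /= => ht.
  apply: differentiable_continuous; apply/derivable1_diffP.
  by have := sarea_is_derive hN ht; case.
- apply/cvgrPdist_le => e e0; near=> t.
  have at_ : a < t by near: t; exact: nbhs_right_gt.
  have tb : t < a + 2 * pi by near: t; apply: nbhs_right_lt; have := pi_gt0 R; lra.
  have te : t < a + e / (polar_cst * m ^- 2) by near: t; apply: nbhs_right_lt; rewrite ltrDl divr_gt0.
  have := lip a t (lexx _) (ltW at_) (ltW tb) => /andP[h1 h2].
  rewrite distrC ger0_norm//; apply: le_trans h2 _.
  by rewrite mulrC -ler_pdivlMr//; lra.
apply/cvgrPdist_le => e e0; near=> t.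
have at_ : a < t by near: t; apply: nbhs_left_gt; have := pi_gt0 R; lra.
have tb : t < a + 2 * pi by near: t; exact: nbhs_left_lt.
have te : a + 2 * pi - e / (polar_cst * m ^- 2) < t by near: t; apply: nbhs_left_gt; rewrite ltrBlDr ltrDl divr_gt0.
have := lip t (a + 2 * pi) (ltW at_) (ltW tb) (lexx _) => /andP[h1 h2].
rewrite ger0_norm//; apply: le_trans h2 _.
by rewrite mulrC -ler_pdivlMr//; lra.
Unshelve. all: by end_near. Qed.

End PolarArea.

(** * Critical directions and descent along tangent lines *)

Section Descent.
Variable R : realType.
Implicit Types (a b c d e m r s t x y : R) (z u w : plane R).
Implicit Types (N M : plane R -> R).

Lemma ge0_derive_le (f df : R -> R) a b : a <= b ->
  {within `[a, b], continuous f} ->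
  (forall x, a < x < b -> is_derive x 1 f (df x)) ->
  (forall x, a < x < b -> 0 <= df x) -> f a <= f b.
Proof.
move=> ab cf hd h; apply: (@ger0_derive1_le_cc _ f a b) => //.
- by move=> x; rewrite in_itv /= => /hd[].
- by move=> x; rewrite in_itv /= => hx; rewrite derive1E (@derive_val _ _ _ _ _ _ _ (hd x hx)) h.
- by rewrite in_itv /= lexx.
- by rewrite in_itv /= ab lexx.
Qed.

Lemma exists_lt_both a b : 0 < a -> 0 < b -> exists x, [/\ 0 < x, x < a & x < b].
Proof.
by move=> a0 b0; exists (Num.min a b / 2); case: (leP a b) => ?; split; lra.
Qed.

Lemma sin_le_id x : 0 <= x -> sin x <= x.
Proof.
move=> x0; rewrite -subr_ge0 -[leLHS](subrr 0) -{2}(sin0 R).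
apply: (@ge0_derive_le (fun y => y - sin y) (fun y => 1 - cos y)) => //.
apply: continuous_subspaceT => y; apply: cvgB; [exact: cvg_id|exact: continuous_sin].
Qed.

Lemma sign_cos_sin e t : e ^+ 2 = 1 -> cos (e * t) = cos t /\ sin (e * t) = e * sin t.
Proof.
by move=> /eqP; rewrite sqrf_eq1 => /orP[] /eqP ->; rewrite ?mul1r// !mulN1r cosN sinN.
Qed.

Definition uperp t : plane R := (- sin t, cos t).

Lemma uvecD s t : uvec (s + t) = cos t *: uvec s + sin t *: uperp s.
Proof.
rewrite /uvec /uperp !scale_pairE cosD sinD; congr pair => /=; ring.
Qed.

Lemma dot_uperp s t : dot (uperp s) (uvec t) = sin (t - s).
Proof. by rewrite /dot /= sinB; ring. Qed.

Lemma plane_decomp t z : z = dot z (uvec t) *: uvec t + dot z (uperp t) *: uperp t.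
Proof.
case: z => x y; rewrite /dot /uvec /uperp /= !scale_pairE; have h := cos2Dsin2 t.
by congr pair => /=; rewrite -[LHS]mulr1 -h; ring.
Qed.

(* The line through the boundary point at angle [t] perpendicular to [uvec t]
   supports the body. *)
Definition critical N t := forall z, N (uvec t) * dot z (uvec t) <= N z.

Definition tline e t x : plane R := uvec t + (e * x) *: uperp t.

(* One of the two ways ([e = 1] or [e = -1]) of not being critical; the distance
   to 0 along the boundary then increases in the direction [e]. *)
Definition descends e N t := exists x, 0 < x /\ N (tline e t x) < N (uvec t).

Lemma tline0 e t : tline e t 0 = uvec t.
Proof. by rewrite /tline mulr0 scale0r addr0. Qed.

Lemma tlineN e t x : tline e t (- x) = tline (- e) t x.
Proof. by rewrite /tline mulrN mulNr. Qed.

Lemma dot_tline e t x : dot (tline e t x) (uvec t) = 1.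
Proof.
by rewrite /tline dotDl dotZl dot_uperp dot_uvec subrr cos0 sin0 mulr0 addr0.
Qed.

Lemma tline_neq0 e t x : tline e t x != 0.
Proof.
apply: contra_eq_neq (dot_tline e t x) => ->.
by rewrite /dot /= !mul0r addr0 eq_sym oner_neq0.
Qed.

Lemma continuous_tline e t : continuous (tline e t).
Proof.
move=> x; apply: cvgD; first exact: cvg_cst.
apply: cvgZr_tmp; apply: cvgM; [exact: cvg_cst|exact: cvg_id].
Qed.

Lemma uvec_tline e t x : e ^+ 2 = 1 -> cos x != 0 ->
  uvec (t + e * x) = cos x *: tline e t (tan x).
Proof.
move=> e1 c0; rewrite uvecD /tline scalerDr scalerA.
have [-> ->] := sign_cos_sin x e1; congr (_ + _ *: _).
by rewrite /tan mulrCA [cos x * _]mulrC divfK.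
Qed.

Lemma tline_convex N e t x y : gauge N -> x < 0 -> 0 < y ->
  (y - x) * N (uvec t) <= y * N (tline e t x) - x * N (tline e t y).
Proof.
move=> hN x0 y0; rewrite -gaugeZ ?subr_ge0//; last by rewrite ltW// (lt_trans x0).
rewrite -mulNr -gaugeZ ?(ltW y0)// -(gaugeZ (a := - x))// ?oppr_ge0 ?(ltW x0)//.
apply: le_trans (gaugeD _ _ hN); rewrite le_eqVlt; apply/orP; left; apply/eqP.
congr N; rewrite /tline !scalerDr !scalerA addrACA -!scalerDl.
rewrite (_ : y * (e * x) + - x * (e * y) = 0); last by ring.
by rewrite scale0r addr0.
Qed.

Lemma critical_tline N t : gauge N ->
  (forall x, N (uvec t) <= N (tline 1 t x)) -> critical N t.
Proof.
move=> hN h z; have [z0|z0] := leP (dot z (uvec t)) 0.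
  by apply: le_trans (gauge_ge0 z hN); rewrite mulr_ge0_le0// gauge_ge0.
have -> : z = dot z (uvec t) *: tline 1 t (dot z (uperp t) / dot z (uvec t)).
  rewrite {1}(plane_decomp t z) /tline scalerDr scalerA mul1r mulrCA mulfV ?mulr1//.
  by rewrite gt_eqF.
by rewrite gaugeZ ?(ltW z0)// mulrC dotZl dot_tline mulr1 ler_pM2l.
Qed.

Lemma critical_or_descends N t : gauge N ->
  [\/ critical N t, descends 1 N t | descends (- 1) N t].
Proof.
move=> hN; have [h|/existsNP[x /negP]] := pselect (forall x, N (uvec t) <= N (tline 1 t x)).
  by apply: Or31; exact: critical_tline.
rewrite -ltNge; have [x0|x0|->] := ltgtP x 0.
- move=> h; apply: Or33; exists (- x); rewrite oppr_gt0; split=> //.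
  by rewrite tlineN opprK.
- by move=> h; apply: Or32; exists x.
- by rewrite tline0 ltxx.
Qed.

(** Convexity of [N] along the line turns one smaller value into a linear decrease up to that point
    and a linear increase, with the same slope, on the opposite side. *)
Lemma descends_slope N e t : gauge N -> descends e N t ->
  exists m x, [/\ 0 < m, 0 < x,
    forall y, 0 <= y -> N (uvec t) + m * y <= N (tline e t (- y)) &
    forall y, 0 <= y <= x -> N (tline e t y) <= N (uvec t) - m * y].
Proof.
move=> hN [x [x0 hx]]; pose m := (N (uvec t) - N (tline e t x)) / x.
have m0 : 0 < m by rewrite divr_gt0 ?subr_gt0.
have mx : m * x = N (uvec t) - N (tline e t x) by rewrite /m divfK ?gt_eqF.
exists m, x; split=> // y.
  rewrite le_eqVlt => /orP[/eqP <-|y0]; first by rewrite mulr0 addr0 oppr0 tline0.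
  have := @tline_convex N e t (- y) x hN; rewrite oppr_lt0 => /(_ y0 x0).
  rewrite -(ler_pM2l x0 (_ + _)); have := congr1 ( *%R y) mx.
  by move: (N _) (N _) (N _) => A B C; clear; lra.
move=> /andP[y0 yx]; have [->|yx'] := eqVneq y x; first by rewrite mx; lra.
have {yx'} yx' : y < x by rewrite lt_neqAle yx'.
have -> : tline e t y = (1 - y / x) *: uvec t + (y / x) *: tline e t x.
  rewrite /tline scalerDr addrA -scalerDl subrK scale1r scalerA; congr (_ + _ *: _).
  by field; rewrite gt_eqF.
have yx1 : 0 <= 1 - y / x by rewrite subr_ge0 ler_pdivrMr// mul1r.
have yx0 : 0 <= y / x by rewrite divr_ge0// ltW.
apply: le_trans (gaugeD _ _ hN) _; rewrite !gaugeZ//.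
rewrite /m le_eqVlt; apply/orP; left; apply/eqP; field; by rewrite gt_eqF.
Qed.

(* [m tan x] beats the second order loss [1 - cos x]. *)
Lemma gauge_rise N e t m x : gauge N -> e ^+ 2 = 1 -> 0 < m ->
  0 < x -> x < pi / 2 -> x < m / N (uvec t) ->
  N (uvec t) + m * tan x <= N (tline e t (tan x)) -> N (uvec t) < N (uvec (t + e * x)).
Proof.
move=> hN e1 m0 x0 x1 x2 h; have n0 := gauge_uvec_gt0 t hN.
have c0 : 0 < cos x by rewrite cos_gt0_pihalf//; lra.
have s0 : 0 < sin x by rewrite sin_gt0_pihalf// x0.
rewrite uvec_tline ?gt_eqF// gaugeZ ?(ltW c0)//.
apply: lt_le_trans (ler_wpM2l (ltW c0) h).
have -> : cos x * (N (uvec t) + m * tan x) = cos x * N (uvec t) + m * sin x.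
  by rewrite /tan; field; rewrite gt_eqF.
have := sin_le_id (ltW x0); rewrite ltr_pdivlMr// in x2 => sx.
have h2 : sin x * N (uvec t) < m by apply: le_lt_trans x2; rewrite ler_wpM2r// ltW.
have h3 := cos2Dsin2 x; have : 1 - cos x <= sin x ^+ 2.
  have -> : sin x ^+ 2 = (1 - cos x) * (1 + cos x) by move: h3; clear; lra.
  by apply: ler_peMr; rewrite ?subr_ge0 ?cos_le1// lerDl (ltW c0).
move: (N _) n0 h2 => A A0 h2 h4.
have : (1 - cos x) * A < m * sin x.
  apply: le_lt_trans (ler_wpM2r (ltW A0) h4) _.
  by rewrite expr2 -mulrA mulrC ltr_pM2r.
by rewrite mulrBl mul1r; lra.
Qed.

(** The direction at angle [y] from [t] meets the line at parameter [tan y], and [N] there is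
    multiplied by [cos y <= 1]. This helps the decrease; for the increase the slope has to outweigh
    it. *)
Lemma descends_near N e t : gauge N -> e ^+ 2 = 1 -> descends e N t ->
  exists d, 0 < d /\ forall x, 0 < x < d ->
    N (uvec (t + e * x)) < N (uvec t) < N (uvec (t - e * x)).
Proof.
move=> hN e1 h; have [m [x [m0 x0 h1 h2]]] := descends_slope hN h.
have n0 := gauge_uvec_gt0 t hN; have pi0 := pi_gt0 R.
have eN1 : (- e) ^+ 2 = 1 by rewrite sqrrN.
(* The three bounds keep [tan] defined, satisfy [gauge_rise], and keep [tan y] in the range of the
   slope estimate. *)
pose d := Num.min (pi / 2) (Num.min (m / N (uvec t)) (atan x)).
have ax : 0 < atan x by rewrite -(atan0 R) lt_atan.
exists d; split; first by rewrite !lt_min; apply/and3P; split; rewrite ?divr_gt0.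
move=> y; rewrite !lt_min => /and4P[y0 y1 y2 y3].
have c0 : 0 < cos y by rewrite cos_gt0_pihalf//; lra.
have ty : 0 < tan y by rewrite /tan divr_gt0// sin_gt0_pihalf// y0.
apply/andP; split; last first.
  by rewrite -mulNr; apply: (gauge_rise hN eN1 m0) => //; rewrite -tlineN h1// ltW.
rewrite uvec_tline ?gt_eqF// gaugeZ ?(ltW c0)//.
have : tan y < x.
  rewrite -[ltRHS](atanK x) ltr_tan// in_itv /=; first by apply/andP; split; lra.
  by rewrite atan_gtNpi2 atan_ltpi2.
move=> /ltW tx; have := h2 (tan y); rewrite tx ltW// => /(_ isT) h3.
apply: le_lt_trans (ler_wpM2l (ltW c0) h3) _.
apply: le_lt_trans (_ : N (uvec t) - m * tan y < _); last by rewrite ltrBlDr ltrDl mulr_gt0.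
rewrite ler_piMl ?cos_le1//; apply: le_trans (gauge_ge0 _ hN) h3.
Qed.

(** Descent in direction [e] would make the gauge larger on the opposite side. *)
Lemma local_max_critical N t d : gauge N -> 0 < d ->
  (forall x, `|x| < d -> N (uvec (t + x)) <= N (uvec t)) -> critical N t.
Proof.
move=> hN d0 h; suff key e : e ^+ 2 = 1 -> ~ descends e N t.
  by case: (critical_or_descends t hN) => // /key; rewrite ?sqrrN expr1n => /(_ erefl).
move=> e1 /(descends_near hN e1)[d' [d'0 h']].
have [x [x0 xd xd']] := exists_lt_both d0 d'0.
have := h' x; rewrite x0 xd' => /(_ isT) /andP[_].
rewrite ltNge h// normrN normrM (ger0_norm (ltW x0)).
suff -> : `|e| = 1 by rewrite mul1r.
by move/eqP: e1; rewrite sqrf_eq1 => /orP[] /eqP ->; rewrite ?normrN normr1.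
Qed.

End Descent.

(** * The distance function along smooth curves *)

Section SmoothCurves.
Variable R : realType.
Implicit Types (a b c d e k r s t x y : R) (z u w q : plane R).
Implicit Types (g : R -> plane R).

Lemma derivable_fst_snd g t : derivable g t 1 ->
  is_derive t 1 (fun s => (g s).1) (derive1 g t).1 /\
  is_derive t 1 (fun s => (g s).2) (derive1 g t).2.
Proof.
move=> dg; have : (fun h => h^-1 *: (g (h *: (1 : R) + t) - g t)) @ 0^' --> derive1 g t.
  by rewrite derive1E; exact: dg.
move=> cv; split; apply: DeriveDef.
- apply: cvgP; apply: (@cvg_comp _ _ _ _ (fun z : plane R => z.1) _ _ _ cv cvg_fst).
- by apply: cvg_lim => //; apply: (@cvg_comp _ _ _ _ (fun z : plane R => z.1) _ _ _ cv cvg_fst).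
- apply: cvgP; apply: (@cvg_comp _ _ _ _ (fun z : plane R => z.2) _ _ _ cv cvg_snd).
- by apply: cvg_lim => //; apply: (@cvg_comp _ _ _ _ (fun z : plane R => z.2) _ _ _ cv cvg_snd).
Qed.

Lemma is_derive_dot g1 g2 t : derivable g1 t 1 -> derivable g2 t 1 ->
  is_derive t 1 (fun s => dot (g1 s) (g2 s))
    (dot (derive1 g1 t) (g2 t) + dot (g1 t) (derive1 g2 t)).
Proof.
move=> /derivable_fst_snd[d11 d12] /derivable_fst_snd[d21 d22].
apply: (is_derive_eq (is_deriveD (is_deriveM d11 d21) (is_deriveM d12 d22))).
move: (derive1 g1 t) (derive1 g2 t) (g1 t) (g2 t) => [? ?] [? ?] [? ?] [? ?].
by rewrite /dot /GRing.scale /=; ring.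
Qed.

Lemma derivable_cst_curve w t : derivable (fun _ : R => w) t 1.
Proof. exact: derivable_cst. Qed.

Lemma is_derive_dot_cst g w t : derivable g t 1 ->
  is_derive t 1 (fun s => dot (g s) w) (dot (derive1 g t) w).
Proof.
move=> dg; have D := is_derive_dot dg (@derivable_cst_curve w t).
have e : dot (derive1 g t) w + dot (g t) (derive1 (fun _ : R => w) t) = dot (derive1 g t) w.
  by rewrite derive1_cst [X in _ + X](_ : _ = 0) ?addr0// /dot /= !mulr0 addr0.
by rewrite e in D.
Qed.

Lemma is_derive_continuous (f : R -> R) t df : is_derive t 1 f df -> {for t, continuous f}.
Proof.
by move=> [df0 _]; apply: differentiable_continuous; apply/derivable1_diffP.
Qed.

Lemma strict_min_of_deriv2 (F h : R -> R) k : (forall s, is_derive s 1 F (h s)) ->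
  h 0 = 0 -> is_derive (0 : R) 1 h k -> 0 < k ->
  exists d, 0 < d /\ forall s, 0 < `|s| < d -> F 0 < F s.
Proof.
move=> dF h0 [dh kE] k0.
have cv : (fun s => s^-1 *: (h (s *: (1 : R) + 0) - h 0)) @ 0^' --> k by rewrite -kE; exact: dh.
move/cvgrPdist_lt : cv => /(_ k k0); rewrite near_withinE.
move=> /nbhs_ballP[d /= d0 hd]; exists d; split=> //.
have sgn s : 0 < `|s| < d -> 0 < s^-1 * h s.
  move=> /andP[s0 sd]; have := hd s; rewrite /ball /= sub0r normrN => /(_ sd).
  rewrite normr_gt0 in s0 => /(_ s0); rewrite /GRing.scale /= mulr1 addr0 h0 subr0.
  by rewrite ltr_norml => /andP[_]; lra.
have cF (a b : R) : {within `[a, b], continuous F}.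
  by apply: continuous_subspaceT => s; exact: is_derive_continuous (dF s).
move=> s /andP[]; rewrite normr_gt0 => s0 sd; have [sp|sn|s00] := ltgtP s 0; last by rewrite s00 eqxx in s0.
  have [c] := @MVT _ F h _ _ sp (fun x _ => dF x) (cF _ _).
  rewrite in_itv /= => /andP[sc c0] e; have := sgn c; rewrite normr_gt0 lt_eqF//=.
  rewrite ltr0_norm// => /(_ ltac:(move: sd; rewrite ltr0_norm//; lra)).
  rewrite nmulr_rgt0 ?invr_lt0// => hc.
  have : h c * (0 - s) < 0 by rewrite sub0r pmulr_llt0// oppr_gt0.
  by rewrite -e subr_lt0.
have [c] := @MVT _ F h _ _ sn (fun x _ => dF x) (cF _ _).
rewrite in_itv /= => /andP[c0 cs] e; have := sgn c; rewrite normr_gt0 gt_eqF//=.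
rewrite gtr0_norm// => /(_ ltac:(move: sd; rewrite gtr0_norm//; lra)).
rewrite pmulr_rgt0 ?invr_gt0// => hc.
have : 0 < h c * (s - 0) by rewrite subr0 mulr_gt0.
by rewrite -e subr_gt0.
Qed.

(** Half the first derivative of the squared distance; working with the square avoids the square
    root. *)
Definition sq_deriv g s := dot (g s) (derive1 g s).

Definition sq_deriv2 g s := dot (derive1 g s) (derive1 g s) + dot (g s) (derive1n 2 g s).

Lemma is_derive_sq g s : smooth_curve g ->
  is_derive s 1 (fun x => dot (g x) (g x)) (2 * sq_deriv g s).
Proof.
move=> sg; apply: (is_derive_eq (is_derive_dot (sg 0%N s) (sg 0%N s))).
by rewrite /sq_deriv [dot (derive1 g s) _]dotC mulr_natl mulr2n.
Qed.

Lemma is_derive_sq_deriv g s : smooth_curve g ->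
  is_derive s 1 (sq_deriv g) (sq_deriv2 g s).
Proof. by move=> sg; exact: (is_derive_dot (sg 0%N s) (sg 1%N s)). Qed.

Lemma continuous_smooth g : smooth_curve g -> continuous g.
Proof.
move=> sg t; apply: differentiable_continuous; apply/derivable1_diffP; exact: (sg 0%N t).
Qed.

Lemma is_derive_dist g s : smooth_curve g -> g s != 0 ->
  is_derive s 1 (fun x => dist (g x) 0) (sq_deriv g s / dist (g s) 0).
Proof.
move=> sg gs; have g0 : 0 < dot (g s) (g s) by rewrite lt_def dot_ge0 dot_eq0 gs.
have h1 := is_derive_sq s sg; have h2 := is_derive1_sqrt g0.
have -> : (fun x => dist (g x) 0) = Num.sqrt \o (fun x => dot (g x) (g x)).
  by apply/funext => x /=; rewrite dist0.
have D := @is_derive1_comp R Num.sqrt (fun x => dot (g x) (g x)) s _ _ h2 h1.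
have n0 := enorm_gt0 gs.
suff -> : sq_deriv g s / dist (g s) 0 = (2 * enorm (g s))^-1 * (2 * sq_deriv g s) by exact: D.
rewrite dist0; move: (sq_deriv g s) (enorm _) n0 => x y y0.
by field; rewrite gt_eqF.
Qed.

(** Where the first derivative vanishes, the quotient rule leaves a single term, so the sign is that
    of the second derivative of the squared distance. *)
Lemma dist_deriv2E g : smooth_curve g -> g 0 != 0 -> sq_deriv g 0 = 0 ->
  dist_deriv2 0 g = sq_deriv2 g 0 / enorm (g 0).
Proof.
move=> sg g0 h0; rewrite /dist_deriv2 /derive1n /= derive1E.
have gn : \forall s \near (0 : R), g s != 0.
  have cg := continuous_smooth sg; have : enorm (g s) @[s --> (0 : R)] --> enorm (g 0).
    apply: (@continuous_comp _ _ _ g (@enorm R)); first exact: cg.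
    exact: (gauge_continuous (gauge_enorm R)).
  move/cvgrPdist_lt => /(_ _ (enorm_gt0 g0)); apply: filterS => s /=.
  apply: contraTneq => ->; rewrite -leNgt /enorm /dot /= !mulr0 addr0 sqrtr0 subr0.
  exact: ler_norm.
have eqn : \forall s \near (0 : R),
    sq_deriv g s / dist (g s) 0 = derive1 (fun x => dist (g x) 0) s.
  near=> s; rewrite derive1E; have gs : g s != 0 by near: s.
  by rewrite (@derive_val _ _ _ _ _ _ _ (is_derive_dist sg gs)).
rewrite -(near_eq_derive _ eqn).
have D1 := is_derive_sq_deriv 0 sg; have D2 := is_derive_dist sg g0.
have n0 : dist (g 0) 0 != 0 by rewrite dist0 gt_eqF// enorm_gt0.
have D3 := @is_deriveV _ (fun x => dist (g x) 0) 0 _ 1 n0 D2.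
have D4 := is_deriveM D1 D3.
rewrite (@derive_val _ _ _ _ _ _ _ D4) h0 /GRing.scale /= !mul0r add0r dist0.
by rewrite mulrC.
Unshelve. all: by end_near. Qed.

End SmoothCurves.

(** * Equilibria in terms of the gauge *)

Section Equilibria.
Variable R : realType.
Implicit Types (a b c d e k r s t x y : R) (z u w q : plane R).
Implicit Types (g : R -> plane R) (N : plane R -> R).

Definition bdpt N t : plane R := (N (uvec t))^-1 *: uvec t.

(** The distance of the boundary point is the reciprocal of the gauge, so a maximum here is a
    minimum of the distance: this is the stable case. *)
Definition strict_angular_max N t :=
  exists d, 0 < d /\ forall x, 0 < `|x| < d -> N (uvec (t + x)) < N (uvec t).

Definition strict_angular_min N t :=
  exists d, 0 < d /\ forall x, 0 < `|x| < d -> N (uvec t) < N (uvec (t + x)).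

Lemma gauge_bdpt N t : gauge N -> N (bdpt N t) = 1.
Proof.
move=> hN; have n0 := gauge_uvec_gt0 t hN.
by rewrite /bdpt gaugeZ ?mulVf ?gt_eqF// invr_ge0 ltW.
Qed.

Lemma bd_bdpt N t : gauge N -> bd (body N) (bdpt N t).
Proof. by move=> hN; rewrite body_bd//= gauge_bdpt. Qed.

Lemma bdpt_neq0 N t : gauge N -> bdpt N t != 0.
Proof.
move=> hN; have n0 := gauge_uvec_gt0 t hN.
by rewrite scaler_eq0 invr_eq0 gt_eqF//= uvec_neq0.
Qed.

Lemma enorm_bdpt N t : gauge N -> enorm (bdpt N t) = (N (uvec t))^-1.
Proof. by move=> hN; rewrite enorm_polar// invr_ge0 gauge_ge0. Qed.

Lemma bdpt_ray N r t : gauge N -> 0 < r -> bd (body N) (r *: uvec t) ->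
  r *: uvec t = bdpt N t.
Proof.
move=> hN r0; rewrite body_bd//= gaugeZ ?(ltW r0)// => h; congr (_ *: _).
have n0 := gauge_uvec_gt0 t hN.
by rewrite -[LHS]mulr1 -(mulfV (lt0r_neq0 n0)) mulrA h mul1r.
Qed.

Lemma bd_polar N z a : gauge N -> bd (body N) z ->
  exists t, a <= t < a + 2 * pi /\ z = bdpt N t.
Proof.
move=> hN bz; have z0 : z != 0.
  by apply: contraPneq bz => ->; rewrite body_bd//= gauge0// => /eqP; rewrite eq_sym oner_eq0.
have [t [ht zE]] := polar_decomp a z0; exists t; split=> //.
by rewrite zE; apply: bdpt_ray; rewrite ?enorm_gt0// -zE.
Qed.

Lemma bdpt_eq N s t : bdpt N s = bdpt N t -> gauge N -> uvec s = uvec t.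
Proof.
move=> e hN; have h := fun x => gauge_uvec_gt0 x hN.
by apply: (@polar_inj R (N (uvec s))^-1 (N (uvec t))^-1 s t _ _ e).2; rewrite invr_gt0.
Qed.

Lemma equilibrium_critical N t : gauge N ->
  equilibrium (body N) 0 (bdpt N t) <-> critical N t.
Proof.
move=> hN; have n0 := gauge_uvec_gt0 t hN.
have dq z : dot z (bdpt N t) = dot z (uvec t) / N (uvec t).
  by rewrite /bdpt dotZr mulrC.
have dqq : dot (bdpt N t) (bdpt N t) = (N (uvec t)) ^- 2.
  by rewrite -enorm2 enorm_bdpt// exprVn.
split=> [[_ [h|h]]|h].
- move=> z; have [->|z0] := eqVneq z 0.
    by rewrite /dot /= !mul0r addr0 mulr0 gauge0.
  have Nz := gauge_gt0 hN z0; have /h : body N ((N z)^-1 *: z).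
    by rewrite /body /= gaugeZ ?invr_ge0 ?(ltW Nz)// mulVf ?gt_eqF.
  rewrite subr0 dotBl dqq dq dotZl subr_le0 => h1.
  have := ler_wpM2r (exprn_ge0 2 (ltW n0)) h1; rewrite mulVf ?expf_neq0 ?gt_eqF//.
  have -> : (N z)^-1 * dot z (uvec t) / N (uvec t) * N (uvec t) ^+ 2 =
    N (uvec t) * dot z (uvec t) / N z by field; rewrite !gt_eqF.
  by rewrite ler_pdivrMr// mul1r.
(* The body cannot lie on the far side of the line, since it contains the origin. *)
- have := h 0; rewrite /body /= gauge0// => /(_ ler01).
  rewrite sub0r subr0 -[- _]add0r dotBl dqq /dot /= !mul0r !addr0 sub0r oppr_ge0.
  by rewrite leNgt invr_gt0 exprn_gt0.
- split; first exact: bd_bdpt.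
  left=> z hz; rewrite subr0 dotBl dqq dq subr_le0 expr2 invfM.
  rewrite ler_wpM2r ?invr_ge0 ?(ltW n0)//.
  rewrite -[leRHS]mul1r ler_pdivlMr// mulrC.
  by apply: le_trans (h z) _.
Qed.

Lemma continuous_shift (f : R -> R) t : continuous f ->
  continuous (fun x : R => f (t + x)).
Proof.
move=> cf x; have h := @continuous_comp R R R (fun y => t + y) f x.
apply: h; last exact: cf.
by apply: cvgD; [exact: cvg_cst|exact: cvg_id].
Qed.

Lemma smooth_dot g w s : smooth_curve g ->
  is_derive s 1 (fun s => dot (g s) w) (dot (derive1 g s) w).
Proof. by move=> sg; exact: is_derive_dot_cst (sg 0%N s). Qed.

(** The support line makes the projection on [uvec t] maximal along [g] at parameter 0. *)
Lemma local_param_tangent N t g : gauge N -> critical N t ->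
  local_param (body N) (bdpt N t) g -> dot (derive1 g 0) (uvec t) = 0.
Proof.
move=> hN ct [sg g0 _ [e [e0 hbd _]]].
have n0 := gauge_uvec_gt0 t hN.
have D s := smooth_dot (uvec t) s sg.
have [] := @derive1_at_max R (fun s => dot (g s) (uvec t)) (- e) e 0.
- lra.
- by move=> s _; case: (D s).
- by rewrite in_itv /=; lra.
- move=> s; rewrite in_itv /= => /andP[s1 s2].
  have : bd (body N) (g s) by apply: hbd; exists s => //=; rewrite in_itv /= s1.
  rewrite body_bd//= => Ns; have := ct (g s); rewrite Ns g0 /bdpt dotZl dot_uvec subrr cos0 mulr1.
  by rewrite mulrC -ler_pdivlMr// mul1r.
by move=> _ h; case: (D 0) => _ <-; exact: h.
Qed.

(** Conversely to following [g], every direction near [t] has to be reached at an arbitrarily small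
    parameter. The component of [g] orthogonal to the direction has opposite signs at [- m] and [m],
    and the intermediate value theorem gives the crossing. *)
Lemma param_crossing N t g d : gauge N -> local_param (body N) (bdpt N t) g ->
  dot (derive1 g 0) (uvec t) = 0 -> 0 < d ->
  exists d', 0 < d' /\ forall x, `|x| < d' ->
    exists y, `|y| < d /\ g y = bdpt N (t + x).
Proof.
move=> hN [sg g0 dg0 [e [e0 hbd _]]] tang d0.
(* The tangential velocity, nonzero because [g] is regular; multiplying by [k] treats both
   orientations of [g] at once. *)
pose k := cross (uvec t) (derive1 g 0).
have crossE s z : cross (uvec s) z = dot z (uperp s).
  by rewrite /cross /dot /=; ring.
have k0 : k != 0.
  apply: contra_neq dg0 => k0; rewrite (plane_decomp t (derive1 g 0)) tang.
  by rewrite -crossE -/k k0 !scale0r addr0.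
have D := smooth_dot (uperp t) 0 sg.
have X0 : dot (g 0) (uperp t) = 0.
  by rewrite g0 /bdpt dotZl dotC dot_uperp subrr sin0 mulr0.
have sgn : \forall y \near 0^', 0 < k * (y^-1 * dot (g y) (uperp t)).
  case: D => dD vD; have cv : (fun s => s^-1 *: (dot (g (s *: (1 : R) + 0)) (uperp t) -
      dot (g 0) (uperp t))) @ 0^' --> k.
    by rewrite /k crossE -vD; exact: dD.
  have kk : 0 < `|k| by rewrite normr_gt0.
  move/cvgrPdist_lt : cv => /(_ _ kk); apply: filterS => y.
  rewrite X0 subr0 /GRing.scale /= mulr1 addr0; move: (y^-1 * _) => v h.
  have k2 : 0 < k ^+ 2 by rewrite exprn_even_gt0.
  have : `|k * (k - v)| < k ^+ 2 by rewrite normrM -real_normK ?num_real// expr2 ltr_pM2l.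
  by rewrite ltr_norml => /andP[_]; lra.
have pos : \forall y \near (0 : R), 0 < dot (g y) (uvec t).
  have := is_derive_continuous (smooth_dot (uvec t) 0 sg).
  move=> /cvgrPdist_lt; rewrite g0 /bdpt dotZl dot_uvec subrr cos0 mulr1.
  have n0 := gauge_uvec_gt0 t hN; rewrite -invr_gt0 in n0.
  by move=> /(_ _ n0); apply: filterS => y; rewrite ltr_norml => /andP[_]; lra.
move: sgn; rewrite near_withinE => /nbhs_ballP[d1 /= d10 sgn].
move: pos => /nbhs_ballP[d2 /= d20 pos].
have [m [m0 mde [md1 md2]]] : exists m, [/\ 0 < m, m < d /\ m < e & m < d1 /\ m < d2].
  have [x [x0 x1 x2]] := exists_lt_both d0 e0.
  have [y [y0 y1 y2]] := exists_lt_both d10 d20.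
  have [m [m0 m1 m2]] := exists_lt_both x0 y0.
  by exists m; split=> //; split; [exact: lt_trans x1|exact: lt_trans x2|exact: lt_trans y1|exact: lt_trans y2].
case: mde => md me.
have sp : 0 < k * dot (g m) (uperp t).
  have := sgn m; rewrite /ball /= sub0r normrN gtr0_norm// => /(_ md1).
  rewrite gt_eqF// => /(_ isT); rewrite mulrCA pmulr_rgt0// invr_gt0//.
have sn : k * dot (g (- m)) (uperp t) < 0.
  have := sgn (- m); rewrite /ball /= sub0r opprK gtr0_norm// => /(_ md1).
  rewrite oppr_eq0 gt_eqF// => /(_ isT); rewrite mulrCA nmulr_rgt0// invr_lt0 oppr_lt0//.
have cX y : continuous (fun x => k * dot (g y) (uperp (t + x))).
  move=> x; apply: cvgM; first exact: cvg_cst.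
  have cs := @continuous_shift cos t (@continuous_cos R) x.
  have ss := @continuous_shift sin t (@continuous_sin R) x.
  by apply: cvgD; apply: cvgM; try exact: cvg_cst; [apply: cvgN; exact: ss|exact: cs].
have /nbhs_ballP[d3 /= d30 h3] : \forall x \near (0 : R), 0 < k * dot (g m) (uperp (t + x)).
  have /cvgrPdist_lt := cX m 0; rewrite /= addr0 => /(_ _ sp); apply: filterS => x.
  by rewrite ltr_norml => /andP[_]; lra.
have /nbhs_ballP[d4 /= d40 h4] : \forall x \near (0 : R), k * dot (g (- m)) (uperp (t + x)) < 0.
  have sn' : 0 < - (k * dot (g (- m)) (uperp t)) by rewrite oppr_gt0.
  have /cvgrPdist_lt := cX (- m) 0; rewrite /= addr0 => /(_ _ sn'); apply: filterS => x.
  by rewrite ltr_norml => /andP[]; lra.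
have pi0 : 0 < pi / 2 :> R by rewrite divr_gt0// pi_gt0.
have [x1 [x10 x13 x14]] := exists_lt_both d30 d40.
have [d' [d'0 d'1 d'2]] := exists_lt_both x10 pi0.
exists d'; split=> // x xd'.
have xb (r : R) : d' < r -> ball 0 r x by rewrite /ball /= sub0r normrN; exact: lt_trans.
have hp := h3 x (xb _ (lt_trans d'1 x13)); have hn := h4 x (xb _ (lt_trans d'1 x14)).
have cm : - m <= m by lra.
have [||y] := @IVT R (fun y => k * dot (g y) (uperp (t + x))) _ _ 0 cm.
- apply: continuous_subspaceT => y; apply: cvgM; first exact: cvg_cst.
  exact: is_derive_continuous (smooth_dot _ y sg).
- by rewrite ge_min le_max (ltW hp) (ltW hn) orbT.
rewrite in_itv /= -ler_norml => ym /eqP; rewrite mulf_eq0 (negbTE k0) /= => /eqP h0.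
exists y; split; first exact: le_lt_trans md.
have gE : g y = dot (g y) (uvec (t + x)) *: uvec (t + x).
  by rewrite {1}(plane_decomp (t + x) (g y)) h0 scale0r addr0.
have := pos y; rewrite /ball /= sub0r normrN => /(_ (le_lt_trans ym md2)).
rewrite {1}gE dotZl dot_uvec opprD addrA subrr add0r cosN pmulr_lgt0 => [r0|]; last first.
  by apply: cos_gt0_pihalf; rewrite -ltr_norml; exact: lt_trans d'2.
rewrite gE; apply: bdpt_ray => //; rewrite -gE; apply: hbd; exists y => //=.
by rewrite in_itv /= -ltr_norml; exact: le_lt_trans me.
Qed.

(** Both second derivative tests in one: [sg = false] is a minimum of the distance, [sg = true] a
    maximum. [param_crossing] transports the conclusion from parameters to angles. *)
Lemma param_min_angular N t g (sg : bool) : gauge N -> critical N t ->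
  local_param (body N) (bdpt N t) g -> 0 < (-1) ^+ sg * dist_deriv2 0 g ->
  exists d, 0 < d /\ forall x, 0 < `|x| < d ->
    if sg then N (uvec t) < N (uvec (t + x)) else N (uvec (t + x)) < N (uvec t).
Proof.
move=> hN ct lp h; have tang := local_param_tangent hN ct lp.
have [smg g0 _ _] := lp.
have gn0 : g 0 != 0 by rewrite g0 bdpt_neq0.
have h0 : sq_deriv g 0 = 0.
  by rewrite /sq_deriv g0 dotC /bdpt dotZr tang mulr0.
rewrite dist_deriv2E// mulrA pmulr_lgt0 ?invr_gt0 ?enorm_gt0// in h.
pose F s := (-1) ^+ sg * dot (g s) (g s).
have DF s : is_derive s 1 F ((-1) ^+ sg * (2 * sq_deriv g s)).
  have := is_deriveZ ((-1) ^+ sg) (is_derive_sq s smg); exact.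
have [|||d [d0 hd]] := @strict_min_of_deriv2 R F (fun s => (-1) ^+ sg * (2 * sq_deriv g s)) ((-1) ^+ sg * (2 * sq_deriv2 g 0)) DF.
- by rewrite h0 !mulr0.
- have := is_deriveZ ((-1) ^+ sg) (is_deriveZ 2 (is_derive_sq_deriv 0 smg)); exact.
- by rewrite mulrCA mulr_gt0.
have [d' [d'0 hd']] := param_crossing hN lp tang d0.
have pi0 : 0 < pi :> R by exact: pi_gt0.
have [r [r0 rd' rp]] := exists_lt_both d'0 pi0.
exists r; split=> // x /andP[x0 xr].
have [y [yd gy]] := hd' x (lt_trans xr rd').
have y0 : 0 < `|y|.
  rewrite normr_gt0; apply/negP => /eqP y0; move: gy; rewrite y0 g0.
  move=> /bdpt_eq /(_ hN) e; have := dot_uvec t (t + x); rewrite -e dot_uvec subrr cos0.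
  rewrite addrAC subrr add0r => /esym/cos_eq1_lt xx.
  by move: x0; rewrite xx ?normr0 ?ltxx// -ltr_norml; apply: (lt_trans xr); lra.
have := hd y; rewrite y0 yd => /(_ isT); rewrite /F -!enorm2 gy g0 !enorm_bdpt//.
have n1 := gauge_uvec_gt0 t hN; have n2 := gauge_uvec_gt0 (t + x) hN.
rewrite !exprVn; case: (sg) => /=; rewrite ?expr1 ?expr0 ?mulN1r ?mul1r ?ltrN2;
  by rewrite ltf_pV2 ?posrE ?exprn_gt0// ltr_pXn2r// nnegrE ltW.
Qed.

End Equilibria.

(** * Nondegenerate equilibria as strict extrema of the gauge *)

Section Classification.
Variable R : realType.
Implicit Types (a b c d e k m r s t x y : R) (z u w q : plane R).
Implicit Types (g : R -> plane R) (N : plane R -> R).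

Lemma strict_max_min_absurd N t : strict_angular_max N t -> strict_angular_min N t -> False.
Proof.
move=> [d [d0 h]] [d' [d'0 h']]; have [x [x0 x1 x2]] := exists_lt_both d0 d'0.
have := h x; rewrite gtr0_norm// x0 x1 => /(_ isT).
by have := h' x; rewrite gtr0_norm// x0 x2 => /(_ isT) /lt_trans h1 /h1; rewrite ltxx.
Qed.

(* If the gauge had slope zero at [q] along the tangent line, that line would
   span a one-sided tangent half line orthogonal to [q]. *)
Lemma nonsmooth_slope N e t : e != 0 -> gauge N -> critical N t ->
  (forall v, tangent_half_line (body N) (bdpt N t) v -> 0 < dot (0 - bdpt N t) v) ->
  exists m, 0 < m /\ forall x, 0 < x -> N (uvec t) + m * x <= N (tline e t x).
Proof.
move=> e0 hN ct hv; have n0 := gauge_uvec_gt0 t hN.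
apply/not_existsP => hm.
pose f x := N (tline e t x).
have fx0 x : 0 < f x by rewrite gauge_gt0// tline_neq0.
have ge x : N (uvec t) <= f x by have := ct (tline e t x); rewrite dot_tline mulr1.
have slope m : 0 < m -> exists d, 0 < d /\ forall x, 0 < x < d -> f x < N (uvec t) + m * x.
  move=> m0; have := hm m; rewrite not_andE => -[//|/existsNP[x]].
  rewrite not_implyE => -[x0 /negP]; rewrite -ltNge => hx; exists x; split=> //.
  move=> y /andP[y0 yx].
  have -> : f y = N ((1 - y / x) *: uvec t + (y / x) *: tline e t x).
    rewrite /f /tline scalerDr addrA -scalerDl subrK scale1r scalerA.
    by congr (N (_ + _ *: _)); field; rewrite gt_eqF.
  have yx1 : 0 < y / x by rewrite divr_gt0.
  have yx2 : 0 <= 1 - y / x by rewrite subr_ge0 ler_pdivrMr// mul1r ltW.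
  apply: le_lt_trans (gaugeD _ _ hN) _; rewrite !gaugeZ// ?ltW//.
  have : y / x * N (tline e t x) < y / x * (N (uvec t) + m * x) by rewrite ltr_pM2l.
  rewrite mulrDr [y / x * (m * x)]mulrCA divfK ?gt_eqF//; lra.
pose w := e *: uperp t.
have : tangent_half_line (body N) (bdpt N t) ((N (uvec t))^-1 *: w).
  split.
    rewrite !scaler_eq0 invr_eq0 (gt_eqF n0)/= (negbTE e0)/=.
    apply/eqP => h; have := dot_uperp t (t + pi / 2).
    by rewrite h addrAC subrr add0r sin_pihalf /dot /= !mul0r addr0 => /eqP; rewrite eq_sym oner_eq0.
  (* The boundary is parametrized by radial projection of the tangent line. *)
  exists (fun x => (f x)^-1 *: tline e t x); split.
    by near=> x; rewrite body_bd//= gaugeZ ?invr_ge0 ?(ltW (fx0 _))// mulVf// gt_eqF.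
  have cf : f x @[x --> 0^'+] --> N (uvec t).
    apply: cvg_at_right_filter; rewrite -(tline0 e t).
    apply: (@continuous_comp _ _ _ (tline e t) N); first exact: continuous_tline.
    exact: gauge_continuous.
  have cv1 : (f x)^-1 @[x --> 0^'+] --> (N (uvec t))^-1 by apply: cvgV => //; rewrite gt_eqF.
  have cslope : (f x - N (uvec t)) / x @[x --> 0^'+] --> 0.
    apply/cvgrPdist_le => m m0; have [d [d0 hd]] := slope m m0.
    near=> x; have x0 : 0 < x by near: x; exact: nbhs_right_gt.
    have xd : x < d by near: x; exact: nbhs_right_lt.
    have := hd x; rewrite x0 xd => /(_ isT) h.
    rewrite sub0r normrN ger0_norm ?divr_ge0 ?subr_ge0 ?(ltW x0)//.
    by rewrite ler_pdivrMr//; lra.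
  have lim : (f x)^-1 *: w - ((f x - N (uvec t)) / x * (f x)^-1 * (N (uvec t))^-1) *: uvec t
      @[x --> 0^'+] --> (N (uvec t))^-1 *: w - (0 * (N (uvec t))^-1 * (N (uvec t))^-1) *: uvec t.
    apply: cvgB; first by apply: cvgZr_tmp.
    by apply: cvgZr_tmp; apply: cvgM; [apply: cvgM|exact: cvg_cst].
  rewrite !mul0r scale0r subr0 in lim.
  apply: cvg_trans lim; apply: near_eq_cvg; near=> x.
  have x0 : 0 < x by near: x; exact: nbhs_right_gt.
  have fx := fx0 x.
  rewrite /bdpt /tline /w; move: (f x) fx (N (uvec t)) n0 => A A0 B B0.
  move: (uvec t) (uperp t) => [u1 u2] [p1 p2]; apply: injective_projections;
    by rewrite /= /GRing.scale /=; field; rewrite !gt_eqF.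
move=> /hv; rewrite sub0r /w /bdpt -scaleNr !dotZl !dotZr dotC dot_uperp subrr sin0.
by rewrite !mulr0 ltxx.
Unshelve. all: by end_near. Qed.

(** At smooth points the second derivative decides. At nonsmooth points the gauge grows at least
    linearly along both halves of the tangent line, which yields a strict angular minimum. This is
    where nondegeneracy enters. *)
Lemma critical_classify N t : gauge N -> all_nondegenerate (body N) 0 -> critical N t ->
  (stable_points (body N) 0 (bdpt N t) /\ strict_angular_max N t) \/
  (~ stable_points (body N) 0 (bdpt N t) /\ strict_angular_min N t).
Proof.
move=> hN nd ct; have eq := (equilibrium_critical t hN).2 ct.
have stable_max g : local_param (body N) (bdpt N t) g -> 0 < dist_deriv2 0 g ->
    strict_angular_max N t.
  by move=> lp h; apply: (@param_min_angular _ N t g false) => //; rewrite expr0 mul1r.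
have min_not g : strict_angular_min N t -> ~ stable_points (body N) 0 (bdpt N t).
  by move=> hmin [_ [g' lp h]]; exact: strict_max_min_absurd (stable_max g' lp h) hmin.
have [sm ns] := nd _ eq; have [smq|nsmq] := pselect (smooth_at (body N) (bdpt N t)).
  have [g lp g2] := sm smq; have [g2p|g2n] := ltP 0 (dist_deriv2 0 g).
    by left; split; [split=> //; exists g|exact: stable_max lp g2p].
  right; suff h : strict_angular_min N t by split=> //; exact: min_not.
  apply: (@param_min_angular _ N t g true) => //; rewrite expr1 mulN1r oppr_gt0.
  by rewrite lt_neqAle g2.
right; suff h : strict_angular_min N t.
  by split=> //; exact: min_not.
have [m1 [m10 h1]] := nonsmooth_slope (oner_neq0 R) hN ct (ns nsmq).
have nz1 : (- 1 : R) != 0 by rewrite oppr_eq0 oner_neq0.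
have [m2 [m20 h2]] := nonsmooth_slope nz1 hN ct (ns nsmq).
have n0 := gauge_uvec_gt0 t hN; have pi0 : 0 < pi / 2 :> R by rewrite divr_gt0// pi_gt0.
have [d1 [d10 d11 d12]] := exists_lt_both pi0 (divr_gt0 m10 n0).
have [d2 [d20 d21 d22]] := exists_lt_both pi0 (divr_gt0 m20 n0).
have [d [d0 dd1 dd2]] := exists_lt_both d10 d20.
exists d; split=> // x /andP[x0 xd].
have key e m : e ^+ 2 = 1 -> 0 < m -> x = e * `|x| -> `|x| < pi / 2 -> `|x| < m / N (uvec t) ->
    (forall x, 0 < x -> N (uvec t) + m * x <= N (tline e t x)) -> N (uvec t) < N (uvec (t + x)).
  move=> e1 m0 xe xp xm hm; rewrite xe; apply: (gauge_rise hN e1 m0) => //; apply: hm.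
  by rewrite /tan divr_gt0// ?sin_gt0_pihalf ?cos_gt0_pihalf ?x0//; apply/andP; split; lra.
have [xp|xn] := leP 0 x.
  apply: (key 1 m1) => //; rewrite ?expr1n ?mul1r ?ger0_norm//; rewrite ger0_norm// in xd; lra.
by apply: (key (- 1) m2) => //; rewrite ?sqrrN ?expr1n ?mulN1r ?ltr0_norm ?opprK//;
  rewrite ltr0_norm// in xd; lra.
Qed.

Definition stable_angle N t := stable_points (body N) 0 (bdpt N t).

Lemma stable_angle_critical N t : gauge N -> stable_angle N t -> critical N t.
Proof. by move=> hN [/equilibrium_critical h _]; exact: h. Qed.

Lemma stable_angle_max N t : gauge N -> all_nondegenerate (body N) 0 ->
  stable_angle N t -> strict_angular_max N t.
Proof.
move=> hN nd st; have := critical_classify hN nd (stable_angle_critical hN st).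
by case=> -[].
Qed.

(** A weak maximum suffices: it is critical, and the only alternative to stable is a strict minimum.
    Stable points are produced in this way throughout. *)
Lemma local_max_stable N t d : gauge N -> all_nondegenerate (body N) 0 -> 0 < d ->
  (forall x, `|x| < d -> N (uvec (t + x)) <= N (uvec t)) -> stable_angle N t.
Proof.
move=> hN nd d0 h; have := critical_classify hN nd (local_max_critical hN d0 h).
case=> -[]// _ [d' [d'0 h']]; have [x [x0 x1 x2]] := exists_lt_both d0 d'0.
have := h' x; rewrite gtr0_norm// x0 x2 => /(_ isT); rewrite ltNge h//.
by rewrite gtr0_norm.
Qed.

(* Otherwise the gauge would have an interior maximum between the two angles. *)
Lemma descends_between N e t r : gauge N -> all_nondegenerate (body N) 0 ->
  e ^+ 2 = 1 -> 0 < r -> N (uvec (t + e * r)) < N (uvec t) ->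
  (forall x, 0 <= x < r -> ~ stable_angle N (t + e * x)) -> descends e N t.
Proof.
move=> hN nd e1 r0 hr hs; apply: contrapT => nde.
have ne : `|e| = 1 by move/eqP: e1; rewrite sqrf_eq1 => /orP[] /eqP ->; rewrite ?normrN normr1.
have [d [d0 hd]] : exists d, 0 < d /\ forall x, 0 < x < d -> N (uvec t) < N (uvec (t + e * x)).
  have nodown : ~ critical N t -> descends (- e) N t.
    move=> nc; move: nde; move/eqP: e1; rewrite sqrf_eq1 => /orP[] /eqP -> nde;
      by case: (critical_or_descends t hN) => //; rewrite ?opprK.
  have [ct|/nodown/(descends_near hN)] := pselect (critical N t).
    case: (critical_classify hN nd ct) => -[hst].
      by have := hs 0; rewrite mulr0 addr0 lexx r0 => /(_ isT).
    move=> [d [d0 hd]]; exists d; split=> // x /andP[x0 xd]; apply: hd.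
    by rewrite normrM ne mul1r gtr0_norm// x0.
  rewrite sqrrN => /(_ e1)[d [d0 hd]]; exists d; split=> // x /hd /andP[_].
  by rewrite mulNr opprK.
pose f x := N (uvec (t + e * x)).
have cf : continuous f.
  move=> x; apply: (@continuous_comp _ _ _ (fun y => t + e * y) (fun y => N (uvec y))).
    by apply: cvgD; [exact: cvg_cst|apply: cvgM; [exact: cvg_cst|exact: cvg_id]].
  exact: gauge_uvec_continuous.
have [c] := @EVT_max R f 0 r (ltW r0) (continuous_subspaceT cf).
rewrite in_itv /= => /andP[c0 cr] hc.
have [y [y0 yd yr]] := exists_lt_both d0 r0.
have fy : N (uvec t) < f c.
  apply: lt_le_trans (hc y _); first by apply: hd; rewrite y0.
  by rewrite in_itv /= !ltW.
have c0' : 0 < c.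
  rewrite lt_neqAle c0 andbT eq_sym; apply/eqP => e0; move: fy.
  by rewrite /f e0 mulr0 addr0 ltxx.
have cr' : c < r.
  rewrite lt_neqAle cr andbT; apply/eqP => e0; move: fy; rewrite /f e0.
  by move=> h; have := lt_trans h hr; rewrite ltxx.
have rc : 0 < r - c by rewrite subr_gt0.
have [d' [d'0 d'1 d'2]] := exists_lt_both c0' rc.
apply: (hs c); first by rewrite c0.
apply: (local_max_stable hN nd d'0) => x xd'.
have ee : e * e = 1 by rewrite -expr2.
have -> : t + e * c + x = t + e * (c + e * x) by rewrite mulrDr mulrA ee mul1r addrA.
apply: hc; rewrite in_itv /=; have : `|e * x| < d' by rewrite normrM ne mul1r.
by rewrite ltr_norml => /andP[h1 h2]; apply/andP; split; lra.
Qed.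

End Classification.

(** * Piecewise smooth curves *)

Section PiecewiseSmooth.
Variable R : realType.
Implicit Types (a b d k l p r s t x y : R) (z u w q : plane R).
Implicit Types (c g : R -> plane R) (N : plane R -> R).

Definition smooth_arc c a b := exists g, smooth_curve g /\
  {in `[a, b], forall t, c t = g t /\ derive1 g t != 0}.

(** The subdivision of [piecewise_smooth_closed_curve] as an inductive relation, which turns
    concatenation, restriction and translation into inductions. *)
Inductive pw_smooth c : R -> R -> Prop :=
| pw_nil a : pw_smooth c a a
| pw_cons a b d : a < b -> smooth_arc c a b -> pw_smooth c b d -> pw_smooth c a d.

Lemma pw_le c a b : pw_smooth c a b -> a <= b.
Proof. by elim=> // {}a {}b d ab _ _; apply: le_trans; exact: ltW. Qed.

Lemma smooth_arc_sub c a b a' b' : a <= a' -> b' <= b -> smooth_arc c a b -> smooth_arc c a' b'.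
Proof.
move=> aa bb [g [sg h]]; exists g; split=> // t; rewrite in_itv /= => /andP[t1 t2].
by apply: h; rewrite in_itv /= (le_trans aa t1) (le_trans t2 bb).
Qed.

Lemma smooth_arc_ext c c' a b : (forall t, a <= t <= b -> c t = c' t) ->
  smooth_arc c a b -> smooth_arc c' a b.
Proof.
move=> e [g [sg h]]; exists g; split=> // t ht; have [h1 h2] := h t ht.
by split=> //; rewrite -h1 e.
Qed.

Lemma pw_ext c c' a b : (forall t, a <= t <= b -> c t = c' t) ->
  pw_smooth c a b -> pw_smooth c' a b.
Proof.
move=> + P; elim: P => [{}a|{}a {}b d ab arc P IH] e; first exact: pw_nil.
have bd := pw_le P; apply: (pw_cons ab); last first.
  by apply: IH => t /andP[t1 t2]; apply: e; rewrite t2 andbT (le_trans (ltW ab)).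
by apply: smooth_arc_ext arc => t /andP[t1 t2]; apply: e; rewrite t1 (le_trans t2).
Qed.

Lemma pw_cat c a b d : pw_smooth c a b -> pw_smooth c b d -> pw_smooth c a d.
Proof. by elim=> // {}a {}b e ab arc _ IH /IH; exact: pw_cons. Qed.

Lemma pw_sub c a b a' b' : a <= a' -> a' <= b' -> b' <= b ->
  pw_smooth c a b -> pw_smooth c a' b'.
Proof.
move=> + + + P; elim: P a' b' => [{}a|{}a {}b d ab arc P IH] a' b' aa ab' bb.
  have e1 : a' = a by apply/eqP; rewrite eq_le aa (le_trans ab' bb).
  have -> : b' = a' by apply/eqP; rewrite eq_le ab' e1 bb.
  exact: pw_nil.
have [ba|ba] := leP b a'; first exact: IH.
have [bb'|bb'] := leP b' b.
  move: ab'; rewrite le_eqVlt => /orP[/eqP <-|ab']; first exact: pw_nil.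
  by apply: (pw_cons ab'); [exact: smooth_arc_sub arc|exact: pw_nil].
apply: (pw_cons ba); first exact: smooth_arc_sub arc.
by apply: IH => //; exact: ltW.
Qed.

Lemma derive1_translate g l t : derive1 (fun s => g (s + l)) t = derive1 g (t + l).
Proof.
rewrite !derive1E /derive.
by under eq_fun do rewrite /= -addrA.
Qed.

Lemma smooth_translate g l : smooth_curve g -> smooth_curve (fun s => g (s + l)).
Proof.
move=> sg n t.
have -> : derive1n n (fun s => g (s + l)) = fun s => derive1n n g (s + l).
  elim: n => [|n IH]; first by [].
  rewrite -[LHS]/(derive1 (derive1n n (fun s => g (s + l)))) IH.
  by apply/funext => s; exact: derive1_translate.
have := sg n (t + l); rewrite /derivable.
by under eq_fun do rewrite /= addrA.
Qed.

Lemma pw_translate c a b l : pw_smooth c a b ->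
  pw_smooth (fun t => c (t + l)) (a - l) (b - l).
Proof.
elim=> [{}a|{}a {}b d ab [g [sg h]] _ IH]; first exact: pw_nil.
apply: pw_cons IH; first by rewrite ltrD2r.
exists (fun s => g (s + l)); split; first exact: smooth_translate.
move=> t; rewrite in_itv /= => ht; rewrite derive1_translate; apply: h.
by rewrite in_itv /=; apply/andP; split; lra.
Qed.

(** Go to the arc on which the value is passed and use its smooth extension [g]; no separate
    continuity statement for [c] is required. *)
Lemma pw_IVT c a b (F : plane R -> R) v : continuous F -> pw_smooth c a b ->
  F (c a) <= v -> v <= F (c b) -> exists p, a <= p <= b /\ F (c p) = v.
Proof.
move=> cF; elim=> [{}a|{}a {}b d ab [g [sg h]] P IH] h1 h2.
  by exists a; split; [rewrite lexx|apply/eqP; rewrite eq_le h1].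
have [hb|hb] := leP v (F (c b)); last first.
  have [p [/andP[p1 p2] pv]] := IH (ltW hb) h2; exists p; split=> //.
  by rewrite p2 andbT (le_trans (ltW ab)).
have ha : c a = g a by apply: (h a _).1; rewrite in_itv /= lexx ltW.
have hb' : c b = g b by apply: (h b _).1; rewrite in_itv /= lexx ltW.
have [||p] := @IVT R (fun t => F (g t)) a b v (ltW ab).
- apply: continuous_subspaceT => t; apply: (@continuous_comp _ _ _ g F); last exact: cF.
  exact: continuous_smooth.
- by rewrite ge_min le_max -ha -hb' h1 hb orbT.
rewrite in_itv /= => pab pv; exists p; split; last by rewrite (h p _).1 ?in_itv.
by have /andP[p1 p2] := pab; rewrite p1 (le_trans p2 (pw_le P)).
Qed.

Lemma pw_of_subdivision c (m : nat) (s : nat -> R) :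
  (forall i, (i < m)%N -> s i < s i.+1 /\ smooth_arc c (s i) (s i.+1)) ->
  pw_smooth c (s 0%N) (s m).
Proof.
elim: m s => [|m IH] s h; first exact: pw_nil.
have [h1 h2] := h 0%N isT; apply: (pw_cons h1 h2).
by apply: (IH (fun i => s i.+1)) => i im; apply: h.
Qed.

Lemma subdivision_of_pw c a b : pw_smooth c a b -> exists (m : nat) (s : nat -> R),
  [/\ s 0%N = a, s m = b &
  forall i, (i < m)%N -> s i < s i.+1 /\ smooth_arc c (s i) (s i.+1)].
Proof.
elim=> [{}a|{}a {}b d ab arc _ [m [s [s0 sm h]]]]; first by exists 0%N, (fun=> a).
exists m.+1, (fun i => if i is j.+1 then s j else a); split=> // -[_|i].
  by rewrite s0.
exact: h.
Qed.

Lemma piecewise_smoothP (A : set (plane R)) : piecewise_smooth_closed_curve A <->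
  exists c, [/\ c @` `[0, 1] = A, c 0 = c 1, {in `[0, 1[ &, injective c} & pw_smooth c 0 1].
Proof.
split=> [[c [m [s [h1 h2 h3 [s0 s1] h]]]]|[c [h1 h2 h3 P]]].
  by exists c; split=> //; rewrite -s0 -s1; exact: pw_of_subdivision.
have [m [s [s0 sm h]]] := subdivision_of_pw P.
by exists c, m, s; split.
Qed.

Lemma smooth_segment q w l : smooth_curve (fun t => q + (t - l) *: w) /\
  forall t, derive1 (fun t => q + (t - l) *: w) t = w.
Proof.
have D t : is_derive t 1 (fun t => q + (t - l) *: w) w.
  have : (fun h : R => h^-1 *: ((q + (h *: (1 : R) + t - l) *: w) - (q + (t - l) *: w))) @ 0^' --> w.
    have : cst w @ (0 : R)^' --> w by exact: cvg_cst.
    apply: cvg_trans; apply: near_eq_cvg; near=> h.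
    have h0 : h != 0 by near: h; exact: nbhs_dnbhs_neq.
    rewrite /cst [h%:A]mulr1 opprD addrACA subrr add0r -scalerBl.
    have -> : h + t - l - (t - l) = h by ring.
    by rewrite scalerA mulVf// scale1r.
  move=> cv; apply: DeriveDef; first by apply: cvgP; exact: cv.
  exact: cvg_lim cv.
have E t : derive1 (fun t => q + (t - l) *: w) t = w.
  by rewrite derive1E; exact: derive_val.
split=> // n t; case: n => [|n]; first by case: (D t).
suff -> : derive1n n.+1 (fun t => q + (t - l) *: w) = cst (if n == 0%N then w else 0).
  exact: derivable_cst.
elim: n => [|n IH]; first by apply/funext => s; exact: E.
rewrite -[LHS]/(derive1 (derive1n n.+1 (fun t => q + (t - l) *: w))) IH; apply/funext => s.
by rewrite derive1_cst.
Unshelve. all: by end_near. Qed.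

End PiecewiseSmooth.

(** * Intersection with a half-plane *)

Section HalfPlaneCut.
Variable R : realType.
Implicit Types (a b d k l p r s t x y : R) (z u w q : plane R).
Implicit Types (c g : R -> plane R) (N : plane R -> R).

(** The gauge of the intersection of [body N] with the half-plane [dot z w <= 1]. *)
Definition cut_gauge N w z : R := Num.max (N z) (dot z w).

Lemma gauge_cut N w : gauge N -> gauge (cut_gauge N w).
Proof.
move=> hN; apply: gauge_max => // [a z _|z z']; first by rewrite dotZl.
by rewrite dotDl.
Qed.

(** A ray from an interior point crosses the boundary once: along it [N] is convex and starts below
    1. *)
Lemma line_exit N q w : gauge N -> N q < 1 -> w != 0 ->
  exists x, [/\ 0 < x, N (q + x *: w) = 1,
    forall y, 0 <= y < x -> N (q + y *: w) < 1 &
    forall y, x < y -> 1 < N (q + y *: w)].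
Proof.
move=> hN q1 w0; have Nw := gauge_gt0 hN w0.
pose f x := N (q + x *: w).
have cf : continuous f.
  move=> x; apply: (@continuous_comp _ _ _ (fun x => q + x *: w) N).
    by apply: cvgD; [exact: cvg_cst|apply: cvgZr_tmp; exact: cvg_id].
  exact: gauge_continuous.
(* By the triangle inequality the ray has left the interior at this parameter. *)
pose X := (1 + N (- q)) / N w.
have X0 : 0 <= X by rewrite divr_ge0 ?addr_ge0 ?gauge_ge0.
have fX : 1 <= f X.
  have : N (X *: w) <= f X + N (- q).
    by apply: le_trans (gaugeD _ _ hN); rewrite addrAC subrr add0r.
  by rewrite gaugeZ// divfK ?gt_eqF// lerD2r.
have [|x] := @IVT R f 0 X 1 X0 (continuous_subspaceT cf).
  by rewrite ge_min le_max fX /f scale0r addr0 (ltW q1) orbT.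
rewrite in_itv /= => /andP[x0 _] fx.
have {}x0 : 0 < x.
  rewrite lt_neqAle x0 andbT; apply/eqP => e; move: fx q1.
  by rewrite /f -e scale0r addr0 => ->; rewrite ltxx.
have conv (y z : R) : 0 <= y -> y <= z -> 0 < z -> f y <= (1 - y / z) * N q + y / z * f z.
  move=> y0 yz z0; have yz0 : 0 <= y / z by rewrite divr_ge0// ltW.
  have yz1 : 0 <= 1 - y / z by rewrite subr_ge0 ler_pdivrMr// mul1r.
  rewrite -!gaugeZ//; apply: le_trans (gaugeD _ _ hN).
  rewrite scalerDr addrA -scalerDl subrK scale1r scalerA divfK ?gt_eqF//.
exists x; split=> // y.
  move=> /andP[y0 yx]; apply: le_lt_trans (conv _ _ y0 (ltW yx) x0) _.
  rewrite fx; have : 0 < (1 - y / x) * (1 - N q); last by lra.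
  by rewrite mulr_gt0// subr_gt0// ltr_pdivrMr// mul1r.
move=> xy; have y0 := lt_trans x0 xy; rewrite -/(f y).
have := conv x y (ltW x0) (ltW xy) y0; rewrite fx.
have r0 : 0 < x / y by rewrite divr_gt0.
have r1 : x / y < 1 by rewrite ltr_pdivrMr// mul1r.
move: (x / y) r0 r1 => r r0 r1 h; rewrite ltNge; apply/negP => h2.
have : (1 - r) * N q < 1 - r by rewrite gtr_pMr// subr_gt0.
have : r * f y <= r by rewrite ger_pMr.
by lra.
Qed.

End HalfPlaneCut.

(** * The boundary after a cut *)

Section BoundaryCut.
Variable R : realType.
Implicit Types (a b d k l p r s t x y : R) (z u w q v : plane R).
Implicit Types (c g e : R -> plane R) (N : plane R -> R).

(** Running through the curve twice makes every window [[p, p + 1[] a parametrization of the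
    boundary, so the starting point is free. *)
Lemma unrolled_curve N c : c @` `[0, 1] = [set z | N z = 1] -> c 0 = c 1 ->
  {in `[0, 1[ &, injective c} -> pw_smooth c 0 1 ->
  exists e, [/\ pw_smooth e 0 2, forall t, 0 <= t <= 1 -> e (t + 1) = e t,
    forall t, 0 <= t <= 2 -> N (e t) = 1,
    forall p s t, 0 <= p <= 1 -> p <= s < p + 1 -> p <= t < p + 1 -> e s = e t -> s = t &
    forall p z, 0 <= p <= 1 -> N z = 1 -> exists t, p <= t < p + 1 /\ e t = z].
Proof.
move=> cim c01 cinj P.
pose e t := if t <= 1 then c t else c (t - 1).
have Pe : pw_smooth e 0 2.
  apply: (@pw_cat _ _ 0 1).
    by apply: pw_ext P => t /andP[_ t1]; rewrite /e t1.
  have := pw_translate (- 1) P; rewrite opprK add0r (_ : 1 + 1 = 2)//.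
  apply: pw_ext => t /andP[t1 t2]; rewrite /e; case: leP => // t1'.
  have -> : t = 1 by apply/eqP; rewrite eq_le t1'.
  by rewrite subrr c01.
have eper t : 0 <= t <= 1 -> e (t + 1) = e t.
  move=> /andP[t0 t1]; rewrite /e t1 addrK; case: leP => // t2.
  have -> : t = 0 by apply/eqP; rewrite eq_le t0 andbT; lra.
  by rewrite add0r c01.
have eN t : 0 <= t <= 2 -> N (e t) = 1.
  move=> /andP[t0 t2]; have sub x : 0 <= x <= 1 -> N (c x) = 1.
    move=> hx; have : (c @` `[0, 1]) (c x) by exists x; rewrite //= in_itv.
    by rewrite cim.
  rewrite /e; case: leP => t1; apply: sub; rewrite ?t0//; lra.
have einj p s t : 0 <= p <= 1 -> p <= s < p + 1 -> p <= t < p + 1 -> e s = e t -> s = t.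
  move=> /andP[p0 p1] /andP[s1 s2] /andP[t1 t2].
  pose r x := if x < 1 then x else x - 1.
  have er x : 0 <= x < 2 -> e x = c (r x) /\ 0 <= r x < 1.
    move=> /andP[h0 h2]; rewrite /e /r; case: (ltgtP x 1) => h1.
    - by rewrite h0 h1.
    - by split=> //; apply/andP; split; lra.
    - by rewrite h1 subrr c01 lexx ltr01.
  have [-> rs] := er s ltac:(apply/andP; split; lra).
  have [-> rt] := er t ltac:(apply/andP; split; lra).
  move=> h; have := cinj (r s) (r t); rewrite !in_itv /= => /(_ rs rt h).
  by rewrite /r; case: ltP => h1; case: ltP => h2; lra.
have esurj p z : 0 <= p <= 1 -> N z = 1 -> exists t, p <= t < p + 1 /\ e t = z.
  move=> /andP[p0 p1] Nz; have : (c @` `[0, 1]) z by rewrite cim.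
  move=> [t /=]; rewrite in_itv /= => /andP[t0 t1] <-.
  have [tp|tp] := leP p t.
    have [t1'|t1'] := ltP t (p + 1).
      by exists t; rewrite tp t1' /e t1.
    have tE : t = 1 by lra.
    exists 0; rewrite tE; have -> : p = 0 by lra.
    by rewrite add0r lexx ltr01 /e ler01 c01.
  exists (t + 1); rewrite eper ?t0// /e t1; split=> //; apply/andP; split; lra.
by exists e.
Qed.

(* [q + x v] parametrizes the cutting line; the chord is [- x1 <= x <= x2]. *)
Lemma cut_chord N w z0 : gauge N -> N z0 = 1 -> 1 < dot z0 w ->
  exists q v x1 x2, [/\ 0 < x1, 0 < x2 & v != 0] /\
   [/\ forall x, dot (q + x *: v) w = 1,
    forall z, dot z w = 1 -> exists x, z = q + x *: v,
    forall x, - x1 < x < x2 -> N (q + x *: v) < 1,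
    N (q + (- x1) *: v) = 1 /\ N (q + x2 *: v) = 1 &
    forall x, N (q + x *: v) <= 1 -> - x1 <= x <= x2].
Proof.
move=> hN bz0 fz0; pose f z := dot z w.
pose q := (dot z0 w)^-1 *: z0; pose v : plane R := (- w.2, w.1).
have fq : f q = 1 by rewrite /f /q dotZl mulVf// gt_eqF// (lt_trans ltr01).
have Nq : N q < 1.
  by rewrite /q gaugeZ ?bz0 ?mulr1 ?invr_ge0 ?invf_lt1// ?ltW// (lt_trans ltr01).
have w0 : w != 0.
  by apply: contraTneq fz0 => ->; rewrite /dot /= !mulr0 addr0 -leNgt ler01.
have v0 : v != 0.
  apply: contra_neq w0 => v0; have /= := congr1 fst v0; have /= := congr1 snd v0.
  by move=> h1 /eqP; rewrite oppr_eq0 => /eqP h2; apply: injective_projections.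
have fv : f v = 0 by rewrite /f /v /dot /=; ring.
have line z : f z = 1 -> exists x, z = q + x *: v.
  move=> fz; have n0 : dot w w != 0 by rewrite dot_eq0.
  exists (dot (z - q) v / dot w w).
  have fzq : dot (z - q) w = 0 by rewrite dotBl -/(f z) -/(f q) fz fq subrr.
  apply: (addrI (- q)); rewrite addrA addNr add0r addrC.
  move: (z - q) fzq n0 => [x y]; rewrite /v; case: (w) => w1 w2; rewrite /dot /= => h n0.
  apply: injective_projections; rewrite /= /GRing.scale /=; apply: (mulIf n0).
    rewrite mulrAC divfK//; apply/eqP; rewrite -subr_eq0; apply/eqP.
    by transitivity ((x * w1 + y * w2) * w1); [ring|rewrite h mul0r].
  rewrite mulrAC divfK//; apply/eqP; rewrite -subr_eq0; apply/eqP.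
  by transitivity ((x * w1 + y * w2) * w2); [ring|rewrite h mul0r].
have [x2 [x20 Nx2 in2 out2]] := line_exit hN Nq v0.
have [x1 [x10 Nx1 in1 out1]] : exists x1, [/\ 0 < x1, N (q + (- x1) *: v) = 1,
    forall y, 0 <= y < x1 -> N (q + (- y) *: v) < 1 &
    forall y, x1 < y -> 1 < N (q + (- y) *: v)].
  have vn0 : - v != 0 by rewrite oppr_eq0.
  have [x [h1 h2 h3 h4]] := line_exit hN Nq vn0; rewrite scalerN -scaleNr in h2.
  exists x; split=> // y.
    by move=> /h3; rewrite scalerN -scaleNr.
  by move=> /h4; rewrite scalerN -scaleNr.
set A := q + (- x1) *: v in Nx1; set B := q + x2 *: v in Nx2.
have fqv y : f (q + y *: v) = 1.
  by move: fq fv; rewrite /f dotDl dotZl => -> ->; rewrite mulr0 addr0.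
have fA : f A = 1 by exact: fqv.
have fB : f B = 1 by exact: fqv.
have chordlt x : - x1 < x < x2 -> N (q + x *: v) < 1.
  move=> /andP[h1 h2]; have [x0|x0] := leP 0 x; first by rewrite in2// x0.
  by have := in1 (- x); rewrite opprK oppr_ge0 (ltW x0) ltrNl h1 => /(_ isT).
exists q, v, x1, x2; split=> //; split=> // x Nx.
apply/andP; split; rewrite leNgt.
  apply/negP => h; have := out1 (- x); rewrite opprK ltrNr => /(_ h).
  by rewrite ltNge Nx.
by apply/negP => /out2; rewrite ltNge Nx.
Qed.

(** Start at a boundary point that is cut off. The surviving boundary is then a single parameter
    interval between the two crossings of the line, and the chord closes it. *)
Lemma boundary_cut N w c : gauge N -> c @` `[0, 1] = bd (body N) -> c 0 = c 1 ->
  {in `[0, 1[ &, injective c} -> pw_smooth c 0 1 ->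
  (exists z, bd (body N) z /\ 1 < dot z w) ->
  piecewise_smooth_closed_curve (bd (body (cut_gauge N w))).
Proof.
move=> hN cim c01 cinj P [z0 [bz0 fz0]]; rewrite body_bd//= in bz0 cim.
rewrite body_bd; last exact: gauge_cut.
pose f z := dot z w.
have cf : continuous (fun z : plane R => f z - 1).
  move=> z; apply: cvgB; last exact: cvg_cst.
  by apply: cvgD; apply: cvgM; try exact: cvg_cst; [exact: cvg_fst|exact: cvg_snd].
have [e [Pe eper eN einj esurj]] := unrolled_curve cim c01 cinj P.
have [q [v [x1 [x2 [[x10 x20 v0] [fqv line chordlt [Nx1 Nx2] chordR]]]]]] :=
  cut_chord hN bz0 fz0.
set A := q + (- x1) *: v in Nx1; set B := q + x2 *: v in Nx2.
have fA : f A = 1 by exact: fqv.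
have fB : f B = 1 by exact: fqv.
have AB z : f z = 1 -> N z = 1 -> z = A \/ z = B.
  move=> /line[x ->] Nx; have : N (q + x *: v) <= 1 by rewrite Nx.
  move=> /chordR/andP[h1 h2].
  move: h1; rewrite le_eqVlt => /orP[/eqP <-|h1]; first by left.
  move: h2; rewrite le_eqVlt => /orP[/eqP ->|h2]; first by right.
  by have := chordlt x; rewrite h1 h2 Nx ltxx => /(_ isT).
have chordN x : - x1 <= x <= x2 -> N (q + x *: v) <= 1.
  move=> /andP[]; rewrite le_eqVlt => /orP[/eqP <- _|h1]; first by rewrite Nx1.
  rewrite le_eqVlt => /orP[/eqP ->|h2]; first by rewrite Nx2.
  by rewrite ltW// chordlt// h1.
have [p0 [hp0 ep0]] : exists p, 0 <= p <= 1 /\ e p = z0.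
  have [|t [/andP[t0 t1] <-]] := esurj 0 z0 _ bz0; first by rewrite lexx ler01.
  by exists t; rewrite t0 ltW// -[1]add0r.
have /andP[p00 p01] := hp0.
have ep1 : e (p0 + 1) = z0 by rewrite eper.
have Ptw s t : p0 <= s -> s <= t -> t <= p0 + 1 -> pw_smooth e s t.
  move=> h1 h2 h3; apply: pw_sub Pe => //; first exact: le_trans h1.
  by apply: le_trans h3 _; rewrite -[2]/(1 + 1) lerD2r.
(* The crossings in order of their parameters; the disjunction records which end of the chord comes
   first. *)
have key s t ys yt : p0 < s -> s < t -> t < p0 + 1 -> e s = q + ys *: v -> e t = q + yt *: v ->
    (ys = - x1 /\ yt = x2) \/ (ys = x2 /\ yt = - x1) ->
    exists c', [/\ c' @` `[0, 1] = [set z | cut_gauge N w z = 1], c' 0 = c' 1,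
      {in `[0, 1[ &, injective c'} & pw_smooth c' 0 1].
  move=> ps st tp es et yst.
  have esA : e s = A \/ e s = B by rewrite es; case: yst => -[-> _]; [left|right].
  have etA : e t = A \/ e t = B by rewrite et; case: yst => -[_ ->]; [right|left].
  have est : e s <> e t.
    have hs : p0 <= s < p0 + 1 by apply/andP; split; [exact: ltW|exact: lt_trans tp].
    have ht : p0 <= t < p0 + 1 by rewrite tp andbT ltW// (lt_trans ps).
    by move=> /(einj p0 s t hp0 hs ht) h; move: st; rewrite h ltxx.
  have fes : f (e s) = 1 by case: esA => ->.
  have fet : f (e t) = 1 by case: etA => ->.
  have zeros p : p0 <= p < p0 + 1 -> f (e p) = 1 -> p = s \/ p = t.
    move=> hp fp; have Np : N (e p) = 1 by apply: eN; lra.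
    have hs : p0 <= s < p0 + 1 by lra.
    have ht : p0 <= t < p0 + 1 by lra.
    case: (AB _ fp Np) => epA; case: esA => esA; case: etA => etA.
    - by case: est; rewrite esA etA.
    - by left; apply: (einj p0) => //; rewrite epA esA.
    - by right; apply: (einj p0) => //; rewrite epA etA.
    - by case: est; rewrite esA etA.
    - by case: est; rewrite esA etA.
    - by right; apply: (einj p0) => //; rewrite epA etA.
    - by left; apply: (einj p0) => //; rewrite epA esA.
    - by case: est; rewrite esA etA.
  have cf' : continuous (fun z : plane R => 1 - f z).
    have -> : (fun z : plane R => 1 - f z) = (fun z => - (f z - 1)).
      by apply/funext => z'; rewrite opprB.
    by move=> z'; apply: cvgN; exact: cf.
  have ivt_up x y : p0 <= x -> x <= y -> y <= p0 + 1 -> f (e x) <= 1 -> 1 <= f (e y) ->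
      exists p, x <= p <= y /\ f (e p) = 1.
    move=> h1 h2 h3 h4 h5.
    have [||p [hp fp]] := @pw_IVT R e x y (fun z => f z - 1) 0 cf (Ptw _ _ h1 h2 h3).
    - by rewrite subr_le0.
    - by rewrite subr_ge0.
    by exists p; split=> //; lra.
  have ivt_down x y : p0 <= x -> x <= y -> y <= p0 + 1 -> 1 <= f (e x) -> f (e y) <= 1 ->
      exists p, x <= p <= y /\ f (e p) = 1.
    move=> h1 h2 h3 h4 h5.
    have [||p [hp fp]] := @pw_IVT R e x y (fun z => 1 - f z) 0 cf' (Ptw _ _ h1 h2 h3).
    - by rewrite subr_le0.
    - by rewrite subr_ge0.
    by exists p; split=> //; lra.
  have fe0 : 1 <= f (e p0) by rewrite ep0 ltW.
  have fe1 : 1 <= f (e (p0 + 1)) by rewrite ep1 ltW.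
  have sp1' : s < p0 + 1 by exact: lt_trans tp.
  have out_l p : p0 <= p < s -> 1 < f (e p).
    move=> /andP[h1 h2]; rewrite ltNge; apply/negP => fp.
    have hp' := ltW (lt_trans h2 sp1').
    have [p' [/andP[p'1 p'2] fp']] := ivt_down p0 p (lexx _) h1 hp' fe0 fp.
    have hz : p0 <= p' < p0 + 1 by rewrite p'1 (le_lt_trans p'2)// (lt_trans h2).
    have p's := le_lt_trans p'2 h2.
    case: (zeros p' hz fp') => e'; first by rewrite e' ltxx in p's.
    by have := lt_trans p's st; rewrite e' ltxx.
  have out_r p : t < p <= p0 + 1 -> 1 < f (e p).
    move=> /andP[h1 h2]; rewrite ltNge; apply/negP => fp.
    have h0 : p0 <= p by rewrite ltW// (lt_trans ps)// (lt_trans st).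
    have [p' [/andP[p'1 p'2] fp']] := ivt_up p (p0 + 1) h0 h2 (lexx _) fp fe1.
    have tp' := lt_le_trans h1 p'1.
    have [p'3|p'3] := ltP p' (p0 + 1).
      have hz : p0 <= p' < p0 + 1 by rewrite p'3 (le_trans h0).
      case: (zeros p' hz fp') => e'; last by rewrite e' ltxx in tp'.
      by have := lt_trans st tp'; rewrite e' ltxx.
    have p'E : p' = p0 + 1 by apply/eqP; rewrite eq_le p'2.
    by move: fp'; rewrite p'E ep1 => fz1; move: fz0; rewrite -/(f z0) fz1 ltxx.
  (* The boundary point opposite to [z0] lies strictly inside the half-plane. It decides that the
     part between the crossings survives. *)
  have [p1 [hp1 fp1]] : exists p, p0 <= p < p0 + 1 /\ f (e p) < 1.
    have z0n : - z0 != 0.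
      by rewrite oppr_eq0; apply: contraTneq fz0 => ->; rewrite /dot /= !mul0r addr0 -leNgt ler01.
    have Nn := gauge_gt0 hN z0n.
    have [|p [hp ep]] := esurj p0 ((N (- z0))^-1 *: - z0) hp0.
      by rewrite gaugeZ ?mulVf ?gt_eqF// invr_ge0 ltW.
    have dN : dot (- z0) w = - dot z0 w by rewrite /dot /=; ring.
    exists p; split=> //; rewrite ep /f dotZl dN.
    apply: lt_trans ltr01; rewrite pmulr_rlt0 ?invr_gt0// oppr_lt0.
    exact: lt_trans ltr01 fz0.
  have [sp1 p1t] : s < p1 /\ p1 < t.
    split; rewrite ltNge; apply/negP => h.
      move: h; rewrite le_eqVlt => /orP[/eqP h|h]; first by rewrite h fes ltxx in fp1.
      by have := out_l p1; rewrite h (andP hp1).1 => /(_ isT)/(lt_trans fp1); rewrite ltxx.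
    move: h; rewrite le_eqVlt => /orP[/eqP h|h]; first by rewrite -h fet ltxx in fp1.
    by have := out_r p1; rewrite h (ltW (andP hp1).2) => /(_ isT)/(lt_trans fp1); rewrite ltxx.
  have inside p : s < p < t -> f (e p) < 1.
    move=> /andP[h1 h2]; rewrite ltNge; apply/negP => fp.
    have [pp|pp] := leP p1 p.
      have [p' [/andP[p'1 p'2] fp']] :=
        ivt_up p1 p (andP hp1).1 pp (ltW (lt_trans h2 tp)) (ltW fp1) fp.
      have hz : p0 <= p' < p0 + 1.
        by rewrite (le_trans (andP hp1).1)// (le_lt_trans p'2)// (lt_trans h2).
      case: (zeros p' hz fp') => e'; rewrite e' in p'1 p'2.
        by move: sp1; rewrite ltNge p'1.
      by move: h2; rewrite ltNge p'2.
    have [p' [/andP[p'1 p'2] fp']] :=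
      ivt_down p p1 (ltW (lt_trans ps h1)) (ltW pp) (ltW (andP hp1).2) fp (ltW fp1).
    have hz : p0 <= p' < p0 + 1.
      by rewrite (le_trans (ltW (lt_trans ps h1)))// (le_lt_trans p'2)// (andP hp1).2.
    case: (zeros p' hz fp') => e'; rewrite e' in p'1 p'2.
      by move: h1; rewrite ltNge p'1.
    by move: p1t; rewrite ltNge p'2.
  have fle p : s <= p <= t -> f (e p) <= 1.
    move=> /andP[]; rewrite le_eqVlt => /orP[/eqP <- _|h1]; first by rewrite fes.
    rewrite le_eqVlt => /orP[/eqP ->|h2]; first by rewrite fet.
    by rewrite ltW// inside// h1.
  (* The old arc keeps its speed on [[0, L]]; as [L < 1], the chord is run through on the rest of
     the unit interval. *)
  pose L := t - s; have L0 : 0 < L by rewrite /L; lra.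
  have L1 : L < 1 by rewrite /L; lra.
  have L1' : 0 < 1 - L by lra.
  pose W := (1 - L)^-1 *: (e s - e t).
  pose c' x := if x <= L then e (x + s) else e t + (x - L) *: W.
  have chordE x : e t + (x - L) *: W = q + (yt + (x - L) / (1 - L) * (ys - yt)) *: v.
    rewrite /W es et; move: ((1 - L)^-1) (x - L) => k l.
    by apply: injective_projections; rewrite /= /GRing.scale /=; ring.
  have yne : ys - yt != 0.
    by move: yst x10 x20; clear => -[] [-> ->] ? ?; apply/eqP; lra.
  have rin r : 0 <= r <= 1 -> - x1 <= yt + r * (ys - yt) <= x2.
    move=> /andP[r0 r1]; move: yst x10 x20 r0 r1; clear => -[] [-> ->] ? ? ? ?;
      by apply/andP; split; nra.
  have rin' r : 0 < r < 1 -> - x1 < yt + r * (ys - yt) < x2.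
    move=> /andP[r0 r1]; move: yst x10 x20 r0 r1; clear => -[] [-> ->] ? ? ? ?;
      by apply/andP; split; nra.
  have Nxs x : 0 <= x <= L -> N (e (x + s)) = 1.
    move=> /andP[hx0 hxL]; apply: eN; move: p00 p01 ps tp hx0 hxL.
    by rewrite /L; clear => *; apply/andP; split; lra.
  exists c'; split.
  - apply/seteqP; split=> [z [x /=]|z /= Mz].
      rewrite in_itv /= => /andP[hx0 hx1] <-; rewrite /cut_gauge /c'; case: leP => xL.
        rewrite Nxs ?hx0//; apply/max_idPl; apply: fle.
        by rewrite lerDr hx0 -lerBrDr.
      rewrite chordE fqv; apply/max_idPr; apply: chordN; apply: rin.
      by rewrite divr_ge0 ?subr_ge0 ?(ltW xL) ?(ltW L1)//= ler_pdivrMr// mul1r lerD2r.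
    move: Mz; rewrite /cut_gauge; have [h Nz|h fz] := leP (dot z w) (N z).
      have [p [hp ep]] := esurj p0 z hp0 Nz.
      have fz : f (e p) <= 1 by rewrite ep -Nz.
      have sp : s <= p.
        by rewrite leNgt; apply/negP => ps'; have := out_l p; rewrite (andP hp).1 ps' => /(_ isT)/(le_lt_trans fz); rewrite ltxx.
      have pt : p <= t.
        rewrite leNgt; apply/negP => tp'; have := out_r p.
        by rewrite tp' (ltW (andP hp).2) => /(_ isT)/(le_lt_trans fz); rewrite ltxx.
      exists (p - s); last by rewrite /c' /L lerD2r pt subrK.
      rewrite /= in_itv /= subr_ge0 sp /=; apply: le_trans (ltW L1).
      by rewrite /L lerD2r.
    have [y zE] := line z fz; have Nz : N z < 1 by rewrite -fz.
    have /andP[y1 y2] : - x1 <= y <= x2 by apply: chordR; rewrite -zE ltW.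
    have y1' : - x1 < y.
      rewrite lt_neqAle y1 andbT; apply/eqP => yE.
      by move: Nz; rewrite zE -yE Nx1 ltxx.
    have y2' : y < x2.
      rewrite lt_neqAle y2 andbT; apply/eqP => yE.
      by move: Nz; rewrite zE yE Nx2 ltxx.
    have x120 : 0 < x1 + x2 by exact: addr_gt0.
    have [r [/andP[r0 r1] yr]] : exists r, 0 < r < 1 /\ y = yt + r * (ys - yt).
      case: yst => -[-> ->]; [exists ((x2 - y) / (x1 + x2))|exists ((y + x1) / (x1 + x2))];
        (split; last by field; rewrite gt_eqF);
        rewrite ltr_pdivlMr// ltr_pdivrMr// mul0r mul1r; apply/andP; split;
        by move: y1' y2'; clear; lra.
    have rL : 0 < r * (1 - L) by exact: mulr_gt0.
    exists (L + r * (1 - L)).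
      rewrite /= in_itv /= addr_ge0 ?(ltW L0) ?(ltW rL)//=.
      by rewrite -lerBrDl ger_pMl// ltW.
    rewrite /c' leNgt ltrDl rL /= chordE addrAC subrr add0r mulfK ?gt_eqF//.
    by rewrite -yr.
  - rewrite /c' (ltW L0) add0r leNgt L1 /= /W scalerA mulfV ?gt_eqF// scale1r.
    by rewrite addrCA subrr addr0.
  - have rint x : L < x -> x < 1 -> 0 < (x - L) / (1 - L) < 1.
      move=> xL x1'; rewrite divr_gt0 ?subr_gt0//= ltr_pdivrMr// mul1r.
      by rewrite ltrD2r.
    have W0 : W != 0.
      by rewrite /W scaler_eq0 invr_eq0 (gt_eqF L1')/= subr_eq0; exact/eqP.
    have win x : 0 <= x <= L -> p0 <= x + s < p0 + 1.
      move=> /andP[h1 h2]; rewrite ler_wpDl ?(ltW ps)//=.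
      by apply: le_lt_trans tp; rewrite -lerBrDr.
    move=> x y; rewrite !in_itv /= => /andP[hx0 hx1] /andP[hy0 hy1]; rewrite /c'.
    case: leP => xL; case: leP => yL.
    + move=> /(einj p0 (x + s) (y + s) hp0) h; apply: (addIr s); apply: h.
        by apply: win; rewrite hx0.
      by apply: win; rewrite hy0.
    + rewrite chordE => h; have := chordlt _ (rin' _ (rint _ yL hy1)).
      by rewrite -h Nxs ?ltxx// hx0.
    + rewrite chordE => h; have := chordlt _ (rin' _ (rint _ xL hx1)).
      by rewrite h Nxs ?ltxx// hy0.
    + move=> /addrI/eqP; rewrite -subr_eq0 -scalerBl scaler_eq0 (negbTE W0) orbF.
      by rewrite subr_eq0 => /eqP/addIr.
  - apply: (@pw_cat _ _ 0 L); last first.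
      apply: (pw_cons L1); last exact: pw_nil.
      have [sm dE] := smooth_segment (e t) W L.
      exists (fun x => e t + (x - L) *: W); split=> // x.
      rewrite in_itv /= => /andP[x0 x1']; rewrite dE; split.
        rewrite /c'; case: leP => // xL; have -> : x = L by apply/eqP; rewrite eq_le xL.
        by rewrite subrr scale0r addr0 /L subrK.
      rewrite /W scaler_eq0 invr_eq0 (gt_eqF L1')/= subr_eq0; exact/eqP.
    have := pw_translate s (Ptw s t (ltW ps) (ltW st) (ltW tp)).
    rewrite subrr -/L; apply: pw_ext => x /andP[_ xL].
    by rewrite /c' xL.
have [a [ha ea]] := esurj p0 A hp0 Nx1.
have [b [hb eb]] := esurj p0 B hp0 Nx2.
have ne z p : p0 <= p < p0 + 1 -> e p = z -> f z = 1 -> p0 < p.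
  move=> /andP[h1 _] ez fz; rewrite lt_neqAle h1 andbT; apply/eqP => pp.
  by move: fz0; rewrite -ep0 pp ez -/(f z) fz ltxx.
have pa := ne _ _ ha ea fA; have pb := ne _ _ hb eb fB.
apply/piecewise_smoothP; have [ab|ba|ab] := ltgtP a b.
- by apply: (key a b (- x1) x2) => //; [exact: (andP hb).2|left].
- by apply: (key b a x2 (- x1)) => //; [exact: (andP ha).2|right].
- have : f (A - B) = 0 by rewrite /f dotBl -/(f A) -/(f B) fA fB subrr.
  have : A = B by rewrite -ea -eb ab.
  move=> /addrI/eqP; rewrite -subr_eq0 -scalerBl scaler_eq0 (negbTE v0) orbF => /eqP h.
  by move: x10 x20 h; clear; lra.
Qed.

Lemma K2_cut N w : gauge N -> K2 (body N) -> K2 (body (cut_gauge N w)).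
Proof.
move=> hN [_ /piecewise_smoothP[c [c1 c2 c3 c4]]]; split.
  by apply: body_convex_body; exact: gauge_cut.
have [h|h] := pselect (exists z, bd (body N) z /\ 1 < dot z w).
  exact: boundary_cut c4 h.
rewrite (_ : cut_gauge N w = N); first by apply/piecewise_smoothP; exists c.
apply/funext => z; apply/max_idPl; have [->|z0] := eqVneq z 0.
  by rewrite gauge0// /dot /= !mul0r addr0.
have Nz := gauge_gt0 hN z0; rewrite leNgt; apply/negP => hz; apply: h.
exists ((N z)^-1 *: z); rewrite body_bd//= gaugeZ ?invr_ge0 ?(ltW Nz)//.
by rewrite mulVf ?gt_eqF// dotZl -(ltr_pM2l Nz) mulr1 mulrA mulfV ?mul1r ?gt_eqF.
Qed.

Definition cuts N ws : plane R -> R := foldr (fun w M => cut_gauge M w) N ws.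

Lemma gauge_cuts N ws : gauge N -> gauge (cuts N ws).
Proof. by move=> hN; elim: ws => //= w ws; exact: gauge_cut. Qed.

Lemma K2_cuts N ws : gauge N -> K2 (body N) -> K2 (body (cuts N ws)).
Proof. by move=> hN KN; elim: ws => //= w ws; apply: K2_cut; exact: gauge_cuts. Qed.

Lemma le_cuts N ws z : N z <= cuts N ws z.
Proof. by elim: ws => //= w ws IH; rewrite /cut_gauge le_max IH. Qed.

Lemma dot_le_cuts N ws w z : w \in ws -> dot z w <= cuts N ws z.
Proof.
elim: ws => //= w' ws IH; rewrite inE /cut_gauge le_max => /orP[/eqP <-|/IH ->//].
by rewrite lexx orbT.
Qed.

Lemma cuts_le N ws z a : N z <= a -> (forall w, w \in ws -> dot z w <= a) ->
  cuts N ws z <= a.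
Proof.
move=> h; elim: ws => //= w ws IH hw; rewrite /cut_gauge ge_max IH ?hw ?mem_head//.
by move=> w' hw'; apply: hw; rewrite inE hw' orbT.
Qed.

Lemma cuts_lt N ws z a : N z < a -> (forall w, w \in ws -> dot z w < a) ->
  cuts N ws z < a.
Proof.
move=> h; elim: ws => //= w ws IH hw; rewrite /cut_gauge gt_max IH ?hw ?mem_head//.
by move=> w' hw'; apply: hw; rewrite inE hw' orbT.
Qed.

End BoundaryCut.

(** * Equilibria away from the cuts *)

Section InactiveCuts.
Variable R : realType.
Implicit Types (a b d e k l p r s t x y : R) (z u w q v : plane R) (ws : seq (plane R)).
Implicit Types (c g : R -> plane R) (N V : plane R -> R).

Lemma continuous_dot w : continuous (fun z : plane R => dot z w).
Proof.
move=> z; apply: cvgD; apply: cvgM; try exact: cvg_cst; [exact: cvg_fst|exact: cvg_snd].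
Qed.

Lemma cuts_near N ws q : gauge N -> (forall w, w \in ws -> dot q w < N q) ->
  \forall z \near q, cuts N ws z = N z.
Proof.
move=> hN; elim: ws => [|w ws IH] h; first by near=> z.
have hw : 0 < N q - dot q w by rewrite subr_gt0 h// mem_head.
have cw : (fun z => N z - dot z w) z @[z --> q] --> N q - dot q w.
  by apply: cvgB; [exact: gauge_continuous|exact: continuous_dot].
move/cvgrPdist_lt : cw => /(_ _ hw) cw.
near=> z; rewrite /= /cut_gauge.
have -> : cuts N ws z = N z.
  by near: z; apply: IH => w' hw'; apply: h; rewrite inE hw' orbT.
apply/max_idPl; rewrite -subr_ge0; have : `|N q - dot q w - (N z - dot z w)| < N q - dot q w by near: z.
by rewrite ltr_norml => /andP[_]; lra.
Unshelve. all: by end_near. Qed.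

Lemma near_angle q t d : 0 < d -> 0 < dot q (uvec t) -> dot q (uperp t) = 0 ->
  \forall z \near q, exists x r, [/\ `|x| < d, 0 < r & z = r *: uvec (t + x)].
Proof.
move=> d0 q0 q1; have pi0 : 0 < pi / 2 :> R by rewrite divr_gt0// pi_gt0.
have [m [m0 md mp]] := exists_lt_both d0 pi0.
have tm : 0 < tan m by rewrite /tan divr_gt0 ?sin_gt0_pihalf ?cos_gt0_pihalf ?m0//; lra.
have h1 : 0 < dot q (uvec t) * tan m - dot q (uperp t) by rewrite q1 subr0 mulr_gt0.
have h2 : 0 < dot q (uvec t) * tan m + dot q (uperp t) by rewrite q1 addr0 mulr_gt0.
have near0 (f : plane R -> R) : continuous f -> 0 < f q -> \forall z \near q, 0 < f z.
  move=> cf f0; have /cvgrPdist_lt := cf q; move=> /(_ _ f0); apply: filterS => z.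
  by rewrite ltr_norml => /andP[_]; lra.
have cs (w : plane R) : continuous (fun z : plane R => dot z w * tan m).
  by move=> z; apply: cvgM; [exact: continuous_dot|exact: cvg_cst].
near=> z.
have a0 : 0 < dot z (uvec t) by near: z; apply: near0 q0; exact: continuous_dot.
have b1 : 0 < dot z (uvec t) * tan m - dot z (uperp t).
  by near: z; apply: near0 h1 => z; apply: cvgB; [exact: cs|exact: continuous_dot].
have b2 : 0 < dot z (uvec t) * tan m + dot z (uperp t).
  by near: z; apply: near0 h2 => z; apply: cvgD; [exact: cs|exact: continuous_dot].
pose y := dot z (uperp t) / dot z (uvec t).
have ya : dot z (uvec t) * y = dot z (uperp t) by rewrite /y mulrC divfK ?gt_eqF.
have ym : `|y| < tan m.
  by rewrite ltr_norml -(ltr_pM2l a0) -[X in _ && X](ltr_pM2l a0) ya; apply/andP; split; lra.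
have ax : `|atan y| < m.
  move: ym; rewrite !ltr_norml => /andP[y1 y2].
  have mi : m \in `]- (pi / 2), pi / 2[ by rewrite in_itv /=; apply/andP; split; lra.
  by apply/andP; split; rewrite -(tanK mi) -?atanN lt_atan.
have ca : 0 < cos (atan y) by apply: cos_gt0_pihalf; rewrite atan_gtNpi2 atan_ltpi2.
exists (atan y), (dot z (uvec t) / cos (atan y)); split.
- exact: lt_trans md.
- by rewrite divr_gt0.
have := @uvec_tline R 1 t (atan y) (expr1n _ _) (lt0r_neq0 ca); rewrite mul1r => ->.
rewrite scalerA divfK ?gt_eqF//.
by rewrite atanK /tline mul1r scalerDr scalerA ya -plane_decomp.
Unshelve. all: by end_near. Qed.

Lemma near_bdpt N t d : gauge N -> 0 < d ->
  \forall z \near bdpt N t, exists x r, [/\ `|x| < d, 0 < r & z = r *: uvec (t + x)].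
Proof.
move=> hN d0; have n0 := gauge_uvec_gt0 t hN; apply: near_angle => //.
  by rewrite /bdpt dotZl dot_uvec subrr cos0 mulr1 invr_gt0.
by rewrite /bdpt dotZl dotC dot_uperp subrr sin0 mulr0.
Qed.

(** The gauges agree near the point only, so the parameter interval of [g] has to shrink;
    [param_crossing] shows that the shorter arc still covers the boundary nearby. *)
Lemma local_param_transfer N V t g : gauge N -> gauge V -> critical N t ->
  (\forall z \near bdpt N t, V z = N z) ->
  local_param (body N) (bdpt N t) g -> local_param (body V) (bdpt N t) g.
Proof.
move=> hN hV ct nz lp; have tang := local_param_tangent hN ct lp.
have [sg g0 dg [e [e0 hbd near_bd]]] := lp.
split=> //.
have cg : g y @[y --> (0 : R)] --> bdpt N t by rewrite -g0; exact: continuous_smooth.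
have /nbhs_ballP[d /= d0 hd] := cg _ nz.
have [e' [e'0 e'd e'e]] := exists_lt_both d0 e0.
exists e'; split=> //.
  move=> z [y yi <-]; move: yi; rewrite /= in_itv /= => /andP[y1 y2].
  have : bd (body N) (g y) by apply: hbd; exists y => //=; rewrite in_itv /=; lra.
  rewrite !body_bd//= => <-; apply: (hd y).
  by rewrite /ball /= sub0r normrN ltr_norml; lra.
have [d' [d'0 hd']] := param_crossing hN lp tang e'0.
near=> z; move=> bz.
have [x [r [xd r0 zE]]] : exists x r, [/\ `|x| < d', 0 < r & z = r *: uvec (t + x)].
  by near: z; exact: near_bdpt.
have NV : V z = N z by near: z.
have : bd (body N) z by move: bz; rewrite !body_bd//= NV.
rewrite zE => /(bdpt_ray hN r0) ->; have [y [ye <-]] := hd' x xd.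
by exists y => //=; rewrite in_itv /= -ltr_norml.
Unshelve. all: by end_near. Qed.

Lemma inactive_eq N ws t : (forall w, w \in ws -> dot (uvec t) w < N (uvec t)) ->
  cuts N ws (uvec t) = N (uvec t).
Proof.
move=> h; apply/eqP; rewrite eq_le le_cuts andbT.
by apply: cuts_le => // w /h/ltW.
Qed.

Lemma inactive_near N ws t : gauge N -> (forall w, w \in ws -> dot (uvec t) w < N (uvec t)) ->
  \forall z \near bdpt N t, cuts N ws z = N z.
Proof.
move=> hN h; apply: cuts_near => // w hw; have n0 := gauge_uvec_gt0 t hN.
by rewrite gauge_bdpt// /bdpt dotZl mulrC ltr_pdivrMr// mul1r h.
Qed.

(** By convexity a descent of [N] is visible arbitrarily close to [uvec t], where [cuts N ws] and
    [N] coincide. *)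
Lemma inactive_critical N ws t : gauge N ->
  (forall w, w \in ws -> dot (uvec t) w < N (uvec t)) ->
  critical (cuts N ws) t -> critical N t.
Proof.
move=> hN h ct; have eV := inactive_eq h.
suff key e : ~ descends e N t by case: (critical_or_descends t hN) => // /key.
move=> /(descends_slope hN)[m [x [m0 x0 _ hm]]].
have : \forall y \near (0 : R), cuts N ws (tline e t y) = N (tline e t y).
  have cl : tline e t y @[y --> (0 : R)] --> uvec t.
    by rewrite -(tline0 e t); exact: continuous_tline.
  exact: cl _ (cuts_near hN h).
move=> /nbhs_ballP[d /= d0 hd]; have [y [y0 yd yx]] := exists_lt_both d0 x0.
have /hd e1 : ball 0 d y by rewrite /ball /= sub0r normrN gtr0_norm.
have := ct (tline e t y); rewrite dot_tline mulr1 eV e1 leNgt => /negP; apply.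
apply: le_lt_trans (hm y _) _; first by rewrite !ltW.
by rewrite ltrBlDr ltrDl mulr_gt0.
Qed.

Lemma inactive_bdpt N ws t : (forall w, w \in ws -> dot (uvec t) w < N (uvec t)) ->
  bdpt (cuts N ws) t = bdpt N t.
Proof. by move=> h; rewrite /bdpt inactive_eq. Qed.

Section AtInactive.
Variables (N : plane R -> R) (ws : seq (plane R)) (t : R).
Hypotheses (hN : gauge N) (hw : forall w, w \in ws -> dot (uvec t) w < N (uvec t)).
Let V := cuts N ws.
Let hV : gauge V := gauge_cuts ws hN.
Hypothesis (ct : critical V t).

Lemma inactive_local_param g :
  local_param (body V) (bdpt N t) g <-> local_param (body N) (bdpt N t) g.
Proof.
have near1 := inactive_near hN hw; split=> lp; last first.
  exact: local_param_transfer (inactive_critical hN hw ct) near1 lp.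
rewrite -(inactive_bdpt hw) in lp near1 *.
apply: (local_param_transfer hV hN ct _ lp).
by apply: filterS near1 => z zE; rewrite /V zE.
Qed.

Lemma inactive_stable : stable_angle V t -> stable_angle N t.
Proof.
rewrite /stable_angle inactive_bdpt// => -[_ [g /inactive_local_param lp h]].
split; last by exists g.
by apply/equilibrium_critical => //; exact: inactive_critical ct.
Qed.

Lemma inactive_nondegenerate : all_nondegenerate (body N) 0 ->
  Defs.nondegenerate (body V) 0 (bdpt V t).
Proof.
move=> nd; rewrite inactive_bdpt//.
have cN := inactive_critical hN hw ct.
have [h1 h2] := nd _ ((equilibrium_critical t hN).2 cN); split=> [[g /inactive_local_param lp]|ns].
  by have [|g' /inactive_local_param lp' h'] := h1; [exists g|exists g'].
have nsN : ~ smooth_at (body N) (bdpt N t).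
  by move=> [g /inactive_local_param lp]; apply: ns; exists g.
move=> v [v0 [g [hg lim]]]; apply: (h2 nsN); split=> //; exists g; split=> //.
(* The one-sided derivative forces [g] to converge to the point, hence to enter the region where the
   two boundaries coincide. *)
have cg : g s @[s --> 0^'+] --> bdpt N t.
  have : (s *: (s^-1 *: (g s - bdpt N t)) + bdpt N t) @[s --> 0^'+] --> (0 : R) *: v + bdpt N t.
    apply: cvgD; last exact: cvg_cst.
    apply: cvgZ => //; apply: cvg_at_right_filter; exact: cvg_id.
  rewrite scale0r add0r; apply: cvg_trans; apply: near_eq_cvg; near=> s.
  have s0 : 0 < s by near: s; exact: nbhs_right_gt.
  by rewrite scalerA mulfV ?gt_eqF// scale1r subrK.
near=> s; have : bd (body V) (g s) by near: s.
have e : V (g s) = N (g s) by near: s; exact: cg _ (inactive_near hN hw).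
by rewrite !body_bd//= e.
Unshelve. all: by end_near. Qed.

End AtInactive.

End InactiveCuts.

(** * Trigonometry of the discrete spiral *)

Section Spiral.
Variable R : realType.
Implicit Types (a b d k l p r s t x y : R) (z u w q v : plane R) (ws : seq (plane R)).
Implicit Types (N V : plane R -> R) (i j n : nat).

Lemma cos_ge x : 1 - x ^+ 2 / 2 <= cos x.
Proof.
have -> : cos x = 1 - 2 * sin (x / 2) ^+ 2.
  have e : x = x / 2 + x / 2 by lra.
  by rewrite {1}e cosD -!expr2; have := cos2Dsin2 (x / 2); lra.
have : sin (x / 2) ^+ 2 <= (x / 2) ^+ 2.
  have key y : 0 <= y -> sin y ^+ 2 <= y ^+ 2.
    move=> y0; have [hy|hy] := leP y 1.
      rewrite ler_pXn2r ?nnegrE ?sin_le_id//; apply: sin_ge0_pi.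
      by rewrite y0 (le_trans hy)// (le_trans _ (pi_ge2 R))// ler1n.
    apply: le_trans (_ : 1 <= _); last by rewrite expr_ge1// ltW.
    by have := cos2Dsin2 y; have := sqr_ge0 (cos y); lra.
  have [x0|x0] := leP 0 (x / 2); first exact: key.
  by rewrite -sqrrN -sinN -[leRHS]sqrrN key// oppr_ge0 ltW.
by rewrite expr_div_n; lra.
Qed.

Lemma cos_gt_kappa x : 0 < x -> 1 - x ^+ 2 < cos x.
Proof.
move=> x0; apply: lt_le_trans (cos_ge x); have : 0 < x ^+ 2 by rewrite exprn_gt0.
by lra.
Qed.

Lemma sin_ge_xcos x : 0 <= x -> x <= pi -> x * cos x <= sin x.
Proof.
move=> x0 xp; rewrite -subr_ge0.
have -> : 0 = (fun y : R => sin y - y * cos y) 0 by rewrite /= sin0 mul0r subr0.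
apply: (@ge0_derive_le _ (fun y => sin y - y * cos y) (fun y => y * sin y)) => //.
- apply: continuous_subspaceT => y; apply: cvgB; first exact: continuous_sin.
  by apply: cvgM; [exact: cvg_id|exact: continuous_cos].
- move=> y _; apply: is_derive_eq; rewrite /GRing.scale /=; ring.
- move=> y /andP[y0 yx]; rewrite mulr_ge0 ?(ltW y0)// sin_ge0_pi// (ltW y0).
  by rewrite (le_trans (ltW yx)).
Qed.

(* Chosen because [kappa s < cos s] while [kappa s ^+ n] tends to 1 when [n * s]
   is fixed. *)
Definition kappa s : R := 1 - s ^+ 2.

Lemma kappa_gt0 s : 0 < s -> s <= 1 / 2 -> 0 < kappa s.
Proof.
move=> s0 s1; have : s ^+ 2 <= (1 / 2) ^+ 2 by rewrite ler_pXn2r// nnegrE ltW.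
by rewrite /kappa; lra.
Qed.

Lemma kappa_lt1 s : 0 < s -> kappa s < 1.
Proof. by move=> s0; rewrite /kappa ltrBlDr ltrDl exprn_gt0. Qed.

(** With [x] the angle past the foot of a line, the inequality says that the next line cuts deeper.
    Up to the foot [sin x <= 0], so [cos (x + s) >= cos x * cos s], and [kappa s < cos s]. *)
Lemma cos_step_inc s x : 0 < s -> s <= 1 / 2 -> - (pi / 2) < x -> x <= 0 -> kappa s * cos x < cos (x + s).
Proof.
move=> s0 s1 x1 x0; have pi0 := pi_gt0 R; have pi2 := pi_ge2 R.
have c0 : 0 < cos x by apply: cos_gt0_pihalf; apply/andP; split; lra.
have sx : sin x <= 0.
  by rewrite -(opprK x) sinN oppr_le0 sin_ge0_pi//; apply/andP; split; lra.
have ss : 0 <= sin s by apply: sin_ge0_pi; apply/andP; split; lra.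
apply: lt_le_trans (_ : cos x * cos s <= _).
  by rewrite mulrC ltr_pM2l// cos_gt_kappa.
by rewrite cosD lerBrDr gerDl mulr_le0_ge0.
Qed.

(** From the angle [2 * s] past the foot on, [sin x * sin s] exceeds [s ^+ 2], and the next line no
    longer cuts as deep. *)
Lemma cos_step_dec s x : 0 < s -> s <= 1 / 2 -> 2 * s <= x -> x < pi / 2 -> cos (x + s) < kappa s * cos x.
Proof.
move=> s0 s1 x1 x2; have pi0 := pi_gt0 R; have pi2 := pi_ge2 R.
have c0 : 0 < cos x by apply: cos_gt0_pihalf; apply/andP; split; lra.
have ss : 0 < sin s by apply: sin_gt0_pi; apply/andP; split; lra.
(* Chosen so that [2 * cos s ^+ 3 > 1]. *)
have cs : 7 / 8 <= cos s.
  apply: le_trans (cos_ge s); have : s ^+ 2 <= (1 / 2) ^+ 2 by rewrite ler_pXn2r// nnegrE ltW.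
  by lra.
have sx : sin (2 * s) <= sin x.
  by rewrite le_eqVlt; move: x1; rewrite le_eqVlt => /orP[/eqP ->|x1];
    rewrite ?eqxx// ltr_sin ?x1 ?orbT// in_itv /=; apply/andP; split; lra.
have s2 : sin (2 * s) = 2 * sin s * cos s.
  by rewrite (_ : 2 * s = s + s) ?sinD; [ring|lra].
have sc : s * cos s <= sin s by apply: sin_ge_xcos; lra.
have : s ^+ 2 < sin x * sin s.
  apply: lt_le_trans (ler_wpM2r (ltW ss) sx); rewrite s2.
  have h1 : s ^+ 2 * cos s ^+ 2 <= sin s ^+ 2.
    have cs0 : 0 <= cos s by lra.
    rewrite -exprMn ler_pXn2r// nnegrE; [exact: mulr_ge0 (ltW s0) cs0|exact: ltW].
  have -> : 2 * sin s * cos s * sin s = 2 * cos s * sin s ^+ 2 by ring.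
  apply: lt_le_trans (ler_wpM2l _ h1); last by lra.
  rewrite mulrCA ltr_pMr ?exprn_gt0//.
  have -> : 2 * cos s * cos s ^+ 2 = 2 * cos s ^+ 3 by ring.
  have : (7 / 8 : R) ^+ 3 <= cos s ^+ 3 by rewrite ler_pXn2r ?nnegrE//; lra.
  by lra.
move=> h; have cs1 := cos_le1 s; have cx1 := cos_le1 x.
have h2 : cos x * cos s <= cos x by rewrite ger_pMr.
have h3 : s ^+ 2 * cos x <= s ^+ 2 by rewrite ger_pMr// exprn_gt0.
by rewrite cosD /kappa mulrBl mul1r; lra.
Qed.

Lemma cos_chain s x n : 0 < s -> s <= 1 / 2 -> 2 * s <= x -> x + n.+1%:R * s < pi / 2 ->
  cos (x + n.+1%:R * s) < kappa s ^+ n.+1 * cos x.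
Proof.
move=> s0 s1; have e m : m.+1%:R * s = m%:R * s + s by rewrite -[m.+1%:R]natr1 mulrDl mul1r.
move=> x1; elim: n => [|n IH] h.
  by rewrite mul1r expr1 in h *; apply: cos_step_dec => //; apply: lt_trans h; rewrite ltrDl.
have hn : x + n.+1%:R * s < pi / 2 by rewrite [n.+2%:R * s]e in h; lra.
rewrite [n.+2%:R * s]e addrA; apply: lt_trans (_ : kappa s * cos (x + n.+1%:R * s) < _).
  by apply: cos_step_dec => //; have : 0 <= n.+1%:R * s by [rewrite mulr_ge0// ltW]; lra.
by rewrite exprS -mulrA ltr_pM2l ?kappa_gt0//; exact: IH.
Qed.

(** The vector of the half-plane whose foot has distance [r * kappa s ^+ k] and direction
    [T - e * (k%:R * s)]. The sign [e] points out of the arc past its end [T], so increasing [k]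
    goes into the arc. *)
Definition spiral_line s r T e (k : nat) : plane R :=
  (r * kappa s ^+ k)^-1 *: uvec (T - e * (k%:R * s)).

Lemma dot_spiral_line s r T e (k : nat) x : e ^+ 2 = 1 ->
  dot (uvec (T + e * x)) (spiral_line s r T e k) = (r * kappa s ^+ k)^-1 * cos (x + k%:R * s).
Proof.
move=> e1; rewrite /spiral_line dotZr dot_uvec; congr (_ * _).
rewrite [X in cos X](_ : _ = - (e * (x + k%:R * s))); last by ring.
by rewrite cosN; have [-> _] := sign_cos_sin (x + k%:R * s) e1.
Qed.

(** The rate of change of the linear form in direction [e]: it is negative past the foot, where the
    line moves away from the origin. *)
Lemma uperp_spiral_line s r T e (k : nat) x : e ^+ 2 = 1 ->
  e * dot (uperp (T + e * x)) (spiral_line s r T e k) =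
  - ((r * kappa s ^+ k)^-1 * sin (x + k%:R * s)).
Proof.
move=> e1; rewrite /spiral_line dotZr dot_uperp.
rewrite [X in sin X](_ : _ = - (e * (x + k%:R * s))); last by ring.
rewrite sinN; have [_ ->] := sign_cos_sin (x + k%:R * s) e1.
move: (_^-1) (sin _) => A B.
by transitivity (- (e ^+ 2 * (A * B))); [ring|rewrite e1 mul1r].
Qed.

End Spiral.

(** * Where the lines of one spiral are active *)

Section SpiralCut.
Variable R : realType.
Implicit Types (a b d l p r s t x y e T : R) (z u w q v : plane R) (ws : seq (plane R)).
Implicit Types (N V : plane R -> R) (i j k n : nat).

Lemma uperpE t : uperp t = (- (uvec t).2, (uvec t).1).
Proof. by []. Qed.

Lemma uvec_uperp s t : uvec s = uvec t -> uperp s = uperp t.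
Proof. by move=> e; rewrite !uperpE e. Qed.

Lemma descends_eq N e s t : uvec s = uvec t -> descends e N s -> descends e N t.
Proof.
by move=> h [x [x0 hx]]; exists x; split=> //; move: hx; rewrite /tline (uvec_uperp h) h.
Qed.

Lemma critical_not_descends N e t : critical N t -> ~ descends e N t.
Proof.
move=> ct [x [x0]]; have := ct (tline e t x); rewrite dot_tline mulr1.
by move=> h /(le_lt_trans h); rewrite ltxx.
Qed.

Lemma cos_gt0_mod x : 0 < cos x -> exists l : int, `|x + 2 * pi * l%:~R| < pi / 2.
Proof.
have [l /andP[h1 h2]] := angle_shift (- pi) x; set y := x + _ in h1 h2.
have cy : cos y = cos x by have /= := congr1 fst (uvec_period x l).
move=> cx; exists l; rewrite -/y ltNge; apply/negP => hy; have pi0 := pi_gt0 R.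
suff : cos y <= 0 by rewrite cy leNgt cx.
have cpi x' : pi / 2 <= x' <= pi -> cos x' <= 0.
  move=> /andP[u1 u2]; have -> : x' = (x' - pi / 2) + pi / 2 by lra.
  by rewrite cosDpihalf oppr_le0 sin_ge0_pi//; apply/andP; split; lra.
have [y0|y0] := leP 0 y.
  by rewrite ger0_norm// in hy; apply: cpi; rewrite hy /=; lra.
by rewrite ltr0_norm// in hy; rewrite -cosN; apply: cpi; rewrite hy /=; lra.
Qed.

(** A maximum of finitely many functions descends as soon as each one that attains it does; the
    others stay below by continuity. *)
Lemma descends_cuts N ws e t : gauge N ->
  N (uvec t) < cuts N ws (uvec t) \/ descends e N t ->
  (forall w, w \in ws -> dot (uvec t) w < cuts N ws (uvec t) \/ e * dot (uperp t) w < 0) ->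
  descends e (cuts N ws) t.
Proof.
move=> hN hNt hw; set c := cuts N ws (uvec t) in hNt hw *.
have cl : tline e t x @[x --> 0^'+] --> uvec t.
  by apply: cvg_at_right_filter; rewrite -(tline0 e t); exact: continuous_tline.
have lt_near (f : plane R -> R) : continuous f -> f (uvec t) < c ->
    \forall x \near 0^'+, f (tline e t x) < c.
  move=> cf fc; have cv : f (tline e t x) @[x --> 0^'+] --> f (uvec t) by apply: cvg_comp cl (cf _).
  have c0 : 0 < c - f (uvec t) by rewrite subr_gt0.
  move/cvgrPdist_lt : cv => /(_ _ c0); apply: filterS => x.
  by rewrite ltr_norml => /andP[]; lra.
have nearN : \forall x \near 0^'+, N (tline e t x) < c.
  case: hNt => [|/(descends_slope hN)[m [x [m0 x0 _ hm]]]].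
    by apply: lt_near; exact: gauge_continuous.
  near=> y; have y0 : 0 < y by near: y; exact: nbhs_right_gt.
  have yx : y < x by near: y; exact: nbhs_right_lt.
  apply: le_lt_trans (hm y _) _; first by rewrite !ltW.
  by apply: lt_le_trans (le_cuts N ws _); rewrite ltrBlDr ltrDl mulr_gt0.
have nearw : \forall x \near 0^'+, forall w, w \in ws -> dot (tline e t x) w < c.
  have sub ws' : {subset ws' <= ws} -> \forall x \near 0^'+, forall w, w \in ws' -> dot (tline e t x) w < c.
    elim: ws' => [|w ws' IH] hs; first by near=> x.
    have hw' : w \in ws by apply: hs; rewrite mem_head.
    have {}IH : \forall x \near 0^'+, forall w, w \in ws' -> dot (tline e t x) w < c.
      by apply: IH => w' h; apply: hs; rewrite inE h orbT.
    have near1 : \forall x \near 0^'+, dot (tline e t x) w < c.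
      case: (hw w hw') => h; first by apply: (@lt_near (fun z => dot z w)) => //; exact: continuous_dot.
      near=> x; have x0 : 0 < x by near: x; exact: nbhs_right_gt.
      have hc : dot (uvec t) w <= c by exact: dot_le_cuts.
      apply: lt_le_trans hc; rewrite /tline dotDl dotZl mulrAC.
      by rewrite gtrDl pmulr_llt0.
    near=> x; move=> w'; rewrite inE => /orP[/eqP ->|]; first by near: x.
    by move: w'; near: x.
  exact: sub.
have /filter_ex[x [x0 x1 x2]] : \forall x \near 0^'+, [/\ 0 < x, N (tline e t x) < c &
    forall w, w \in ws -> dot (tline e t x) w < c].
  near=> x; split; [by near: x; exact: nbhs_right_gt|by near: x|by near: x].
by exists x; split=> //; exact: cuts_lt.
Unshelve. all: by end_near. Qed.

Section OneFamily.
Variables (N : plane R -> R) (e T s : R) (n : nat) (ws : seq (plane R)).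
Hypotheses (hN : gauge N) (nd : all_nondegenerate (body N) 0).
Hypotheses (e1 : e ^+ 2 = 1) (s0 : 0 < s) (s1 : s <= 1 / 2) (n0 : (0 < n)%N).
Hypothesis (stT : stable_angle N T).
Hypothesis noT : forall x, - (n%:R * s) < x < 0 -> ~ stable_angle N (T + e * x).
Hypothesis desT : forall x, 0 < x < 2 * s -> descends e N (T + e * x).

Definition radius T := (N (uvec T))^-1.

Definition feet k := spiral_line s (radius T) T e k.

Hypothesis hws : forall k, (0 < k <= n)%N -> feet k \in ws.

Lemma radius_gt0 : 0 < radius T.
Proof. by rewrite invr_gt0 gauge_uvec_gt0. Qed.

Lemma height_gt0 k : 0 < (radius T * kappa s ^+ k)^-1.
Proof. by rewrite invr_gt0 mulr_gt0 ?radius_gt0 ?exprn_gt0 ?kappa_gt0. Qed.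

Lemma dot_feet k x : dot (uvec (T + e * x)) (feet k) =
  (radius T * kappa s ^+ k)^-1 * cos (x + k%:R * s).
Proof. exact: dot_spiral_line. Qed.

Lemma stable_gauge_ge x : (radius T)^-1 * cos x <= N (uvec (T + e * x)).
Proof.
have := stable_angle_critical hN stT (uvec (T + e * x)).
rewrite dot_uvec /radius invrK opprD addrA subrr add0r cosN.
by have [-> _] := sign_cos_sin x e1.
Qed.

(* The foot of a line is cut off by the next line. *)
Lemma active_lower k x : `|x + k%:R * s| < pi / 2 ->
  dot (uvec (T + e * x)) (feet k.+1) <= dot (uvec (T + e * x)) (feet k) ->
  0 < x + k%:R * s.
Proof.
rewrite ltr_norml => /andP[h1 h2]; rewrite !dot_feet ltNge => h; apply/negP => h0.
have := cos_step_inc s0 s1 h1 h0; rewrite ltNge => /negP; apply.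
have r0 := radius_gt0; have k0 := kappa_gt0 s0 s1.
have e2 : k.+1%:R * s = k%:R * s + s by rewrite -[k.+1%:R]natr1 mulrDl mul1r.
move: h; rewrite e2 addrA exprSr mulrA invfM -[leLHS]mulrA ler_pM2l ?height_gt0//.
by rewrite ler_pdivrMl.
Qed.

Lemma active_upper k x : (0 < k)%N -> `|x + k%:R * s| < pi / 2 ->
  N (uvec (T + e * x)) <= dot (uvec (T + e * x)) (feet k) -> x < 2 * s.
Proof.
case: k => // k _; rewrite ltr_norml => /andP[h1 h2] h; rewrite ltNge; apply/negP => hx.
have := cos_chain s0 s1 hx h2; rewrite ltNge => /negP; apply.
have := le_trans (stable_gauge_ge x) h; rewrite dot_feet invfM -mulrA.
have ri : 0 < (radius T)^-1 by rewrite invr_gt0 radius_gt0.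
by rewrite ler_pM2l// ler_pdivlMl ?exprn_gt0 ?kappa_gt0.
Qed.

(** Some foot lies within the angle [s] of the direction, and [cos s > kappa s] there compensates
    one factor of its height. So over the arc the cut body stays closer to the origin than the
    stable point [T], which is lost. *)
Lemma cuts_gt_radius x : - (n%:R * s) <= x <= 0 ->
  (radius T)^-1 < cuts N ws (uvec (T + e * x)).
Proof.
move=> /andP[x1 x2]; have r0 := radius_gt0; have k0 := kappa_gt0 s0 s1.
have pi2 := pi_ge2 R.
have [k [kn hk]] : exists k, (0 < k <= n)%N /\ `|x + k%:R * s| <= s.
  have y0 : 0 <= - x / s by rewrite divr_ge0 ?oppr_ge0// ltW.
  have /andP[t1 t2] := truncn_itv y0; move: (Num.truncn _) t1 t2 => j t1 t2.
  have t1' : j%:R * s <= - x by rewrite -ler_pdivlMr.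
  have t2' : - x < j.+1%:R * s by rewrite -ltr_pdivrMr.
  have ej : j.+1%:R * s = j%:R * s + s by rewrite -[j.+1%:R]natr1 mulrDl mul1r.
  have [j0|j0] := posnP j.
    exists 1%N; rewrite n0; split=> //; move: t2'; rewrite ej j0 mul0r mul1r add0r => t2'.
    by rewrite ler_norml; apply/andP; split; lra.
  exists j; rewrite j0; split.
    by rewrite -(ler_nat R) -(ler_pM2r s0); lra.
  by rewrite ler_norml; apply/andP; split; lra.
apply: lt_le_trans (dot_le_cuts N (uvec (T + e * x)) (hws kn)).
have ri : 0 < (radius T)^-1 by rewrite invr_gt0.
rewrite dot_feet invfM -mulrA ltr_pMr//.
have ck : kappa s < cos (x + k%:R * s).
  apply: lt_le_trans (_ : cos s <= _); first exact: cos_gt_kappa.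
  have key y : 0 <= y <= s -> cos s <= cos y.
    move=> /andP[y0 ys]; rewrite -subr_le0 leNgt; apply/negP => h.
    have := @ge0_derive_le R (fun x' => - cos x') (fun x' => sin x') y s ys.
    rewrite lerN2 => /(_ _ _ _) h'.
    suff : cos s <= cos y by rewrite -subr_le0 leNgt h.
    apply: h'.
    - by apply: continuous_subspaceT => x'; apply: cvgN; exact: continuous_cos.
    - by move=> x' _; apply: is_derive_eq; rewrite opprK.
    - by move=> x' /andP[u1 u2]; apply: sin_ge0_pi; rewrite (ltW (le_lt_trans y0 u1)) /= (le_trans (ltW u2))// (le_trans s1)// (le_trans _ pi2)//; lra.
  have [y0|y0] := leP 0 (x + k%:R * s); first by apply: key; rewrite y0; rewrite ger0_norm in hk.
  by rewrite -(cosN (x + _)); apply: key; rewrite ltr0_norm// in hk; rewrite hk andbT oppr_ge0 ltW.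
rewrite mulrC ltr_pdivlMr ?exprn_gt0// mul1r; apply: le_lt_trans ck.
case: k kn {hk} => // k _; rewrite exprS ger_pMr// exprn_ile1// ltW//; exact: kappa_lt1.
Qed.

(** The delicate case is a point where the line meets the old boundary. Past [T] the old gauge
    descends by [desT]. Over the arc it exceeds its value at [T] by [cuts_gt_radius], and with no
    stable angle in between [descends_between] applies. *)
Lemma active_body_descends k x : (0 < k <= n)%N -> 0 < x + k%:R * s < pi / 2 ->
  dot (uvec (T + e * x)) (feet k) = cuts N ws (uvec (T + e * x)) ->
  N (uvec (T + e * x)) < cuts N ws (uvec (T + e * x)) \/ descends e N (T + e * x).
Proof.
move=> /andP[k0 kn] /andP[x1 x2] hV.
have [h|h] := ltP (N (uvec (T + e * x))) (cuts N ws (uvec (T + e * x))); [by left|right].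
have NV : N (uvec (T + e * x)) = cuts N ws (uvec (T + e * x)).
  by apply/eqP; rewrite eq_le le_cuts.
have xs : x < 2 * s.
  by apply: (active_upper k0); rewrite ?gtr0_norm// hV NV.
have [xp|xn] := ltP 0 x; first by apply: desT; rewrite xp.
have kns : k%:R * s <= n%:R * s by rewrite ler_pM2r// ler_nat.
have Vr : (radius T)^-1 < N (uvec (T + e * x)).
  by rewrite NV; apply: cuts_gt_radius; apply/andP; split; lra.
have xneq : x < 0.
  rewrite lt_neqAle xn andbT; apply/eqP => x0; move: Vr.
  by rewrite x0 mulr0 addr0 /radius invrK ltxx.
apply: (@descends_between R N e (T + e * x) (- x)) => //.
- by rewrite oppr_gt0.
- by rewrite mulrN addrK -[N (uvec T)]invrK.
move=> y /andP[y0 y1]; rewrite -addrA -mulrDr; apply: noT.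
by apply/andP; split; lra.
Qed.

Lemma active_feet_descends k x : 0 < x + k%:R * s < pi / 2 ->
  e * dot (uperp (T + e * x)) (feet k) < 0.
Proof.
move=> /andP[h1 h2]; rewrite uperp_spiral_line// oppr_lt0 mulr_gt0 ?height_gt0//.
by rewrite sin_gt0_pihalf// h1.
Qed.

Lemma active_mod k t : 0 < dot (uvec t) (feet k) ->
  exists x, uvec (T + e * x) = uvec t /\ `|x + k%:R * s| < pi / 2.
Proof.
have ee : e * e = 1 by rewrite -expr2.
have tE : t = T + e * (e * (t - T)) by rewrite mulrA ee mul1r addrC subrK.
rewrite {1}tE dot_feet pmulr_rgt0 ?height_gt0// => /cos_gt0_mod[l hl].
exists (e * (t - T) + 2 * pi * l%:~R); split; last first.
  by rewrite addrAC.
rewrite mulrDr addrA -tE; move/eqP: e1; rewrite sqrf_eq1 => /orP[] /eqP ->.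
  by rewrite mul1r uvec_period.
by rewrite mulN1r -mulrN -mulrNz uvec_period.
Qed.

End OneFamily.

End SpiralCut.

(** * Counting stable points after the cuts *)

Section FewerStable.
Variable R : realType.
Implicit Types (a b d l p r s t x y e T : R) (z u w q v : plane R) (ws : seq (plane R)).
Implicit Types (N V : plane R -> R) (i j k n : nat).

Lemma card_remove_lt (A : set (plane R)) (B : set (plane R)) q n : (A #= `I_n)%card -> A q ->
  (B #<= A `\ q)%card -> (B #<= A)%card /\ ~ (A #<= B)%card.
Proof.
move=> An Aq BA; split; first exact: card_le_trans BA (card_le_setD _ _).
move=> AB; have fA : finite_set A by exists n.
have nA : (`I_n #<= A `\ q)%card.
  by apply: card_le_trans (card_le_trans AB BA); rewrite (card_le_eqr An).
have fD : finite_set (A `\ q) by exact: card_le_finite (card_le_setD A [set q]) fA.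
have h1 : (size (finmap.enum_fset (fset_set A)) <= n)%N.
  by apply: geq_card_fset_set; rewrite (card_le_eql An).
have := leq_card_fset_set fD nA.
have -> : fset_set (A `\ q) = finmap.fsetD (fset_set A) (finmap.fset1 q).
  by rewrite fset_setD// fset_set1.
have := finmap.cardfsD1 q (fset_set A); rewrite in_fset_set// (mem_set Aq) => e2 h2.
by move: h1; rewrite leqNgt => /negP; apply; rewrite e2 add1n ltnS.
Qed.

Lemma cuts_attained N ws z : cuts N ws z = N z \/ exists2 w, w \in ws & dot z w = cuts N ws z.
Proof.
elim: ws => [|w ws IH] /=; first by left.
rewrite /cut_gauge; case: (leP (cuts N ws z) (dot z w)) => h.
  by right; exists w => //; rewrite mem_head.
by case: IH => [->|[w' hw' e']]; [left|right; exists w' => //; rewrite inE hw' orbT].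
Qed.

(** If some line were active, all functions attaining the maximum would descend in the common
    direction [e], and [t] would not be critical. *)
Lemma critical_inactive N ws t e : gauge N -> critical (cuts N ws) t ->
  (forall w, w \in ws -> dot (uvec t) w = cuts N ws (uvec t) ->
    (N (uvec t) < cuts N ws (uvec t) \/ descends e N t) /\ e * dot (uperp t) w < 0) ->
  forall w, w \in ws -> dot (uvec t) w < N (uvec t).
Proof.
move=> hN ct h.
have no w : w \in ws -> dot (uvec t) w <> cuts N ws (uvec t).
  move=> hw eq; have [h1 _] := h w hw eq.
  apply: (critical_not_descends ct (e := e)); apply: descends_cuts => // w' hw'.
  have [eq'|neq] := eqVneq (dot (uvec t) w') (cuts N ws (uvec t)).
    by right; have [] := h w' hw' eq'.
  by left; rewrite lt_neqAle neq dot_le_cuts.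
move=> w hw; case: (cuts_attained N ws (uvec t)) => [<-|[w' hw' /(no _ hw')//]].
by rewrite lt_neqAle dot_le_cuts// andbT; apply/eqP; exact: no.
Qed.

Lemma equilibrium_angle V q : gauge V -> equilibrium (body V) 0 q ->
  exists t, q = bdpt V t /\ critical V t.
Proof.
move=> hV eq; have [t [_ qE]] := bd_polar 0 hV eq.1; exists t; split=> //.
by apply/equilibrium_critical => //; rewrite -qE.
Qed.

(** All stable points of the cut body are old ones, and the one at [T] is gone. *)
Lemma fewer_stable_cuts N ws T n : gauge N -> K2 (body N) -> all_nondegenerate (body N) 0 ->
  (stable_points (body N) 0 #= `I_n)%card -> stable_angle N T ->
  N (uvec T) < cuts N ws (uvec T) ->
  (forall t, critical (cuts N ws) t -> forall w, w \in ws -> dot (uvec t) w < N (uvec t)) ->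
  fewer_stable (body N) 0 (body (cuts N ws)).
Proof.
move=> hN kN nd fin stT cutT h; have hV := gauge_cuts ws hN.
split; [exact: K2_cuts|by move=> z; apply: le_trans; exact: le_cuts|exact: body0| |].
  by move=> q /(equilibrium_angle hV)[t [-> ct]]; apply: inactive_nondegenerate => //; exact: h.
apply: (card_remove_lt fin stT); apply: subset_card_le => q st.
have [t [qE ct]] := equilibrium_angle hV st.1; rewrite qE in st *.
split; first by rewrite inactive_bdpt; [apply: inactive_stable => //|]; exact: h.
move=> /= eq; have := gauge_bdpt t hV; rewrite eq /bdpt gaugeZ// ?invr_ge0 ?gauge_ge0// => e1.
by move: cutT; rewrite -(mulr1 (N _)) -e1 mulVKf ?ltxx// gt_eqF// gauge_uvec_gt0.
Qed.

(** Near its foot the boundary is the line itself, along which the distance has positive second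
    derivative: a nondegenerate stable point. *)
Lemma foot_local_param V m w r : gauge V -> 0 < r -> w = r^-1 *: uvec m ->
  (\forall z \near r *: uvec m, V z = dot z w) ->
  exists g, local_param (body V) (r *: uvec m) g /\ 0 < dist_deriv2 0 g.
Proof.
move=> hV r0 wE nV.
pose g t := r *: uvec m + (t - 0) *: uperp m : plane R; exists g.
have [sg dg] := smooth_segment (r *: uvec m) (uperp m) 0.
have g0 : g 0 = r *: uvec m by rewrite /g subr0 scale0r addr0.
have upn : uperp m != 0.
  apply/eqP => u0; have := uvec_neq0 m; rewrite /uvec; case: u0 => /eqP; rewrite oppr_eq0 => /eqP -> ->.
  by rewrite eqxx.
have uu : dot (uperp m) (uvec m) = 0 by rewrite dot_uperp subrr sin0.
have pp : dot (uperp m) (uperp m) = 1.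
  by rewrite /dot /= mulrNN -!expr2 addrC cos2Dsin2.
have vv : dot (uvec m) (uvec m) = 1 by rewrite dot_uvec subrr cos0.
have dgw t : dot (g t) w = 1.
  by rewrite /g wE dotDl !dotZl !dotZr uu vv mulr0 mulr0 addr0 mulr1 divff// gt_eqF.
split; last first.
  have sq0 : sq_deriv g 0 = 0.
    by rewrite /sq_deriv g0 /g dg dotZl dotC uu mulr0.
  rewrite dist_deriv2E//; last by rewrite g0 scaler_eq0 negb_or gt_eqF// uvec_neq0.
  rewrite g0 enorm_polar ?(ltW r0)// divr_gt0// /sq_deriv2.
  have -> : derive1n 2 g 0 = 0.
    rewrite /derive1n /= -/(derive1 _ _) (_ : derive1 g = fun=> uperp m) ?derive1_cst//.
    by apply/funext => t; exact: dg.
  by rewrite dg pp (dotC _ 0) -{1}(scale0r (0 : plane R)) dotZl mul0r addr0.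
split=> //; first by rewrite dg.
have cg : continuous g by exact: continuous_smooth.
have /nbhs_ballP[d /= d0 hd] : \forall t \near (0 : R), V (g t) = dot (g t) w.
  have := cg 0; rewrite /continuous_at g0 => h; exact: (h _ nV).
exists d; split=> //.
  move=> _ [t /= ht <-]; rewrite body_bd//= hd ?dgw//.
  by rewrite /ball /= sub0r normrN; move: ht; rewrite in_itv /= ltr_norml.
have near2 : \forall z \near r *: uvec m, `|dot z (uperp m)| < d.
  have cd := @continuous_dot R (uperp m) (r *: uvec m).
  have z0 : dot (r *: uvec m) (uperp m) = 0 by rewrite dotZl dotC uu mulr0.
  move/cvgrPdist_lt : cd => /(_ d d0); apply: filterS => z; rewrite z0 sub0r normrN//.
near=> z; rewrite body_bd//= => Vz.
have nVz : V z = dot z w by near: z.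
have zd : `|dot z (uperp m)| < d by near: z.
exists (dot z (uperp m)); first by rewrite /= in_itv /= -ltr_norml.
have zr : dot z (uvec m) = r.
  have h : dot z w = 1 by rewrite -nVz.
  by rewrite wE dotZr in h; rewrite -[RHS]mulr1 -h mulrA divff ?mul1r// gt_eqF.
by rewrite /g subr0 {2}(plane_decomp m z) zr.
Unshelve. all: by end_near. Qed.

(** The foot of the common last line is a new stable point, but both [T] and [T'] are lost. Sending
    the foot to the point at [T'] and fixing the rest is an injection that misses the point at
    [T]. *)
Lemma fewer_stable_cuts_foot N ws T T' m r n : gauge N -> K2 (body N) -> all_nondegenerate (body N) 0 ->
  (stable_points (body N) 0 #= `I_n)%card -> stable_angle N T -> stable_angle N T' ->
  uvec T != uvec T' ->
  N (uvec T) < cuts N ws (uvec T) -> N (uvec T') < cuts N ws (uvec T') -> 0 < r ->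
  (\forall z \near r *: uvec m, cuts N ws z = dot z (r^-1 *: uvec m)) ->
  (forall t, critical (cuts N ws) t -> uvec t = uvec m \/
    forall w, w \in ws -> dot (uvec t) w < N (uvec t)) ->
  fewer_stable (body N) 0 (body (cuts N ws)).
Proof.
move=> hN kN nd fin stT stT' TT' cutT cutT' r0 nV h; have hV := gauge_cuts ws hN.
have [g [lp dd]] := foot_local_param hV r0 erefl nV.
have foot t : uvec t = uvec m -> bdpt (cuts N ws) t = r *: uvec m.
  move=> tm; rewrite /bdpt tm.
  have Vr : cuts N ws (r *: uvec m) = 1.
    by rewrite (nbhs_singleton nV) dotZl dotZr dot_uvec subrr cos0 mulr1 divff// gt_eqF.
  by rewrite gaugeZ ?ltW// in Vr; rewrite -[(_)^-1]mulr1 -Vr mulrCA mulVf ?mulr1// gt_eqF// gauge_uvec_gt0.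
have out T0 t : N (uvec T0) < cuts N ws (uvec T0) -> bdpt (cuts N ws) t <> bdpt N T0.
  move=> cut0 eq; have := gauge_bdpt t hV; rewrite eq /bdpt gaugeZ// ?invr_ge0 ?gauge_ge0// => e1.
  by move: cut0; rewrite -(mulr1 (N _)) -e1 mulVKf ?ltxx// gt_eqF// gauge_uvec_gt0.
split; [exact: K2_cuts|by move=> z; apply: le_trans; exact: le_cuts|exact: body0| |].
  move=> q /(equilibrium_angle hV)[t [-> ct]].
  case: (h t ct) => [tm|hin]; last exact: inactive_nondegenerate.
  rewrite foot//; split=> [_|ns]; first by exists g => //; rewrite gt_eqF.
  by case: ns; exists g.
apply: (card_remove_lt fin stT).
pose f q := if q == r *: uvec m then bdpt N T' else q.
have fS : set_fun (stable_points (body (cuts N ws)) 0) (stable_points (body N) 0 `\ bdpt N T) f.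
  move=> q st; have [t [qE ct]] := equilibrium_angle hV st.1; rewrite qE in st *.
  rewrite /f; case: eqP => [_|nf].
    split=> //= /bdpt_eq /(_ hN) e; by move: TT'; rewrite e eqxx.
  case: (h t ct) => [/foot//|hin]; split; last exact: out.
  by rewrite inactive_bdpt//; apply: (inactive_stable hN hin ct).
have fI : {in stable_points (body (cuts N ws)) 0 &, injective f}.
  move=> q q' /set_mem st /set_mem st'.
  have [t [qE ct]] := equilibrium_angle hV st.1.
  have [t' [qE' ct']] := equilibrium_angle hV st'.1.
  rewrite /f; case: eqP => [->|_]; case: eqP => [->|_]//.
    by move=> e; have := out T' t' cutT'; rewrite -qE' -e.
  by move=> e; have := out T' t cutT'; rewrite -qE -e.
rewrite -(card_le_eql (inj_card_eq fI)); apply: subset_card_le => _ [q st <-]; exact: fS.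
Qed.

End FewerStable.

(** * Families of spiral lines *)

Section Families.
Variable R : realType.
Implicit Types (a b d l p r s t x y e T : R) (z u w q v : plane R) (ws : seq (plane R)).
Implicit Types (N V : plane R -> R) (i j k n : nat).

Definition family N e T s n := [seq feet N e T s k | k <- iota 1 n].

Lemma feet_family N e T s n k : (0 < k <= n)%N -> feet N e T s k \in family N e T s n.
Proof. by move=> /andP[k0 kn]; apply/mapP; exists k => //; rewrite mem_iota k0 add1n ltnS. Qed.

Lemma family_feet N e T s n w : w \in family N e T s n ->
  exists k, (0 < k <= n)%N /\ w = feet N e T s k.
Proof.
by move=> /mapP[k]; rewrite mem_iota add1n ltnS => kn ->; exists k.
Qed.

(** Otherwise the maximum over the closed arc is attained in its interior, which gives a stable
    angle. *)
Lemma between_lt_max N a b t : gauge N -> all_nondegenerate (body N) 0 ->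
  (forall x, a < x < b -> ~ stable_angle N x) -> a < t < b ->
  N (uvec t) < Num.max (N (uvec a)) (N (uvec b)).
Proof.
move=> hN nd ns /andP[ta tb]; have ab : a <= b by rewrite ltW// (lt_trans ta).
rewrite ltNge; apply/negP; rewrite ge_max => /andP[h1 h2].
have [c' c'ab hc'] := EVT_max ab (continuous_subspaceT (gauge_uvec_continuous hN)).
have [c [ca cb hc]] : exists c, [/\ a < c, c < b &
    forall x, a <= x <= b -> N (uvec x) <= N (uvec c)].
  move: c'ab; rewrite in_itv /= => /andP[].
  rewrite !le_eqVlt => /orP[/eqP e1|c1]; last move=> /orP[/eqP e2|c2].
  - move=> _; exists t; split=> // x xab; apply: le_trans h1; rewrite e1; apply: hc'.
    by rewrite in_itv.
  - exists t; split=> // x xab; apply: le_trans h2; rewrite -e2; apply: hc'.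
    by rewrite in_itv.
  - by exists c'; split=> // x xab; apply: hc'; rewrite in_itv.
have ca0 : 0 < c - a by rewrite subr_gt0.
have cb0 : 0 < b - c by rewrite subr_gt0.
have [d [d0 da db]] := exists_lt_both ca0 cb0.
apply: (ns c); first by rewrite ca.
apply: (local_max_stable (d := d)) => // x; rewrite ltr_norml => /andP[x1 x2].
by apply: hc; apply/andP; split; lra.
Qed.

(** This supplies the hypothesis [desT]. The gauge is smaller at some [x'] past the strict maximum
    [T]; by continuity it is larger than that at all small [x], and [descends_between] applies from
    [x] to [x']. *)
Lemma descends_beyond N e T l : gauge N -> all_nondegenerate (body N) 0 -> e ^+ 2 = 1 -> 0 < l ->
  stable_angle N T -> (forall x, 0 < x < l -> ~ stable_angle N (T + e * x)) ->
  exists d, 0 < d /\ forall x, 0 < x < d -> descends e N (T + e * x).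
Proof.
move=> hN nd e1 l0 st ns.
have ne : `|e| = 1 by move/eqP: e1; rewrite sqrf_eq1 => /orP[] /eqP ->; rewrite ?normrN normr1.
have [d [d0 hd]] := stable_angle_max hN nd st.
have [x' [x'0 x'd x'l]] := exists_lt_both d0 l0.
have h1 : N (uvec (T + e * x')) < N (uvec T).
  by apply: hd; rewrite normrM ne mul1r gtr0_norm// x'0.
have cf : N (uvec (T + e * x)) @[x --> (0 : R)] --> N (uvec T).
  have h0 : T + e * 0 = T by rewrite mulr0 addr0.
  have c1 : continuous (fun x => T + e * x).
    by move=> y; apply: cvgD; [exact: cvg_cst|apply: cvgM; [exact: cvg_cst|exact: cvg_id]].
  rewrite -{2}h0; exact: (cvg_comp _ _ (c1 0) (gauge_uvec_continuous hN (x := _))).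
have h0 : 0 < N (uvec T) - N (uvec (T + e * x')) by rewrite subr_gt0.
move/cvgrPdist_lt : cf => /(_ _ h0) /nbhs_ballP[d' /= d'0 hd'].
have [d2 [d20 d2d d2x]] := exists_lt_both d'0 x'0.
exists d2; split=> // x /andP[x0 xd]; have xx' : x < x' by exact: lt_trans xd d2x.
apply: (@descends_between _ _ _ _ (x' - x)) => //.
- by rewrite subr_gt0.
- rewrite -addrA -mulrDr [x + _]addrC subrK.
  have : ball (0 : R) d' x by rewrite /ball /= sub0r normrN gtr0_norm// (lt_trans xd).
  move=> /hd' /ltr_normlW; move: (N _) (N _) (N _) => A B C.
  by rewrite ltrD2l ltrN2.
- move=> y /andP[y0 y1]; rewrite -addrA -mulrDr; apply: ns.
  by rewrite ltr_wpDr//= (lt_trans _ x'l)// -ltrBrDl.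
Qed.

Definition descending_cut N ws e t w :=
  (N (uvec t) < cuts N ws (uvec t) \/ descends e N t) /\ e * dot (uperp t) w < 0.

Section Active.
Variables (N : plane R -> R) (e T s : R) (n : nat) (ws : seq (plane R)).
Hypotheses (hN : gauge N) (nd : all_nondegenerate (body N) 0).
Hypotheses (e1 : e ^+ 2 = 1) (s0 : 0 < s) (s1 : s <= 1 / 2) (n0 : (0 < n)%N).
Hypothesis stT : stable_angle N T.
Hypothesis noT : forall x, - (n%:R * s) < x < 0 -> ~ stable_angle N (T + e * x).
Hypothesis desT : forall x, 0 < x < 2 * s -> descends e N (T + e * x).
Hypothesis hws : forall k, (0 < k <= n)%N -> feet N e T s k \in ws.

Definition end_angle := T - e * (n%:R * s).

Lemma end_angleD x : end_angle + e * (x + n%:R * s) = T + e * x.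
Proof. by rewrite /end_angle; ring. Qed.

(** Here [y] is the angle from the foot of the last line. Every other line is cut off at its own
    foot by its successor; only for [k = n] can [y <= 0] occur, and that case is settled separately
    in the one-sided and the two-sided cut. *)
Lemma family_active k t : (0 < k <= n)%N ->
  dot (uvec t) (feet N e T s k) = cuts N ws (uvec t) ->
  exists y, [/\ uvec t = uvec (end_angle + e * y), y < n%:R * s + 2 * s,
    (k < n)%N -> 0 < y,
    k = n -> `|y| < pi / 2 &
    0 < y -> descending_cut N ws e t (feet N e T s k)].
Proof.
move=> kn hV; have V0 := gauge_uvec_gt0 t (gauge_cuts ws hN).
have d0 : 0 < dot (uvec t) (feet N e T s k) by rewrite hV.
have [x [xt hx]] := active_mod hN e1 s0 s1 d0.
have kns : k%:R * s <= n%:R * s by case/andP: kn => _ kn; rewrite ler_pM2r// ler_nat.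
have xs : x < 2 * s.
  apply: (active_upper hN e1 s0 s1 stT _ hx); first by case/andP: kn.
  by rewrite xt hV le_cuts.
have lower : (k < n)%N -> 0 < x + k%:R * s.
  move=> kn'; apply: (@active_lower _ N e T s hN e1 s0 s1 k x hx); rewrite xt hV dot_le_cuts//.
  by apply: hws; rewrite kn'.
exists (x + n%:R * s); rewrite end_angleD; split=> //.
- by rewrite addrC ltrD2l.
- by move=> /lower; lra.
- by move=> <-.
move=> y0; have k0 : 0 < x + k%:R * s < pi / 2.
  rewrite (le_lt_trans (ler_norm _) hx) andbT; case/andP: kn => _.
  by rewrite leq_eqVlt => /orP[/eqP ->//|/lower].
have := active_feet_descends T hN e1 s0 s1 k0.
have := active_body_descends hN nd e1 s0 s1 n0 stT noT desT hws kn k0.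
rewrite (uvec_uperp xt) xt => h1 h2; split=> //.
case: (h1 hV) => [|h]; [by left|right]; exact: descends_eq xt h.
Qed.

(** Cauchy-Schwarz: a point beyond a line is farther away than its foot, and the last foot is the
    lowest. *)
Lemma feet_height k z : (k <= n)%N -> 1 < dot z (feet N e T s k) ->
  radius N T * kappa s ^+ n < enorm z.
Proof.
move=> kn; have h0 k' := height_gt0 T hN s0 s1 k'; have k0 := kappa_gt0 s0 s1.
have r0 := radius_gt0 T hN => h.
have h1 : 1 < enorm z * (radius N T * kappa s ^+ k)^-1.
  apply: lt_le_trans h _; apply: le_trans (dot_le_enorm _ _) _.
  by rewrite /feet /spiral_line enormZ ?enorm_uvec ?mulr1// ltW.
have h2 : 0 < radius N T * kappa s ^+ k by rewrite mulr_gt0// exprn_gt0.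
move: h1; rewrite ltr_pdivlMr// mul1r; apply: le_lt_trans.
rewrite ler_pM2l// -(subnK kn) exprD ger_pMl ?exprn_gt0// exprn_ile1 ?ltW//.
exact: kappa_lt1.
Qed.

End Active.

Lemma cuts_polar N ws z : gauge N -> N z <= 1 -> 1 < cuts N ws z ->
  exists t w, [/\ z = enorm z *: uvec t, 0 < enorm z, w \in ws, 1 < dot z w &
    dot (uvec t) w = cuts N ws (uvec t)].
Proof.
move=> hN z1 z2; have hV := gauge_cuts ws hN.
have zn0 : z != 0 by apply: contraTneq z2 => ->; rewrite gauge0// ltr10.
have [t [_ zE]] := polar_decomp 0 zn0; have r0 := enorm_gt0 zn0.
exists t; case: (cuts_attained N ws (uvec t)) => [e|[w hw e]].
  by move: z2; rewrite zE gaugeZ ?ltW// e -gaugeZ ?ltW// -zE ltNge z1.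
by exists w; split=> //; rewrite zE dotZl e -gaugeZ ?ltW// -zE.
Qed.

Lemma cuts_near_line N ws w q : gauge N -> w \in ws -> N q < dot q w ->
  (forall w', w' \in ws -> w' != w -> dot q w' < dot q w) ->
  \forall z \near q, cuts N ws z = dot z w.
Proof.
move=> hN hw h1 h2.
have lt_near (f : plane R -> R) : continuous f -> f q < dot q w ->
    \forall z \near q, f z < dot z w.
  move=> cf fq; have c : (fun z => dot z w - f z) @ q --> dot q w - f q.
    by apply: cvgB; [exact: continuous_dot|exact: cf].
  move/cvgrPdist_lt : c => /(_ _ (_ : 0 < dot q w - f q)); rewrite subr_gt0 => /(_ fq).
  by apply: filterS => z; rewrite ltr_norml => /andP[_]; rewrite ltrBlDl ltrDr subr_gt0.
have nN := lt_near _ (gauge_continuous hN) h1.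
have nw : \forall z \near q, forall w', w' \in ws -> dot z w' <= dot z w.
  have sub ws' : {subset ws' <= ws} -> \forall z \near q, forall w', w' \in ws' -> dot z w' <= dot z w.
    elim: ws' => [|w1 ws' IH] hs; first by near=> z.
    have {}IH : \forall z \near q, forall w', w' \in ws' -> dot z w' <= dot z w.
      by apply: IH => w' h; apply: hs; rewrite inE h orbT.
    have near1 : \forall z \near q, dot z w1 <= dot z w.
      have [->|ne] := eqVneq w1 w; first by near=> z.
      have := lt_near _ (@continuous_dot R w1) (h2 w1 (hs w1 (mem_head _ _)) ne).
      by apply: filterS => z /ltW.
    near=> z; move=> w'; rewrite inE => /orP[/eqP ->|]; first by near: z.
    by move: w'; near: z.
  exact: sub.
near=> z; apply/eqP; rewrite eq_le dot_le_cuts// andbT; apply: cuts_le.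
  by apply/ltW; near: z.
by near: z.
Unshelve. all: by end_near. Qed.

End Families.

(** * One-sided and two-sided spiral cuts *)

Section SidedCuts.
Variable R : realType.
Implicit Types (a b d l p r s t x y e T : R) (z u w q v : plane R) (ws : seq (plane R)).
Implicit Types (N V : plane R -> R) (i j k n : nat).

(** The margin [2 * s] is the reach of the cuts beyond the ends of the arc. *)
Definition removed_in N V a b r s := forall z, N z <= 1 -> 1 < V z ->
  r < enorm z /\ exists t, a - 2 * s <= t < b + 2 * s /\ z = enorm z *: uvec t.

Lemma sign_cases e : e ^+ 2 = 1 -> e = 1 \/ e = -1.
Proof. by move/eqP; rewrite sqrf_eq1 => /orP[] /eqP ->; [left|right]. Qed.

(** Here [n%:R * s] is the whole arc. The last foot is in the direction of the nearer stable point
    but farther out, so the last line is never active, and every active line descends in direction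
    [e]. *)
Lemma one_sided_cut N e T s n c : gauge N -> K2 (body N) -> all_nondegenerate (body N) 0 ->
  (stable_points (body N) 0 #= `I_c)%card ->
  e ^+ 2 = 1 -> 0 < s -> s <= 1 / 2 -> (0 < n)%N -> stable_angle N T ->
  stable_angle N (T - e * (n%:R * s)) ->
  (forall x, - (n%:R * s) < x < 0 -> ~ stable_angle N (T + e * x)) ->
  (forall x, 0 < x < 2 * s -> descends e N (T + e * x)) ->
  (radius N T * kappa s ^+ n)^-1 < N (uvec (T - e * (n%:R * s))) ->
  exists V, [/\ gauge V, fewer_stable (body N) 0 (body V) &
    removed_in N V (Num.min T (T - e * (n%:R * s))) (Num.max T (T - e * (n%:R * s)))
      (radius N T * kappa s ^+ n) s].
Proof.
move=> hN kN nd fin e1 s0 s1 n0 stT stm noT desT hm.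
pose ws := family N e T s n; exists (cuts N ws); have hV := gauge_cuts ws hN.
have ns0 : 0 < n%:R * s by rewrite mulr_gt0// ltr0n.
have hws k : (0 < k <= n)%N -> feet N e T s k \in ws by exact: feet_family.
have last_inactive t : dot (uvec t) (feet N e T s n) < cuts N ws (uvec t).
  have V0 := gauge_uvec_gt0 t hV.
  rewrite /feet /spiral_line dotZr dot_uvec.
  set c' := cos _; have [c0|c0] := leP c' 0.
    apply: le_lt_trans V0; rewrite mulr_ge0_le0// ltW//; exact: height_gt0.
  apply: lt_le_trans (le_cuts N ws _); apply: lt_le_trans (_ : N (uvec (T - e * (n%:R * s))) * c' <= _).
    by rewrite ltr_pM2r.
  by have := stable_angle_critical hN stm (uvec t); rewrite dot_uvec.
have active w t : w \in ws -> dot (uvec t) w = cuts N ws (uvec t) ->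
    descending_cut N ws e t w /\ exists y, [/\ uvec t = uvec (T - e * (n%:R * s) + e * y),
      0 < y & y < n%:R * s + 2 * s].
  move=> /family_feet[k [kn ->]] hw.
  have [y [ty yb y0 _ dc]] := family_active hN nd e1 s0 s1 n0 stT noT desT hws kn hw.
  have kn' : (k < n)%N.
    case/andP: kn => _; rewrite leq_eqVlt => /orP[/eqP ke|//].
    by move: hw (last_inactive t); rewrite ke => ->; rewrite ltxx.
  by split; [exact: dc (y0 kn')|exists y; split=> //; exact: y0].
split=> //.
  apply: (fewer_stable_cuts (T := T) hN kN nd fin stT).
    have := @cuts_gt_radius R N e T s n ws hN e1 s0 s1 n0 hws 0.
    by rewrite mulr0 addr0 /radius invrK lexx oppr_le0 ltW// => /(_ isT).
  move=> t ct; apply: (critical_inactive (e := e)) => // w hw hw'.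
  by have [] := active w t hw hw'.
move=> z z1 z2; have [t [w [zE r0 hw zw tw]]] := cuts_polar hN z1 z2.
have [k [kn wE]] := family_feet hw; split.
  by apply: (feet_height (T := T) (e := e) hN s0 s1 (k := k)); [case/andP: kn|rewrite -wE].
have [_ [y [ty y0 yb]]] := active w t hw tw.
exists (T - e * (n%:R * s) + e * y); split; last by rewrite -ty.
by case: (sign_cases e1) => ->; apply/andP; split;
  rewrite ?mul1r ?mulN1r ?opprK;
  rewrite ?(min_r (_ : T - _ <= T)) ?(max_l (_ : T - _ <= T)) ?(min_l (_ : T <= T + _))
    ?(max_r (_ : T <= T + _)) ?lerDl ?gerBl ?(ltW ns0)//; lra.
Qed.

Lemma end_angle_eq N T T' s n : T' = T - 2 * (n%:R * s) -> N (uvec T) = N (uvec T') ->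
  feet N 1 T s n = feet N (-1) T' s n.
Proof.
by move=> e1 e2; rewrite /feet /spiral_line /radius e2 e1; congr (_ *: uvec _); ring.
Qed.

(** Here [n%:R * s] is half the arc, and equal distances make the two last lines coincide, with foot
    in the middle direction [m]. The bound by [pi] makes the signed angle from [m] unique on the
    range of the cuts. *)
Lemma two_sided_cut N T T' s n c : gauge N -> K2 (body N) -> all_nondegenerate (body N) 0 ->
  (stable_points (body N) 0 #= `I_c)%card ->
  0 < s -> s <= 1 / 2 -> (0 < n)%N -> n%:R * s + 2 * s < pi -> stable_angle N T -> stable_angle N T' ->
  T' = T - 2 * (n%:R * s) -> N (uvec T) = N (uvec T') ->
  (forall x, T' < x < T -> ~ stable_angle N x) ->
  (forall x, 0 < x < 2 * s -> descends 1 N (T + 1 * x)) ->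
  (forall x, 0 < x < 2 * s -> descends (-1) N (T' + (-1) * x)) ->
  exists V, [/\ gauge V, fewer_stable (body N) 0 (body V) &
    removed_in N V T' T (radius N T * kappa s ^+ n) s].
Proof.
move=> hN kN nd fin s0 s1 n0 nsp stT stT' TT' NT noT desT desT'.
have pi0 := pi_gt0 R; have ns0 : 0 < n%:R * s by rewrite mulr_gt0// ltr0n.
have o1 : (1 : R) ^+ 2 = 1 by rewrite expr1n.
have o2 : (-1 : R) ^+ 2 = 1 by rewrite sqrrN expr1n.
pose ws := family N 1 T s n ++ family N (-1) T' s n; exists (cuts N ws).
have hV := gauge_cuts ws hN.
have hws k : (0 < k <= n)%N -> feet N 1 T s k \in ws.
  by move=> kn; rewrite mem_cat feet_family.
have hws' k : (0 < k <= n)%N -> feet N (-1) T' s k \in ws.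
  by move=> kn; rewrite mem_cat orbC feet_family.
have no1 x : - (n%:R * s) < x < 0 -> ~ stable_angle N (T + 1 * x).
  by move=> /andP[x1 x2]; apply: noT; apply/andP; split; lra.
have no2 x : - (n%:R * s) < x < 0 -> ~ stable_angle N (T' + (-1) * x).
  by move=> /andP[x1 x2]; apply: noT; apply/andP; split; lra.
pose m := T - n%:R * s; pose wn := feet N 1 T s n.
have eqn : wn = feet N (-1) T' s n by exact: end_angle_eq.
have end1 : end_angle 1 T s n = m by rewrite /end_angle mul1r.
have end2 : end_angle (-1) T' s n = m by rewrite /end_angle TT' /m; ring.
have small e x : e ^+ 2 = 1 -> 0 <= x -> x < pi -> - pi < e * x < pi.
  by move=> /sign_cases[] ->; rewrite ?mul1r ?mulN1r ?ltrN2 => x0 xp; apply/andP; split; lra.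
have inj x y : - pi < x < pi -> - pi < y < pi -> uvec (m + x) = uvec (m + y) -> x = y.
  move=> /andP[x1 x2] /andP[y1 y2] h.
  suff : m + x = m + y by lra.
  by apply: (@uvec_inj R (m - pi)) => //; apply/andP; split; lra.
have active w t : w \in ws -> dot (uvec t) w = cuts N ws (uvec t) ->
    exists e y, [/\ e ^+ 2 = 1, uvec t = uvec (m + e * y), 0 <= y < n%:R * s + 2 * s,
      0 < y -> descending_cut N ws e t w & 0 < y \/ w = wn].
  (* The common line belongs to both families, so the side can be chosen with [y >= 0]. *)
  have last_active t0 : dot (uvec t0) wn = cuts N ws (uvec t0) ->
      exists e y, [/\ e ^+ 2 = 1, uvec t0 = uvec (m + e * y), 0 <= y < n%:R * s + 2 * s,
        0 < y -> descending_cut N ws e t0 wn & 0 < y \/ wn = wn].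
    move=> hw; have nn : (0 < n <= n)%N by rewrite n0 leqnn.
    have [y [ty yb _ yp dc]] := family_active hN nd o1 s0 s1 n0 stT no1 desT hws nn hw.
    have hw2 := hw; rewrite eqn in hw2.
    have [y' [ty' yb' _ yp' dc']] := family_active hN nd o2 s0 s1 n0 stT' no2 desT' hws' nn hw2.
    rewrite end1 in ty; rewrite end2 in ty'.
    have [y0|y0] := leP 0 y; first by exists 1, y; rewrite y0; split=> //; right.
    have yy : - y = y'.
      have /ltr_normlP[h1 h2] := yp erefl; have /ltr_normlP[h3 h4] := yp' erefl.
      have : 1 * y = (-1) * y'.
        by apply: inj; rewrite -?ty -?ty' ?mul1r ?mulN1r//; apply/andP; split; lra.
      by lra.
    have y'0 : 0 < y' by rewrite -yy oppr_gt0.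
    by exists (-1), y'; rewrite (ltW y'0) eqn; split=> //; right.
  rewrite mem_cat => /orP[] /family_feet[k [kn ->]] hw.
    move: (kn) => /andP[k0]; rewrite leq_eqVlt => /orP[/eqP ke|kn'].
      by rewrite ke in hw *; exact: last_active.
    have [y [ty yb y0 yp dc]] := family_active hN nd o1 s0 s1 n0 stT no1 desT hws kn hw.
    rewrite end1 in ty; exists 1, y; rewrite (ltW (y0 kn')); split=> //; left; exact: y0.
  move: (kn) => /andP[k0]; rewrite leq_eqVlt => /orP[/eqP ke|kn'].
    by rewrite ke -eqn in hw *; exact: last_active.
  have [y [ty yb y0 yp dc]] := family_active hN nd o2 s0 s1 n0 stT' no2 desT' hws' kn hw.
  rewrite end2 in ty; exists (-1), y; rewrite (ltW (y0 kn')); split=> //; left; exact: y0.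
have cutT : N (uvec T) < cuts N ws (uvec T).
  have := @cuts_gt_radius R N 1 T s n ws hN o1 s0 s1 n0 hws 0.
  by rewrite mulr0 addr0 /radius invrK lexx oppr_le0 ltW// => /(_ isT).
have cutT' : N (uvec T') < cuts N ws (uvec T').
  have := @cuts_gt_radius R N (-1) T' s n ws hN o2 s0 s1 n0 hws' 0.
  by rewrite mulr0 addr0 /radius invrK lexx oppr_le0 ltW// => /(_ isT).
have ra0 := radius_gt0 T hN; have k0 := kappa_gt0 s0 s1.
have rn0 : 0 < radius N T * kappa s ^+ n by rewrite mulr_gt0// exprn_gt0.
have wnE : wn = (radius N T * kappa s ^+ n)^-1 *: uvec m.
  by rewrite /wn /feet /spiral_line mul1r.
have only w : w \in ws -> dot (uvec m) w = cuts N ws (uvec m) -> w = wn.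
  move=> hw hw'; have [e [y [ee ty /andP[y0 yb] _]]] := active w m hw hw'; case=> // yp.
  have : e * y = 0.
    apply: inj; [|by rewrite oppr_lt0 pi0|by rewrite addr0].
    by apply: small => //; exact: lt_trans nsp.
  move/eqP; rewrite mulf_eq0 (gt_eqF yp) orbF => /eqP e0.
  by move: ee; rewrite e0 expr0n => /eqP; rewrite eq_sym oner_eq0.
(* Between the two stable angles the gauge is below its common end value, so the foot is interior to
   the old body. *)
have Nm : N (uvec m) < dot (uvec m) wn.
  rewrite wnE dotZr dot_uvec subrr cos0 mulr1.
  have mT : T' < m < T by rewrite /m TT'; apply/andP; split; lra.
  have := between_lt_max hN nd noT mT; rewrite -NT maxxx => h.
  apply: (lt_le_trans h); rewrite invfM /radius invrK ler_pMr ?gauge_uvec_gt0//.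
  by rewrite invf_ge1 ?exprn_gt0// exprn_ile1 ?ltW//; exact: kappa_lt1.
have wnws : wn \in ws by apply: hws; rewrite n0 leqnn.
have actn : dot (uvec m) wn = cuts N ws (uvec m).
  case: (cuts_attained N ws (uvec m)) => [h|[w hw hw']]; last by rewrite -(only w).
  by move: Nm; rewrite -h ltNge dot_le_cuts.
split=> //.
  apply: (@fewer_stable_cuts_foot R N ws T T' m (radius N T * kappa s ^+ n) c) => //.
  - apply/eqP => h.
    have : n%:R * s = - (n%:R * s).
      apply: inj; [by apply/andP; split; lra|by apply/andP; split; lra|].
      by move: h; rewrite TT' /m; congr (uvec _ = uvec _); ring.
    by lra.
  - rewrite -wnE; apply: cuts_near_line => //.
      by rewrite gaugeZ ?(ltW rn0)// dotZl ltr_pM2l.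
    move=> w hw ne; rewrite !dotZl ltr_pM2l// lt_neqAle actn dot_le_cuts// andbT.
    by apply/eqP => /(only w hw) e; rewrite e eqxx in ne.
  move=> t ct; have [h|tm] := pselect (uvec t = uvec m); [by left|right].
  have [[w0 hw0]|noact] := pselect (exists2 w, w \in ws & dot (uvec t) w = cuts N ws (uvec t)); last first.
    apply: (critical_inactive (e := 1)) => // w hw hw'; case: noact; by exists w.
  move=> hw0'; have [e0 [y0 [e01 ty0 /andP[y00 yb0] _ _]]] := active w0 t hw0 hw0'.
  (* Each active line brings its own side, but the signed angle of [t] from [m] is unique and not
     zero, so the sides agree. *)
  apply: (critical_inactive (e := e0)) => // w hw hw'.
  have [e [y [ee ty /andP[y1 yb] dc _]]] := active w t hw hw'.
  have yp : 0 < y.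
    by rewrite lt_neqAle y1 andbT; apply/eqP => h; apply: tm; rewrite ty -h mulr0 addr0.
  have ey : e * y = e0 * y0.
    by apply: inj; rewrite -?ty -?ty0//; apply: small => //; exact: lt_trans nsp.
  suff -> : e0 = e by exact: dc.
  by case: (sign_cases ee) ey => ->; case: (sign_cases e01) => ->//; lra.
move=> z z1 z2; have [t [w [zE r0 hw zw tw]]] := cuts_polar hN z1 z2; split.
  move: hw; rewrite mem_cat => /orP[] /family_feet[k [kn wE]].
    by apply: (feet_height (T := T) (e := 1) hN s0 s1 (k := k)); [case/andP: kn|rewrite -wE].
  rewrite /radius NT -/(radius N T').
  by apply: (feet_height (T := T') (e := -1) hN s0 s1 (k := k)); [case/andP: kn|rewrite -wE].
have [e [y [ee ty /andP[y0 yb] _ _]]] := active w t hw tw.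
exists (m + e * y); split; last by rewrite -ty.
by case: (sign_cases ee) => ->; rewrite /m TT'; apply/andP; split; lra.
Qed.

End SidedCuts.

(** * The area removed over one arc *)

Section ArcRemoval.
Variable R : realType.
Implicit Types (a b d k l p r s t x y e T : R) (z u w q v : plane R) (ws : seq (plane R)).
Implicit Types (N V : plane R -> R) (i j n : nat).
Notation pmeasurable := (@measurable _ (R * R)%type).

Definition disc_cut N r z : R := Num.max (N z) (r^-1 * enorm z).

Lemma gauge_disc_cut N r : gauge N -> 0 < r -> gauge (disc_cut N r).
Proof.
move=> hN r0; have ri : 0 < r^-1 by rewrite invr_gt0.
by have [eZ eD _] := gauge_scale (gauge_enorm R) ri; exact: gauge_max.
Qed.

Lemma body_disc_cut N r : 0 < r -> body (disc_cut N r) = body N `&` [set z | enorm z <= r].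
Proof.
move=> r0; apply/seteqP; split=> z; rewrite /body /disc_cut /= ge_max.
  by move=> /andP[h1]; rewrite mulrC ler_pdivrMr// mul1r.
by move=> [-> h]; rewrite mulrC ler_pdivrMr// mul1r.
Qed.

Definition arc_gap N r a b := sarea N a b - sarea (disc_cut N r) a b.

(** Removed points lie outside the disc of radius [r], hence are disjoint from the part counted by
    [disc_cut N r]. *)
Lemma removed_area N V a b r s : gauge N -> gauge V -> 0 < s -> 0 < r -> a < b ->
  b + 2 * s <= a - 2 * s + 2 * pi -> removed_in N V a b r s ->
  (area (body N `\` body V) <= (arc_gap N r (a - 2 * s) (b + 2 * s))%:E)%E.
Proof.
move=> hN hV s0 r0 ab le2 h; set a' := a - 2 * s in le2 *; set b' := b + 2 * s in le2 *.
have hD := gauge_disc_cut hN r0.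
have mD : pmeasurable (body N `\` body V) by apply: measurableD; exact: body_measurable.
have mM := bodyI_measurable hD le2; have mN := bodyI_measurable hN le2.
have disj : (body N `\` body V) `&` (body (disc_cut N r) `&` sector a' b') = set0.
  apply/seteqP; split=> // z [[z1 /negP]]; rewrite -ltNge => z2; rewrite body_disc_cut// => -[[_ z3] _].
  by have [] := h z z1 z2; rewrite ltNge z3.
have sub : (body N `\` body V) `|` (body (disc_cut N r) `&` sector a' b') `<=` body N `&` sector a' b'.
  move=> z [[z1 /negP]|[]]; last by rewrite body_disc_cut// => -[].
  rewrite -ltNge => z2; split=> //; have [h1 [t [ht zE]]] := h z z1 z2.
  by exists (enorm z), t; split=> //; exact: lt_trans h1.
have := le_area (measurableU _ _ mD mM) mN sub; rewrite areaU// !sareaE//.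
have /fineK <- : area (body N `\` body V) \is a fin_num.
  by apply: (body_area_fin hN) => // z [].
by rewrite -EFinD !lee_fin /arc_gap; lra.
Qed.

Lemma bernoulli x n : 0 <= x -> x <= 1 -> 1 - n%:R * x <= (1 - x) ^+ n.
Proof.
move=> x0 x1; elim: n => [|n IH]; first by rewrite mul0r subr0.
rewrite exprS; have y0 : 0 <= 1 - x by rewrite subr_ge0.
apply: le_trans (ler_wpM2l y0 IH); rewrite -[n.+1%:R]natr1.
have : 0 <= n%:R * x ^+ 2 by rewrite mulr_ge0// sqr_ge0.
by move=> h; rewrite -subr_ge0 (_ : _ - _ = n%:R * x ^+ 2)//; ring.
Qed.

Lemma kappa_expr_ge s n : 0 < s -> s <= 1 / 2 -> 1 - n%:R * s ^+ 2 <= kappa s ^+ n.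
Proof.
move=> s0 s1; apply: bernoulli; first exact: sqr_ge0.
by rewrite -[1](expr1n _ 2) ler_pXn2r ?nnegrE// ?ltW//; lra.
Qed.

(** Two errors, both linear in [s]: the margins have total opening [4 * s], and shrinking the disc
    costs the factor [kappa s ^+ (2 * n)], which is at least [1 - 2 * n * s ^+ 2] with [n * s]
    bounded. *)
Lemma arc_gap_widen N r a b : gauge N -> 0 < r -> a < b -> b < a + 2 * pi ->
  exists C, 0 < C /\ forall s n, 0 < s -> s <= 1 / 2 -> n%:R * s <= 2 * pi ->
    b + 2 * s <= a - 2 * s + 2 * pi ->
    arc_gap N (r * kappa s ^+ n) (a - 2 * s) (b + 2 * s) <= arc_gap N r a b + s * C.
Proof.
move=> hN r0 ab ba; have [m [m0 hm]] := gauge_lower hN.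
have hD := gauge_disc_cut hN r0; have pi0 := pi_gt0 R.
have D0 : 0 <= sarea (disc_cut N r) a b by apply: sarea_ge0 => //; exact: ltW.
have c0 := polar_cst_gt0 R; have v0 : 0 < m ^- 2 by rewrite invr_gt0 exprn_gt0.
(* The first summand pays for the margins, the second for [2 * n * s ^+ 2 <= 4 * pi * s]. *)
exists (4 * polar_cst R * m ^- 2 + 4 * pi * sarea (disc_cut N r) a b).
split.
  have pos A B C : 0 < A -> 0 < B -> 0 <= C -> 0 < 4 * A * B + 4 * pi * C :> R.
    by move=> A0 B0 C0; rewrite ltr_wpDr ?mulr_gt0// mulr_ge0// mulr_ge0// ltW.
  exact: pos.
move=> s n s0 s1 nsp le2.
have [i1 i2 i3 i4] : [/\ a - 2 * s <= a, a <= b, b <= b + 2 * s & a <= b + 2 * s].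
  by clear -s0 ab; split; lra.
have [i5 i6] : b <= a - 2 * s + 2 * pi /\ b + 2 * s <= a + 2 * pi by clear -s0 ab le2; split; lra.
have k0 := kappa_gt0 s0 s1.
have rn0 : 0 < r * kappa s ^+ n by rewrite mulr_gt0// exprn_gt0.
have hD' := gauge_disc_cut hN rn0.
have side x : sarea N x (x + 2 * s) <= polar_cst R * m ^- 2 * (2 * s).
  rewrite [X in _ <= _ * X](_ : 2 * s = x + 2 * s - x); last by ring.
  apply: sarea_le => //; [by rewrite lerDl; lra|by have := pi_ge2 R; lra|].
  move=> t _; have n0 := gauge_uvec_gt0 t hN; have n2 : 0 < N (uvec t) ^+ 2 by rewrite exprn_gt0.
  have m2 : 0 < m ^+ 2 by rewrite exprn_gt0.
  rewrite lef_pV2 ?posrE//; have n1 := ltW n0; have m1 := ltW m0; rewrite ler_pXn2r ?nnegrE//.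
  by have := hm (uvec t); rewrite enorm_uvec mulr1.
have eN : sarea N (a - 2 * s) (b + 2 * s) <= sarea N a b + polar_cst R * m ^- 2 * (4 * s).
  rewrite (@sarea_cat _ N _ a)//.
  rewrite (@sarea_cat _ N a b)//.
  have := side (a - 2 * s); rewrite subrK => h1; have := side b => h2.
  rewrite (_ : polar_cst R * m ^- 2 * (4 * s) = polar_cst R * m ^- 2 * (2 * s) + polar_cst R * m ^- 2 * (2 * s)); last by ring.
  by move: h1 h2; move: (sarea _ _ _) (sarea _ _ _) (sarea _ _ _) (_ * (2 * s)) => A B C' D' h1 h2; clear -h1 h2; lra.
have e1 : sarea (disc_cut N (r * kappa s ^+ n)) a b <=
    sarea (disc_cut N (r * kappa s ^+ n)) (a - 2 * s) (b + 2 * s).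
  rewrite (@sarea_cat _ _ (a - 2 * s) a (b + 2 * s))//.
  rewrite (@sarea_cat _ _ a b (b + 2 * s))//.
  have [j1 j2] : a <= a - 2 * s + 2 * pi /\ b + 2 * s <= b + 2 * pi.
    by clear -s0 i2 i5 i6; split; lra.
  have p1 := sarea_ge0 hD' j1; have p2 := sarea_ge0 hD' j2.
  by rewrite addrCA lerDl; exact: addr_ge0 p1 p2.
have kn : kappa s ^+ n <= 1 by rewrite exprn_ile1 ?ltW// kappa_lt1.
have kn0 : 0 < kappa s ^+ n by rewrite exprn_gt0.
have e2 : (kappa s ^+ n) ^+ 2 * sarea (disc_cut N r) a b <= sarea (disc_cut N (r * kappa s ^+ n)) a b.
  have i0 : 0 < (kappa s ^+ n)^-1 by rewrite invr_gt0.
  have := sarea_scale hD i0 (ltW ba).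
  rewrite (_ : (kappa s ^- n) ^- 2 = (kappa s ^+ n) ^+ 2); last by rewrite exprVn invrK.
  move=> <-.
  apply: le_sarea => //; [exact: gauge_scale|exact: ltW|].
  move=> t _; rewrite /disc_cut enorm_uvec !mulr1 ge_max maxr_pMr ?(ltW i0)//.
  rewrite !le_max [r * _]mulrC invfM lexx orbT andbT ler_peMl ?invf_ge1 ?gauge_ge0//.
have e3 : (1 - 2 * (2 * pi) * s) * sarea (disc_cut N r) a b <= (kappa s ^+ n) ^+ 2 * sarea (disc_cut N r) a b.
  apply: ler_wpM2r => //; rewrite -exprM; apply: le_trans (kappa_expr_ge _ s0 s1).
  rewrite lerD2l lerN2 natrM expr2 mulrA ler_wpM2r ?(ltW s0)//.
  by rewrite mulrAC mulrC ler_wpM2l.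
rewrite /arc_gap; move: e1 e2 e3 eN D0.
move: (sarea _ (a - _) _) (sarea _ (a - _) _) (sarea (disc_cut N r) a b) (sarea (disc_cut N _) a b)
  (sarea N a b) (_ ^+ 2) => A B D E F G h1 h2 h3 h4 h5.
have h6 := le_trans h3 (le_trans h2 h1).
rewrite -subr_ge0 in h6; rewrite -subr_ge0 in h4; rewrite -subr_ge0.
rewrite (_ : _ - _ = (B - (1 - 2 * (2 * pi) * s) * D) + (F + polar_cst R * m ^- 2 * (4 * s) - A)); last by ring.
exact: addr_ge0.
Qed.

(** The spiral has to end exactly at the angle [l], so the step runs through the fractions
    [l / n]. *)
Lemma small_step (P : set R) l : 0 < l -> (\forall s \near 0^'+, P s) ->
  exists n s, [/\ (0 < n)%N, 0 < s, n%:R * s = l & P s].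
Proof.
move=> l0 /nbhs_ballP[d /= d0 hd].
have [n hn] : exists n, l / d < n.+1%:R.
  by exists (Num.truncn (l / d)); have /andP[] := truncn_itv (ltW (divr_gt0 l0 d0)).
exists n.+1, (l / n.+1%:R); split=> //; first by rewrite divr_gt0.
  by rewrite mulrC divfK.
apply: hd; last by rewrite divr_gt0.
rewrite /ball /= sub0r normrN gtr0_norm ?divr_gt0//.
by rewrite ltr_pdivrMr// mulrC -ltr_pdivrMr.
Qed.

Lemma near_lt_right C x : 0 < x -> \forall s \near 0^'+, s * C < x.
Proof.
move=> x0; have c : s * C @[s --> (0 : R)^'+] --> 0 * C.
  by apply: cvg_at_right_filter; apply: cvgM; [exact: cvg_id|exact: cvg_cst].
rewrite mul0r in c; move/cvgrPdist_lt : c => /(_ _ x0); apply: filterS => s.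
by rewrite sub0r normrN => /ltr_normlW.
Qed.

Definition arc_radius N a b := Num.max (radius N a) (radius N b).

Lemma arc_fewer N a b l e c : gauge N -> K2 (body N) -> all_nondegenerate (body N) 0 ->
  (stable_points (body N) 0 #= `I_c)%card -> a < b -> b < a + 2 * pi ->
  stable_angle N a -> stable_angle N b -> (forall x, a < x < b -> ~ stable_angle N x) -> 0 < l ->
  (forall x, b < x < b + l -> ~ stable_angle N x) ->
  (forall x, a - l < x < a -> ~ stable_angle N x) -> 0 < e ->
  exists K', fewer_stable (body N) 0 K' /\
    (area (body N `\` K') <= (arc_gap N (arc_radius N a b) a b + e)%:E)%E.
Proof.
move=> hN kN nd fin ab ba sta stb noab l0 nob noa e0; have pi0 := pi_gt0 R.
have o1 : (1 : R) ^+ 2 = 1 by rewrite expr1n.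
have o2 : (-1 : R) ^+ 2 = 1 by rewrite sqrrN expr1n.
have [d1 [d10 des1]] : exists d, 0 < d /\ forall x, 0 < x < d -> descends 1 N (b + 1 * x).
  apply: (descends_beyond (l := l)) => // x /andP[x0 xl].
  by apply: nob; apply/andP; split; lra.
have [d2 [d20 des2]] : exists d, 0 < d /\ forall x, 0 < x < d -> descends (-1) N (a + (-1) * x).
  apply: (descends_beyond (l := l)) => // x /andP[x0 xl].
  by apply: noa; apply/andP; split; lra.
set r := arc_radius N a b; have ra0 := radius_gt0 a hN; have rb0 := radius_gt0 b hN.
have r0 : 0 < r by rewrite lt_max ra0.
have [C [C0 hC]] := arc_gap_widen hN r0 ab ba.
pose Q s := [/\ s <= 1 / 2, forall x, 0 < x < 2 * s -> descends 1 N (b + 1 * x),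
  forall x, 0 < x < 2 * s -> descends (-1) N (a + (-1) * x), s * C <= e & b + 2 * s <= a - 2 * s + 2 * pi].
have nQ : \forall s \near 0^'+, Q s.
  near=> s; have s0 : 0 < s by near: s; exact: nbhs_right_gt.
  split.
  - by apply/ltW; near: s; apply: nbhs_right_lt; lra.
  - move=> x /andP[x0 xs]; apply: des1; rewrite x0 (lt_trans xs)// mulrC.
    by near: s; exact: near_lt_right.
  - move=> x /andP[x0 xs]; apply: des2; rewrite x0 (lt_trans xs)// mulrC.
    by near: s; exact: near_lt_right.
  - by apply/ltW; near: s; exact: near_lt_right.
  - have : s * 4 < 2 * pi - (b - a) by near: s; apply: near_lt_right; lra.
    by move=> h; clear -h; lra.
have finish V s n : gauge V -> fewer_stable (body N) 0 (body V) -> 0 < s -> n%:R * s <= 2 * pi ->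
    Q s -> removed_in N V a b (r * kappa s ^+ n) s ->
    exists K', fewer_stable (body N) 0 K' /\ (area (body N `\` K') <= (arc_gap N r a b + e)%:E)%E.
  move=> hV fV s0 ns [q1 _ _ q4 q5] rem; exists (body V); split=> //.
  have rk0 : 0 < r * kappa s ^+ n by rewrite mulr_gt0// exprn_gt0// kappa_gt0.
  apply: le_trans (removed_area hN hV s0 rk0 ab q5 rem) _; rewrite lee_fin.
  by apply: le_trans (hC s n s0 q1 ns q5) _; rewrite lerD2l.
have higher x y : 0 < x -> x < y -> \forall s \near 0^'+, x < y * (1 - (b - a) * s).
  move=> x0 xy; have := @near_lt_right (y * (b - a)) (y - x); rewrite subr_gt0 => /(_ xy).
  apply: filterS => s; rewrite -subr_gt0 => h; rewrite -subr_gt0.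
  by rewrite (_ : _ - _ = y - x - s * (y * (b - a)))//; ring.
have foot x y s n : 0 < s -> s <= 1 / 2 -> n%:R * s = b - a -> 0 < x -> 0 < y ->
    x < y * (1 - (b - a) * s) -> (y * kappa s ^+ n)^-1 < x^-1.
  move=> s0 s1 ns x0 y0 h; rewrite ltf_pV2 ?posrE//; last by rewrite mulr_gt0// exprn_gt0// kappa_gt0.
  apply: lt_le_trans h _; rewrite ler_pM2l//.
  by apply: le_trans (kappa_expr_ge n s0 s1); rewrite expr2 mulrA ns.
have ab0 : 0 < b - a by rewrite subr_gt0.
have ns2 : b - a <= 2 * pi by lra.
have [rab|rba|req] := ltgtP (radius N a) (radius N b).
- have [n [s [n0 s0 ns [[q1 q2 q3 q4 q5] hi]]]] := small_step ab0 (filterI nQ (higher _ _ ra0 rab)).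
  have bE : b - 1 * (n%:R * s) = a by rewrite ns; ring.
  have rE : r = radius N b by rewrite /r /arc_radius max_r// ltW.
  have st : stable_angle N (b - 1 * (n%:R * s)) by rewrite bE.
  have no x : - (n%:R * s) < x < 0 -> ~ stable_angle N (b + 1 * x).
    by rewrite ns => /andP[h1 h2]; apply: noab; apply/andP; split; clear -h1 h2; lra.
  have low : (radius N b * kappa s ^+ n)^-1 < N (uvec (b - 1 * (n%:R * s))).
    by rewrite bE -[N (uvec a)]invrK; exact: foot.
  have [V [hV fV rem]] := one_sided_cut hN kN nd fin o1 s0 q1 n0 stb st no q2 low.
  apply: (finish V s n hV fV s0) => //; first by rewrite ns.
  by rewrite rE; move: rem; rewrite bE min_r ?max_l ?ltW.
- have [n [s [n0 s0 ns [[q1 q2 q3 q4 q5] hi]]]] := small_step ab0 (filterI nQ (higher _ _ rb0 rba)).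
  have aE : a - (-1) * (n%:R * s) = b by rewrite ns; ring.
  have rE : r = radius N a by rewrite /r /arc_radius max_l// ltW.
  have st : stable_angle N (a - (-1) * (n%:R * s)) by rewrite aE.
  have no x : - (n%:R * s) < x < 0 -> ~ stable_angle N (a + (-1) * x).
    by rewrite ns => /andP[h1 h2]; apply: noab; apply/andP; split; clear -h1 h2; lra.
  have low : (radius N a * kappa s ^+ n)^-1 < N (uvec (a - (-1) * (n%:R * s))).
    by rewrite aE -[N (uvec b)]invrK; exact: foot.
  have [V [hV fV rem]] := one_sided_cut hN kN nd fin o2 s0 q1 n0 sta st no q3 low.
  apply: (finish V s n hV fV s0) => //; first by rewrite ns.
  by rewrite rE; move: rem; rewrite aE min_l ?max_r ?ltW.
have half0 : 0 < (b - a) / 2 by rewrite divr_gt0.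
have nhalf : \forall s \near 0^'+, (b - a) / 2 + s * 2 < pi.
  have h : 0 < pi - (b - a) / 2 by lra.
  by have := @near_lt_right 2 _ h; apply: filterS => s; lra.
have [n [s [n0 s0 ns [[q1 q2 q3 q4 q5] hi]]]] := small_step half0 (filterI nQ nhalf).
have rE : r = radius N b by rewrite /r /arc_radius req maxxx.
have h1 : n%:R * s + 2 * s < pi by rewrite ns [2 * s]mulrC.
have h2 : a = b - 2 * (n%:R * s) by rewrite ns; field.
have h3 : N (uvec b) = N (uvec a) by apply/invr_inj; rewrite -/(radius N b) -req.
have [V [hV fV rem]] := two_sided_cut hN kN nd fin s0 q1 n0 h1 stb sta h2 h3 noab q2 q3.
apply: (finish V s n hV fV s0) => //; first by rewrite ns; clear -ns2 ab0; lra.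
by rewrite rE.
Unshelve. all: by end_near. Qed.

End ArcRemoval.

(** * The area inequality over half an arc *)

Section Kite.
Variable R : realType.
Implicit Types (a b c d h k m p r s t x y e T : R) (z w q v : plane R).
Implicit Types (N : plane R -> R).

Lemma sin_combination t0 e s s' : e ^+ 2 = 1 ->
  sin s' *: uvec (t0 + e * s) = sin (s' - s) *: uvec t0 + sin s *: uvec (t0 + e * s').
Proof.
move=> e1; have [c1 s1] := sign_cos_sin s e1; have [c2 s2] := sign_cos_sin s' e1.
rewrite sinB; apply: injective_projections; rewrite /= /GRing.scale /= ?cosD ?sinD c1 s1 c2 s2; ring.
Qed.

(** The direction at [s] is a nonnegative combination of those at 0 and [s']. Subadditivity and the
    support line at [t0] then bound [N] there, and the sine identity makes the bound exact. *)
Lemma critical_ratio N t0 e s s' : gauge N -> critical N t0 -> e ^+ 2 = 1 ->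
  0 <= s -> s <= s' -> s' < pi / 2 ->
  N (uvec (t0 + e * s)) * cos s' <= N (uvec (t0 + e * s')) * cos s.
Proof.
move=> hN ct e1 s0 ss' s'p; have pi2 := pi_ge2 R; have pi0 := pi_gt0 R.
have c' : 0 < cos s' by apply: cos_gt0_pihalf; apply/andP; split; lra.
have [s'0|s'n0] := eqVneq s' 0.
  by have -> : s = s' by [lra|]; rewrite mulrC.
have s'0 : 0 < s' by rewrite lt_neqAle eq_sym s'n0 (le_trans s0).
have sn' : 0 < sin s' by apply: sin_gt0_pi; apply/andP; split; lra.
have sn : 0 <= sin s by apply: sin_ge0_pi; apply/andP; split; lra.
have snd : 0 <= sin (s' - s) by apply: sin_ge0_pi; apply/andP; split; lra.
have h1 : N (uvec t0) * cos s' <= N (uvec (t0 + e * s')).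
  have := ct (uvec (t0 + e * s')); rewrite dot_uvec opprD addrA subrr add0r cosN.
  by have [-> _] := sign_cos_sin s' e1.
have h2 : sin s' * N (uvec (t0 + e * s)) <= sin (s' - s) * N (uvec t0) + sin s * N (uvec (t0 + e * s')).
  rewrite -(gaugeZ _ hN (ltW sn')) -(gaugeZ _ hN snd) -(gaugeZ _ hN sn) (sin_combination t0 s s' e1).
  exact: gaugeD.
rewrite -(ler_pM2l sn') mulrA; apply: le_trans (ler_wpM2r (ltW c') h2) _.
rewrite mulrDl -[_ * _ * cos s']mulrA; apply: le_trans (lerD (ler_wpM2l snd h1) (lexx _)) _.
rewrite le_eqVlt; apply/orP; left; apply/eqP; rewrite sinB; ring.
Qed.

(* [a = cos s ^+ 2], [b = (r * N (uvec (t0 + e * s))) ^+ 2] and, at the point [c] where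
   [cos c ^+ 2 = h / tan h], [m] and [u] are the values of [a] and [b]. *)
Lemma kite_pointwise a b m (u : R) : 0 < a -> a < 1 -> a <= b -> 0 < m -> 0 < u ->
  (m <= a /\ m * b <= u * a) \/ (a <= m /\ u * a <= m * b) ->
  m / u * (m^-1 - a^-1) <= m^-1 * (Num.max b 1)^-1 - b^-1 /\
  (m / u * (m^-1 - a^-1) = m^-1 * (Num.max b 1)^-1 - b^-1 -> a = b).
Proof.
move=> a0 a1 ab m0 u0 hc; have b0 : 0 < b := lt_le_trans a0 ab.
have M0 : 0 < Num.max b 1 by rewrite lt_max b0.
have step1 : a / b <= (Num.max b 1)^-1.
  rewrite ler_pdivrMr// mulrC ler_pdivlMr//.
  by rewrite maxr_pMr ?(ltW a0)// mulr1 ge_max ab andbT mulrC ger_pMr// ltW.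
(* As in Chebyshev's inequality, [a] and [a / b] lie on the same side of their values [m] and
   [m / u], so the product of the differences is nonnegative. *)
have step2 : m / u * (m^-1 - a^-1) <= m^-1 * (a / b) - b^-1.
  rewrite -subr_ge0.
  have -> : m^-1 * (a / b) - b^-1 - m / u * (m^-1 - a^-1) = (a - m) * (u * a - m * b) / (m * b * (u * a)).
    by field; rewrite !gt_eqF.
  apply: divr_ge0; last by rewrite !mulr_ge0// ltW.
  by case: hc => -[h1 h2]; [apply: mulr_ge0|apply: mulr_le0]; rewrite ?subr_ge0 ?subr_le0.
have mi : 0 < m^-1 by rewrite invr_gt0.
have step3 : m^-1 * (a / b) - b^-1 <= m^-1 * (Num.max b 1)^-1 - b^-1 by rewrite lerD2r ler_pM2l.
split; first exact: le_trans step2 step3.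
move=> eq; have : m^-1 * (a / b) = m^-1 * (Num.max b 1)^-1.
  apply/eqP; rewrite eq_le ler_pM2l// step1 /=.
  by rewrite -(lerD2r (- b^-1)) -eq.
have mn0 : m^-1 != 0 by rewrite gt_eqF.
move/(mulfI mn0) => h; have {}h : a * Num.max b 1 = b.
  have Mn0 : Num.max b 1 != 0 by rewrite gt_eqF.
  by apply: (mulIf (_ : b^-1 != 0)); rewrite ?invr_eq0 ?gt_eqF// mulrAC h mulVf// divff// gt_eqF.
have [b1|b1] := leP b 1; first by rewrite max_r// mulr1 in h.
rewrite max_l ?(ltW b1)// in h; have : a = 1.
  by apply: (mulIf (_ : b != 0)); rewrite ?h ?mul1r// gt_eqF.
by move=> a1'; move: a1; rewrite a1' ltxx.
Qed.

Lemma lt_cos x y : 0 <= x -> x < y -> y <= pi -> cos y < cos x.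
Proof.
move=> x0 xy yp; rewrite ltr_cos// in_itv /= ?x0 ?yp ?(le_trans (ltW xy))//.
by rewrite (le_trans x0)// ltW.
Qed.

Lemma tan_gt_id h : 0 < h -> h < pi / 2 -> h * cos h < sin h.
Proof.
move=> h0 hp; have pi0 := pi_gt0 R.
have D x : is_derive x 1 (fun y => sin y - y * cos y) (x * sin x).
  by apply: is_derive_eq; rewrite /GRing.scale /=; ring.
have cf : {within `[0, h], continuous (fun y => sin y - y * cos y)}.
  by apply: continuous_subspaceT => x; exact: is_derive_continuous (D x).
have [x] := MVT h0 (fun x _ => D x) cf; rewrite in_itv /= => /andP[x0 xh].
rewrite sin0 mul0r !subr0 => e; rewrite -subr_gt0 e !mulr_gt0//.
by apply: sin_gt0_pi; rewrite x0 /= (lt_trans xh)// (lt_trans hp)// ltr_pdivrMr// ltr_pMr// ltr1n.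
Qed.

Lemma is_derive_phase e t0 t : is_derive t 1 (fun x => e * (x - t0)) e.
Proof.
have d : is_derive t 1 (fun x => x - t0) (1 - 0) by exact: is_deriveB.
by have := is_deriveZ e d; rewrite subr0 /GRing.scale /= mulr1.
Qed.

Lemma max1_sqr x : 0 < x -> Num.max x 1 ^+ 2 = Num.max (x ^+ 2) 1.
Proof.
move=> x0; have [h|/ltW h] := leP x 1.
  by rewrite max_r ?expr1n// expr_le1// ltW.
by rewrite max_l// expr_ge1// ltW.
Qed.

(* With [w s = (cos s / (r * N (uvec (t0 + e * s)))) ^+ 2], which is at most 1 and
   nonincreasing, and with [cos c ^+ 2 = h / tan h], the derivative of the difference
   of the two sides is at least a multiple of [w c * (tan h / h - (cos s)^-2)], whose
   integral over [0, h] vanishes. *)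
Lemma half_kite N r e t0 p h : gauge N -> critical N t0 -> 0 < h -> h < pi / 2 ->
  (e = 1 /\ t0 = p) \/ (e = -1 /\ t0 = p + h) -> radius N t0 <= r ->
  h / tan h * sarea N p (p + h) <= sarea (disc_cut N r) p (p + h) /\
  (h / tan h * sarea N p (p + h) = sarea (disc_cut N r) p (p + h) ->
   forall s, 0 < s < h -> N (uvec (t0 + e * s)) = r^-1 * cos s).
Proof.
move=> hN ct h0 hp et rr; have pi0 := pi_gt0 R; have pi2 := pi_ge2 R.
have rt0 := radius_gt0 t0 hN; have r0 : 0 < r := lt_le_trans rt0 rr.
have hD := gauge_disc_cut hN r0.
have e1 : e ^+ 2 = 1 by case: et => -[-> _]; rewrite ?sqrrN expr1n.
have ee : e * e = 1 by rewrite -expr2.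
pose u s := r * N (uvec (t0 + e * s)).
have u0 s : 0 < u s by rewrite mulr_gt0// gauge_uvec_gt0.
have cpos s : 0 <= s -> s <= h -> 0 < cos s.
  by move=> s0 sh; apply: cos_gt0_pihalf; apply/andP; split; lra.
have ratio s s' : 0 <= s -> s <= s' -> s' <= h -> u s * cos s' <= u s' * cos s.
  move=> s0 ss' sh; rewrite /u -!mulrA ler_pM2l//.
  by apply: critical_ratio => //; exact: le_lt_trans hp.
have u00 : 1 <= u 0.
  by rewrite /u mulr0 addr0 -ler_pdivrMr ?gauge_uvec_gt0// mul1r.
have cos_le_u s : 0 <= s -> s <= h -> cos s <= u s.
  move=> s0 sh; have := ratio 0 s (lexx _) s0 sh; rewrite cos0 mulr1.
  by apply: le_trans; rewrite ler_peMl// ltW// cpos.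
have tanh : 0 < tan h by rewrite /tan divr_gt0 ?cpos ?(ltW h0)// sin_gt0_pihalf// h0.
set m := h / tan h; have m0 : 0 < m by rewrite divr_gt0.
(* The value is taken because [cos h ^+ 2 <= h / tan h] amounts to [sin h * cos h <= h], and
   [h / tan h <= 1] to [h <= tan h]. *)
have [c [c0 ch cm]] : exists c, [/\ 0 <= c, c <= h & cos c ^+ 2 = m].
  have ccos : continuous (fun x => cos x ^+ 2).
    by move=> x; apply: cvgM; exact: continuous_cos.
  have hm : cos h ^+ 2 <= m.
    rewrite /m /tan invf_div mulrA ler_pdivlMr; last by rewrite sin_gt0_pihalf// h0.
    rewrite expr2 mulrAC ler_pM2r ?cpos ?(ltW h0)//.
    apply: le_trans (sin_le_id (ltW h0)); rewrite mulrC ger_pMr ?cos_le1//.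
    by rewrite sin_gt0_pihalf// h0.
  have m1 : m <= cos 0 ^+ 2.
    rewrite cos0 expr1n /m /tan invf_div mulrA ler_pdivrMr ?sin_gt0_pihalf ?h0// mul1r ltW//.
    exact: tan_gt_id.
  have [||c] := @IVT R (fun x => cos x ^+ 2) 0 h m (ltW h0).
  - exact: continuous_subspaceT.
  - by rewrite ge_min le_max hm m1 orbT.
  by rewrite in_itv /= => /andP[c0 ch] cm; exists c.
pose k := polar_cst R * r ^+ 2; have k0 : 0 < k by rewrite mulr_gt0 ?polar_cst_gt0// exprn_gt0.
pose W := m / u c ^+ 2.
pose ph t := e * (t - t0).
pose X t := m^-1 * sarea (disc_cut N r) p t - sarea N p t - k * W * (e * (m^-1 * ph t - tan (ph t))).
pose dX t := k * (m^-1 * (Num.max (u (ph t) ^+ 2) 1)^-1 - (u (ph t) ^+ 2)^-1 - W * (m^-1 - (cos (ph t) ^+ 2)^-1)).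
have phi t : p <= t <= p + h -> 0 <= ph t <= h.
  by case: et => -[ee' te]; rewrite /ph te ee' => /andP[h1 h2]; apply/andP; split; lra.
have phii t : p < t < p + h -> 0 < ph t < h.
  by case: et => -[ee' te]; rewrite /ph te ee' => /andP[h1 h2]; apply/andP; split; lra.
have uph t : u (ph t) = r * N (uvec t).
  by rewrite /u /ph mulrA ee mul1r addrC subrK.
have DX t : p < t < p + h -> is_derive t 1 X (dX t).
  move=> tp; have /andP[p1 p2] := phii t tp; have ctn0 : cos (ph t) != 0 by rewrite gt_eqF// cpos// ltW.
  have t2 : p < t < p + 2 * pi by case/andP: tp => h1 h2; apply/andP; split; lra.
  have d1 := sarea_is_derive hN t2; have d2 := sarea_is_derive hD t2.
  have dph : is_derive t 1 ph e by exact: is_derive_phase.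
  have dt := is_derive1_comp (is_derive_tan ctn0) dph.
  have -> : dX t = m^-1 *: (polar_cst R / disc_cut N r (uvec t) ^+ 2) - polar_cst R / N (uvec t) ^+ 2
      - (k * W) *: (e *: (m^-1 *: e - (cos (ph t)) ^- 2 * e)).
    have -> : disc_cut N r (uvec t) ^+ 2 = r ^- 2 * Num.max (u (ph t) ^+ 2) 1.
      have -> : disc_cut N r (uvec t) = r^-1 * Num.max (u (ph t)) 1.
        by rewrite maxr_pMr ?invr_ge0 ?(ltW r0)// uph mulKf ?gt_eqF// mulr1 /disc_cut enorm_uvec mulr1.
      rewrite exprMn exprVn; congr (_ * _).
      exact: max1_sqr.
    rewrite /dX /k uph; have := gt_eqF (gauge_uvec_gt0 t hN); move: (N (uvec t)) => n nn0.
    rewrite /GRing.scale /= exprMn.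
    have M0 : Num.max (r ^+ 2 * n ^+ 2) 1 != 0.
      by rewrite gt_eqF// lt_max ltr01 orbT.
    move: (Num.max _ _) M0 => M M0; move: (polar_cst R) => cp.
    have -> : e * (m^-1 * e - cos (ph t) ^- 2 * e) = m^-1 - cos (ph t) ^- 2.
      by transitivity (e ^+ 2 * (m^-1 - cos (ph t) ^- 2)); [ring|rewrite e1 mul1r].
    by field; rewrite ctn0 M0 nn0 !gt_eqF.
  exact: is_deriveB.
have cX : {within `[p, p + h], continuous X}.
  have sub : `[p, p + h] `<=` `[p, p + 2 * pi].
    by apply: subset_itvl; rewrite bnd_simp; lra.
  have c1 := continuous_subspaceW sub (sarea_continuous (a := p) hN).
  have c2 := continuous_subspaceW sub (sarea_continuous (a := p) hD).
  have c3 : {within `[p, p + h], continuous (fun t => e * (m^-1 * ph t - tan (ph t)))}.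
    apply: continuous_in_subspaceT => t; rewrite inE /= in_itv /= => /phi /andP[p1 p2].
    have ctn0 : cos (ph t) != 0 by rewrite gt_eqF// cpos.
    have dph : is_derive t 1 ph e by exact: is_derive_phase.
    have dt := is_derive1_comp (is_derive_tan ctn0) dph.
    have d : is_derive t 1 (fun t => e * (m^-1 * ph t - tan (ph t))) (e *: (m^-1 *: e - (cos (ph t)) ^- 2 * e)).
      exact: is_deriveZ.
    exact: is_derive_continuous d.
  move=> x; apply: cvgB; [apply: cvgB; [apply: cvgM; [exact: cvg_cst|exact: c2]|exact: c1]|].
  by apply: cvgM; [exact: cvg_cst|exact: c3].
have pw t : p < t < p + h -> 0 <= dX t /\ (dX t = 0 -> cos (ph t) ^+ 2 = u (ph t) ^+ 2).
  move=> /phii /andP[p1 p2]; set s := ph t in p1 p2 *.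
  have cs := cpos s (ltW p1) (ltW p2); have cc := cpos c c0 ch.
  have a1 : cos s ^+ 2 < 1.
    rewrite expr_lt1 ?(ltW cs)// -cos0; apply: lt_cos => //; lra.
  have sq x y : 0 < x -> x <= y -> x ^+ 2 <= y ^+ 2.
    by move=> x0 xy; have y0 := lt_le_trans x0 xy; rewrite ler_pXn2r// nnegrE ltW.
  have us := u0 s; have uc := u0 c.
  have [h1 h2] : m / u c ^+ 2 * (m^-1 - (cos s ^+ 2)^-1) <= m^-1 * (Num.max (u s ^+ 2) 1)^-1 - (u s ^+ 2)^-1 /\
    (m / u c ^+ 2 * (m^-1 - (cos s ^+ 2)^-1) = m^-1 * (Num.max (u s ^+ 2) 1)^-1 - (u s ^+ 2)^-1 -> cos s ^+ 2 = u s ^+ 2).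
    apply: kite_pointwise => //; rewrite ?exprn_gt0//.
      by apply: sq => //; exact: cos_le_u (ltW p1) (ltW p2).
    rewrite -cm -!exprMn; have [sc|sc] := leP s c; [left|right]; split; apply: sq => //.
    - have [->//|sc'] := eqVneq s c.
      have sc2 : s < c by rewrite lt_neqAle sc'.
      by apply/ltW; apply: lt_cos (ltW p1) sc2 _; lra.
    - by rewrite mulr_gt0.
    - by rewrite mulrC; exact: ratio (ltW p1) sc ch.
    - by apply/ltW; apply: lt_cos c0 sc _; lra.
    - by rewrite mulr_gt0.
    - by rewrite [leRHS]mulrC; exact: ratio c0 (ltW sc) (ltW p2).
  rewrite /dX -/s -/W; split; first by rewrite mulr_ge0 ?(ltW k0)// subr_ge0.
  by move/eqP; rewrite mulf_eq0 (gt_eqF k0) /= subr_eq0 => /eqP/esym.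
have mh : m^-1 * h - tan h = 0.
  by rewrite /m invf_div divfK ?subrr// gt_eqF.
have base x : x = 0 \/ x = h -> m^-1 * x - tan x = 0.
  by case=> ->//; rewrite mulr0 tan0 subr0.
have Xp : X p = 0.
  rewrite /X !sarea_id// base; first by rewrite !mulr0 !subr0.
  by rewrite /ph; case: et => -[-> ->]; [left|right]; ring.
have Xq : X (p + h) = m^-1 * sarea (disc_cut N r) p (p + h) - sarea N p (p + h).
  rewrite /X base ?mulr0 ?subr0//.
  by rewrite /ph; case: et => -[-> ->]; [right|left]; ring.
have php : p <= p + h by rewrite lerDl ltW.
have mi : 0 < m^-1 by rewrite invr_gt0.
have key : 0 <= X (p + h).
  rewrite -{1}Xp; apply: (ge0_derive_le php cX DX) => t tp; by have [] := pw t tp.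
split; first by rewrite -(ler_pM2l mi) mulKf ?gt_eqF// -subr_ge0 -Xq.
move=> eq s s0h.
(* Under equality the monotone function [X] vanishes at both ends, so its derivative is 0 and the
   pointwise inequality is an equality at every interior angle. *)
have X0 t : p <= t <= p + h -> X t = 0.
  move=> /andP[t1 t2]; apply/eqP; rewrite eq_le -{2}Xp; apply/andP; split.
    have <- : X (p + h) = 0 by rewrite Xq -eq mulKf ?subrr// gt_eqF.
    apply: (ge0_derive_le (df := dX) t2).
    - by apply: continuous_subspaceW cX; apply: subset_itvr; rewrite bnd_simp.
    - by move=> x /andP[x1 x2]; apply: DX; rewrite x2 (le_lt_trans t1).
    - by move=> x /andP[x1 x2]; have [] := pw x _; rewrite ?x2 ?(le_lt_trans t1).
  apply: (ge0_derive_le (df := dX) t1).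
  - by apply: continuous_subspaceW cX; apply: subset_itvl; rewrite bnd_simp.
  - by move=> x /andP[x1 x2]; apply: DX; rewrite x1 (lt_le_trans x2).
  - by move=> x /andP[x1 x2]; have [] := pw x _; rewrite ?x1 ?(lt_le_trans x2).
have st : p < t0 + e * s < p + h.
  by case: et s0h => -[-> ->] /andP[s1 s2]; apply/andP; split; clear -s1 s2; lra.
have phs : ph (t0 + e * s) = s by rewrite /ph addrAC subrr add0r mulrA ee mul1r.
have dX0 : dX (t0 + e * s) = 0.
  have n0 : \forall x \near t0 + e * s, X x = (cst 0 : R -> R) x.
    have /andP[s1 s2] := st.
    near=> x; apply: X0; apply/andP; split; apply/ltW; near: x; [exact: lt_nbhsr|exact: lt_nbhsl].
  have d := near_eq_is_derive n0 (DX _ st).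
  by have := @derive_val _ _ _ _ _ _ _ d; rewrite derive_cst.
have := (pw _ st).2 dX0; rewrite phs => /eqP; rewrite eqrXn2 ?ltW ?u0 ?cpos//; last 2 first.
- by case/andP: s0h => s1 _; exact: ltW.
- by case/andP: s0h => _ s1; exact: ltW.
by move=> /eqP ->; rewrite /u mulKf ?gt_eqF.
Unshelve. all: by end_near. Qed.

End Kite.

(** * Convexity of the reciprocal gain *)

Section Excess.
Variable R : realType.
Implicit Types (a b c d h k m p r s t x y e T : R) (N : plane R -> R).

Let q x : R := sin x - x * cos x.
Let p x : R := x - sin x * cos x.

Lemma is_derive_q x : is_derive x 1 q (x * sin x).
Proof. by apply: is_derive_eq; rewrite /GRing.scale /=; ring. Qed.

Lemma is_derive_p x : is_derive x 1 p (2 * sin x ^+ 2).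
Proof.
have e := cos2Dsin2 x.
apply: is_derive_eq; rewrite /GRing.scale /=.
transitivity (1 + sin x ^+ 2 - cos x ^+ 2); first by ring.
by rewrite -{1}e; ring.
Qed.

Lemma q_gt0 x : 0 < x -> x <= pi / 2 -> 0 < q x.
Proof.
move=> x0 xp; have pi0 := pi_gt0 R; rewrite /q.
move: xp; rewrite le_eqVlt => /orP[/eqP ->|xp]; last by rewrite subr_gt0; exact: tan_gt_id.
by rewrite cos_pihalf sin_pihalf mulr0 subr0.
Qed.

Lemma sin_lt_id x : 0 < x -> x <= pi / 2 -> sin x < x.
Proof.
move=> x0 xp; have pi0 := pi_gt0 R.
have D y : is_derive y 1 (fun y => y - sin y) (1 - cos y).
  by apply: is_derive_eq; rewrite /GRing.scale /=; ring.
have cf : {within `[0, x], continuous (fun y => y - sin y)}.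
  by apply: continuous_subspaceT => y; exact: is_derive_continuous (D y).
have [y] := MVT x0 (fun x _ => D x) cf; rewrite in_itv /= => /andP[y0 yx].
rewrite sin0 !subr0 => e; rewrite -subr_gt0 e mulr_gt0// subr_gt0 -cos0.
by apply: lt_cos => //; lra.
Qed.

Lemma p_gt0 x : 0 < x -> x <= pi / 2 -> 0 < p x.
Proof.
move=> x0 xp; rewrite subr_gt0; apply: le_lt_trans (sin_lt_id x0 xp).
have pi0 := pi_gt0 R.
by rewrite ger_pMr ?cos_le1// sin_gt0_pi// x0; lra.
Qed.

(** This is [(1 - x / tan x)^-1] without [tan], so that it extends smoothly to [pi / 2], where its
    value is 1. *)
Let g x : R := sin x / q x.
Let dg x : R := - (p x / q x ^+ 2).
Let ddg x : R := 2 * sin x * (x ^+ 2 - sin x ^+ 2) / q x ^+ 3.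

Lemma is_derive_g x : 0 < x -> x <= pi / 2 -> is_derive x 1 g (dg x).
Proof.
move=> x0 xp; have q0 : q x != 0 by rewrite gt_eqF// q_gt0.
have d := is_deriveM (is_derive_sin x) (is_deriveV q0 (is_derive_q x)).
apply: (is_derive_eq d); rewrite /dg /p /GRing.scale /=; move: q0; rewrite /q => q0.
have e := cos2Dsin2 x.
transitivity (- (x * (cos x ^+ 2 + sin x ^+ 2) - sin x * cos x) / (sin x - x * cos x) ^+ 2).
  by field.
by rewrite e mulr1 mulNr.
Qed.

Lemma is_derive_dg x : 0 < x -> x <= pi / 2 -> is_derive x 1 dg (ddg x).
Proof.
move=> x0 xp; have q0 : q x != 0 by rewrite gt_eqF// q_gt0.
have q20 : q x ^+ 2 != 0 by rewrite expf_neq0.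
have d2 : is_derive x 1 (fun y => q y ^+ 2) (2 * q x * (x * sin x)).
  have d := is_deriveX 2 (is_derive_q x); apply: (is_derive_eq d).
  by rewrite /GRing.scale /= expr1.
have d := is_deriveN (is_deriveM (is_derive_p x) (is_deriveV (f := fun y => q y ^+ 2) q20 d2)).
apply: (is_derive_eq d); rewrite /ddg /GRing.scale /=.
have e : sin x ^+ 2 = 1 - cos x ^+ 2 by rewrite -(cos2Dsin2 x); ring.
transitivity (2 * sin x * (x * p x - sin x * q x) / q x ^+ 3); first by field.
congr (_ * _ / _); rewrite /p /q.
by ring.
Qed.

(** Strict convexity of [g]: the sign of its second derivative is that of [x ^+ 2 - sin x ^+ 2]. *)
Lemma dg_lt x y : 0 < x -> x < y -> y <= pi / 2 -> dg x < dg y.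
Proof.
move=> x0 xy yp; have pi0 := pi_gt0 R.
have D t : t \in `]x, y[ -> is_derive t 1 dg (ddg t).
  by rewrite in_itv /= => /andP[t1 t2]; apply: is_derive_dg; lra.
have cf : {within `[x, y], continuous dg}.
  apply: continuous_in_subspaceT => t; rewrite inE /= in_itv /= => /andP[t1 t2].
  have t0 : 0 < t by lra. have tp : t <= pi / 2 by lra.
  exact: is_derive_continuous (is_derive_dg t0 tp).
have [t] := MVT xy D cf; rewrite in_itv /= => /andP[t1 t2] e.
have t0 : 0 < t by lra. have tp : t <= pi / 2 by lra.
have s0 : 0 < sin t by apply: sin_gt0_pi; rewrite t0; lra.
rewrite -subr_gt0 e mulr_gt0 ?subr_gt0// /ddg divr_gt0 ?exprn_gt0 ?q_gt0//.
rewrite mulr_gt0 ?mulr_gt0// subr_gt0 ltr_pXn2r ?nnegrE ?ltW//; exact: sin_lt_id.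
Qed.

Lemma g_tangent x y : 0 < x -> x <= pi / 2 -> 0 < y -> y <= pi / 2 ->
  g x + dg x * (y - x) <= g y /\ (g x + dg x * (y - x) = g y -> y = x).
Proof.
move=> x0 xp y0 yp.
have key a b : 0 < a -> a < b -> b <= pi / 2 -> exists2 c, a < c < b & g b - g a = dg c * (b - a).
  move=> a0 ab bp.
  have D t : t \in `]a, b[ -> is_derive t 1 g (dg t).
    by rewrite in_itv /= => /andP[t1 t2]; apply: is_derive_g; lra.
  have cf : {within `[a, b], continuous g}.
    apply: continuous_in_subspaceT => t; rewrite inE /= in_itv /= => /andP[t1 t2].
    have t0 : 0 < t by lra. have tp : t <= pi / 2 by lra.
    exact: is_derive_continuous (is_derive_g t0 tp).
  by have [c] := MVT ab D cf; rewrite in_itv /= => cab e; exists c.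
have strict : x != y -> g x + dg x * (y - x) < g y.
  move=> ne; rewrite -ltrBrDl; have [xy|yx|xy] := ltgtP x y; last by rewrite xy eqxx in ne.
    have [c /andP[c1 c2] ->] := key x y x0 xy yp.
    by rewrite ltr_pM2r ?subr_gt0// dg_lt// (le_trans (ltW c2)).
  have [c /andP[c1 c2] e] := key y x y0 yx xp.
  rewrite -(opprB x y) mulrN ltrNl opprB e ltr_pM2r ?subr_gt0// dg_lt//; exact: lt_trans c1.
have [->|ne] := eqVneq x y; first by rewrite subrr mulr0 addr0.
split; first exact/ltW/strict.
by move=> e; have := strict ne; rewrite e ltxx.
Qed.

(* The reciprocal of the largest fraction of the area over an arc of half-angle
   [h] that can be gained. *)
Definition gain h : R := if h < pi / 2 then (1 - h / tan h)^-1 else 1.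

Lemma gain_gE h : 0 < h -> h < pi / 2 -> gain h = g h.
Proof.
move=> h0 hp; rewrite /gain hp /g; have := q_gt0 h0 (ltW hp); rewrite /q => q0.
have s0 : 0 < sin h by rewrite sin_gt0_pihalf// h0.
have c0 : 0 < cos h by rewrite cos_gt0_pihalf// (lt_trans _ h0)//= oppr_lt0 divr_gt0 ?pi_gt0.
by rewrite /tan; field; rewrite !gt_eqF.
Qed.

Lemma gain_gt0 h : 0 < h -> 0 < gain h.
Proof.
move=> h0; have [hp|hp] := ltP h (pi / 2); last by rewrite /gain (ltNge h) hp.
rewrite gain_gE// /g divr_gt0 ?q_gt0 ?(ltW hp)//.
by rewrite sin_gt0_pihalf// h0.
Qed.

Lemma gain_tangent t : 0 < t -> t < pi / 2 -> exists k, forall h, 0 < h ->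
  gain t + k * (h - t) <= gain h /\ (gain t + k * (h - t) = gain h -> h = t).
Proof.
move=> t0 tp; exists (dg t) => h h0; rewrite gain_gE//.
have pi0 := pi_gt0 R.
have [hp|hp] := ltP h (pi / 2).
  by rewrite gain_gE//; apply: g_tangent => //; exact: ltW.
have pp0 : 0 < pi / 2 :> R by rewrite divr_gt0.
have [h1 h2] := g_tangent t0 (ltW tp) pp0 (lexx _).
have gp : g (pi / 2) = gain h.
  by rewrite /gain ltNge hp /g /q cos_pihalf sin_pihalf mulr0 subr0 divr1.
(* From [pi / 2] on the gain stays 1 while the tangent line keeps falling. *)
have d0 : dg t < 0 by rewrite oppr_lt0 divr_gt0 ?p_gt0 ?exprn_gt0 ?q_gt0// ltW.
have h3 : g t + dg t * (pi / 2 - t) < gain h.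
  rewrite lt_neqAle -gp h1 andbT; apply/eqP => /h2 e; by rewrite e ltxx in tp.
have h4 : dg t * (h - t) <= dg t * (pi / 2 - t) by rewrite ler_nM2l// lerD2r.
have h5 : g t + dg t * (h - t) < gain h by apply: le_lt_trans h3; rewrite lerD2l.
by split; [exact: ltW|move=> e; move: h5; rewrite e ltxx].
Qed.

End Excess.

(** * The gap over a whole arc *)

Section ArcGap.
Variable R : realType.
Implicit Types (a b c d h k m p r s t x y e T : R) (N : plane R -> R).

(** Both halves use the same radius, the larger one, which [half_kite] admits. From [pi / 2] on the
    gain is 1 and the bound only says that the disc part has nonnegative area. *)
Lemma arc_gap_le N a b : gauge N -> critical N a -> critical N b -> a < b -> b < a + 2 * pi ->
  let r := arc_radius N a b in let h := (b - a) / 2 in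
  gain h * arc_gap N r a b <= sarea N a b /\
  (h < pi / 2 -> gain h * arc_gap N r a b = sarea N a b -> forall s, 0 < s < h ->
    N (uvec (a + s)) = r^-1 * cos s /\ N (uvec (b - s)) = r^-1 * cos s).
Proof.
move=> hN ca cb ab ba r h; have pi0 := pi_gt0 R.
have h0 : 0 < h by rewrite divr_gt0// subr_gt0.
have rb : radius N b <= r by rewrite /r /arc_radius le_max lexx orbT.
have ra : radius N a <= r by rewrite /r /arc_radius le_max lexx.
have r0 : 0 < r by apply: lt_le_trans ra; exact: radius_gt0.
have hD := gauge_disc_cut hN r0.
have D0 : 0 <= sarea (disc_cut N r) a b by apply: sarea_ge0 => //; exact: ltW.
have [hp|hp] := ltP h (pi / 2); last first.
  by rewrite /gain ltNge hp /= mul1r /arc_gap gerBl; split.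
have [k1 k1'] := half_kite hN ca h0 hp (or_introl (conj erefl erefl)) ra.
have mh : (a + h) + h = b by rewrite /h; field.
have [k2 k2'] := half_kite (p := a + h) hN cb h0 hp (or_intror (conj erefl (esym mh))) rb.
have le1 : a <= a + h by rewrite lerDl ltW.
have le2 : a + h <= b by rewrite -mh lerDl ltW.
have eN := sarea_cat hN le1 le2 (ltW ba); have eD := sarea_cat hD le1 le2 (ltW ba).
rewrite mh in k2 k2'; set m := h / tan h in k1 k1' k2 k2'.
have gE : gain h = (1 - m)^-1 by rewrite /gain hp.
have m1 : 0 < 1 - m by rewrite -invr_gt0 -gE gain_gt0.
rewrite gE /arc_gap eN eD; move: k1 k2 k1' k2'.
move: (sarea N a _) (sarea N _ b) (sarea (disc_cut N r) a _) (sarea (disc_cut N r) _ b).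
move=> A B C D k1 k2 k1' k2'; split.
  by rewrite mulrC ler_pdivrMr//; clear -k1 k2; lra.
move=> _ e; have {}e : A + B - (C + D) = (A + B) * (1 - m).
  by rewrite -[X in _ = X * _]e mulrAC mulVf ?mul1r// gt_eqF.
have e1 : m * A = C by clear -k1 k2 e; lra.
have e2 : m * B = D by clear -k1 k2 e; lra.
move=> s sh; split; first by rewrite -(k1' e1 s sh) mul1r.
by rewrite -(k2' e2 s sh) mulN1r.
Qed.

End ArcGap.

(** * Enumerating the stable angles *)

Section Enumeration.
Variable R : realType.
Implicit Types (a b c d h k m p r s t x y e T : R) (N : plane R -> R).

Lemma stable_angle_eq N s t : uvec s = uvec t -> stable_angle N s -> stable_angle N t.
Proof. by move=> e; rewrite /stable_angle /bdpt e. Qed.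

Lemma sorted_enum (A : set R) n : (A #= `I_n)%card -> exists s : seq R,
  [/\ size s = n, sorted <%R s & forall x, A x <-> x \in s].
Proof.
move=> An; have fA : finite_set A by exists n.
have h1 : (size (finmap.enum_fset (fset_set A)) <= n)%N.
  by apply: geq_card_fset_set; rewrite (card_le_eql An).
have h2 : (n <= size (finmap.enum_fset (fset_set A)))%N.
  by apply: leq_card_fset_set => //; rewrite (card_le_eqr An).
exists (sort <=%R (finmap.enum_fset (fset_set A))); split.
- by rewrite size_sort; apply/eqP; rewrite eqn_leq h1.
- by rewrite sort_lt_sorted finmap.fset_uniq.
- by move=> x; rewrite mem_sort in_fset_set//; split; rewrite inE.
Qed.

(** An infinite sequence that gains a full turn every [n] steps gives each stable angle a successor
    without a special case at the end of a turn. *)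
Lemma stable_enum N n : gauge N -> (0 < n)%N -> (stable_points (body N) 0 #= `I_n)%card ->
  exists t : nat -> R, [/\ forall i, stable_angle N (t i), forall i, t i < t i.+1,
    forall i x, t i < x < t i.+1 -> ~ stable_angle N x & forall i, t (i + n)%N = t i + 2 * pi].
Proof.
move=> hN n0 fin; have pi0 := pi_gt0 R.
pose A := [set t : R | 0 <= t < 2 * pi /\ stable_angle N t].
have AE : bdpt N @` A = stable_points (body N) 0.
  apply/seteqP; split=> [_ [t [_ st] <-]//|q st].
  have [t [ht qE]] := bd_polar 0 hN st.1.1; exists t => //; split; first by rewrite add0r in ht.
  by rewrite /stable_angle -qE.
have Ainj : {in A &, injective (bdpt N)}.
  move=> s t /set_mem[hs _] /set_mem[ht _] /bdpt_eq /(_ hN).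
  by apply: (@uvec_inj _ 0); rewrite add0r.
have An : (A #= `I_n)%card.
  by apply: card_eq_trans fin; rewrite -AE card_eq_sym; exact: inj_card_eq.
have [s [ss so sm]] := sorted_enum An.
have sA i : (i < n)%N -> A (s`_i) by move=> ii; apply/sm; rewrite mem_nth// ss.
have slt i j : (i < n)%N -> (j < n)%N -> (s`_i < s`_j) = (i < j)%N.
  by move=> ii jj; rewrite lt_sorted_ltn_nth ?inE ?ss.
pose t i : R := s`_(i %% n) + 2 * pi * (i %/ n)%:R.
have modlt i : (i %% n < n)%N by rewrite ltn_mod.
have next i : (i.+1 %% n = (i %% n).+1 /\ i.+1 %/ n = i %/ n)%N \/
    ((i %% n).+1 = n /\ (i.+1 %% n = 0)%N /\ i.+1 %/ n = (i %/ n).+1)%N.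
  have eS : (i.+1 = i %/ n * n + (i %% n).+1)%N by rewrite addnS -divn_eq.
  have := modlt i; rewrite leq_eqVlt => /orP[/eqP en|lt]; [right|left].
    by split=> //; rewrite eS en modnMDl divnMDl// modnn divnn n0 addn1.
  by rewrite eS modnMDl divnMDl// (modn_small lt) (divn_small lt) addn0.
have tE i : t i.+1 = s`_(i %% n).+1 + 2 * pi * (i %/ n)%:R /\ ((i %% n).+1 < n)%N \/
    t i.+1 = s`_0 + 2 * pi + 2 * pi * (i %/ n)%:R /\ ((i %% n).+1 = n)%N.
  have [[e1 e2]|[e0 [e1 e2]]] := next i; [left|right]; rewrite /t e1 e2.
    by rewrite -e1.
  by rewrite -[(_.+1)%:R]natr1; split=> //; ring.
exists t; split=> [i|i|i x|i].
- have [_ st] := sA _ (modlt i); apply: stable_angle_eq st.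
  by have := uvec_period (s`_(i %% n)) (i %/ n)%N; rewrite /t => <-.
- have [[-> lt]|[-> _]] := tE i; first by rewrite /t ltrD2r slt.
  have [/andP[_ h1] _] := sA _ (modlt i); have [/andP[h2 _] _] := sA _ n0.
  by rewrite /t ltrD2r; clear -h1 h2; lra.
- move=> tx st; have [k hk] := angle_shift 0 x; rewrite add0r in hk.
  set y := x + _ in hk.
  have /sm/(nthP 0)[j] : A y.
    by split=> //; apply: stable_angle_eq st; rewrite uvec_period.
  rewrite ss => jn yE.
  have [/andP[a1 a2] _] := sA _ (modlt i); have [/andP[b1 b2] _] := sA _ n0.
  have xE : x = y + 2 * pi * (- k)%:~R by rewrite /y mulrNz; ring.
  have [/andP[c1 c2] _] := sA _ jn.
  (* The number of turns between the listed representative of [x] and the period of [t i]. A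
     negative value puts [x] below [t i], 0 and 1 contradict the order of the list, and larger
     values overshoot [t i.+1]. *)
  pose l : int := - k - (i %/ n)%N%:Z.
  have xE2 : x = s`_j + 2 * pi * l%:~R + 2 * pi * (i %/ n)%:R.
    by rewrite xE -yE /l rmorphB /=; ring.
  have low : s`_(i %% n) < s`_j + 2 * pi * l%:~R.
    by move: tx; rewrite xE2 {1}/t ltrD2r => /andP[].
  have l0 : 0 <= l.
    rewrite leNgt; apply/negP => ln; have l1 : l%:~R <= -1 :> R by rewrite (ler_int R l (-1)) -ltzD1 addNr.
    have : 2 * pi * l%:~R <= 2 * pi * -1 :> R by rewrite ler_pM2l// mulr_gt0.
    by clear -low a1 c2; lra.
  case: l l0 xE2 low => [] // [|[|l]] _ xE2 low.
  + rewrite mulr0 addr0 in xE2 low; have ij : (i %% n < j)%N by rewrite -slt.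
    have [[e2 lt2]|[e2 en]] := tE i.
      have : s`_j < s`_(i %% n).+1 by case/andP: tx => _; rewrite xE2 e2 ltrD2r.
      by rewrite slt// ltnS leqNgt ij.
    by move: jn; rewrite -en ltnS leqNgt ij.
  + have [[e2 lt2]|[e2 en]] := tE i.
      have [/andP[_ d2] _] := sA _ lt2.
      have : s`_j + 2 * pi * 1%:~R < s`_(i %% n).+1 by case/andP: tx => _; rewrite xE2 e2 ltrD2r.
      by clear -c1 d2; lra.
    have : s`_j + 2 * pi * 1%:~R < s`_0 + 2 * pi by case/andP: tx => _; rewrite xE2 e2 ltrD2r.
    by rewrite mulr1 ltrD2r slt.
  + have up : t i.+1 <= 4 * pi + 2 * pi * (i %/ n)%:R.
      have [[-> lt2]|[-> en]] := tE i; rewrite lerD2r; last by clear -b2; lra.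
      by have [/andP[_ d2] _] := sA _ lt2; clear -d2 pi0; lra.
    have : s`_j + 2 * pi * l.+2%:~R < 4 * pi.
      by move: tx; rewrite xE2 => /andP[_ /lt_le_trans/(_ up)]; rewrite ltrD2r.
    have : 2 * pi * 2 <= 2 * pi * l.+2%:~R :> R.
      by rewrite ler_pM2l ?mulr_gt0//; rewrite -[l.+2%:~R]/(l.+2%:R) ler_nat.
    by move: (_ * l.+2%:~R) => z; clear -c1; lra.
- by rewrite /t modnDr divnDr ?dvdnn// divnn n0 natrD mulrDr mulr1 addrA.
Qed.

End Enumeration.

(** * Averaging over the arcs *)

Section Averaging.
Variable R : realType.
Implicit Types (a b c d h k m p r s t x y e T : R) (N : plane R -> R).

Lemma sarea_sum N (t : nat -> R) n : gauge N -> (forall i, t i <= t i.+1) ->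
  t n <= t 0%N + 2 * pi -> sarea N (t 0%N) (t n) = \sum_(i < n) sarea N (t i) (t i.+1).
Proof.
move=> hN tt; elim: n => [|n IH] tn; first by rewrite big_ord0 sarea_id.
have t0n : t 0%N <= t n by elim: n {IH tn} => // n IH; exact: le_trans IH (tt n).
rewrite big_ord_recr /= (@sarea_cat _ _ _ (t n))// IH//; exact: le_trans (tt n) tn.
Qed.

Lemma sum_eq_of_le n (f g : 'I_n -> R) : (forall i, f i <= g i) ->
  \sum_i g i <= \sum_i f i -> forall i, f i = g i.
Proof.
move=> fg gf i.
have : \sum_j (g j - f j) == 0.
  by rewrite eq_le sumr_ge0 ?andbT => [|j _]; rewrite ?sumrB ?subr_le0// subr_ge0.
rewrite psumr_eq0 => [/allP/(_ i (mem_index_enum i))|j _]; last by rewrite subr_ge0.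
by rewrite /= subr_eq0 => /eqP.
Qed.

(** If all gaps are at least [c * A], then [T i >= c * A * gain (h i)], and the tangent line bounds
    this below by terms whose sum is already [A]. So every inequality used is an equality. *)
Lemma gain_average n (h C T : 'I_n -> R) (A c : R) : (2 < n)%N -> 0 < A ->
  c = (n%:R * gain (pi / n%:R))^-1 ->
  (forall i, 0 < h i) -> \sum_i h i = pi -> (forall i, gain (h i) * C i <= T i) -> \sum_i T i = A ->
  (forall i, c * A <= C i) ->
  forall i, [/\ h i = pi / n%:R, gain (h i) * C i = T i & C i = c * A].
Proof.
move=> n2 A0 ce h0 hs gC TA hC; have pi0 := pi_gt0 R.
have n0 : 0 < n%:R :> R by rewrite ltr0n (ltn_trans _ n2).
set t := pi / n%:R in ce *; have t0 : 0 < t by rewrite divr_gt0.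
have tp : t < pi / 2 by rewrite ltr_pM2l// ltf_pV2 ?posrE// ltr_nat.
have [k hk] := gain_tangent t0 tp.
have gt0 := gain_gt0 t0.
have c0 : 0 < c by rewrite ce invr_gt0 mulr_gt0.
pose f i := c * A * (gain t + k * (h i - t)).
have cA0 : 0 < c * A by rewrite mulr_gt0.
have f1 i : f i <= c * A * gain (h i) by rewrite ler_pM2l//; case: (hk (h i) (h0 i)).
have f2 i : c * A * gain (h i) <= gain (h i) * C i by rewrite mulrC ler_pM2l ?gain_gt0.
have fT i : f i <= T i by apply: le_trans (f1 i) (le_trans (f2 i) (gC i)).
have fs : \sum_i f i = A.
  rewrite -mulr_sumr big_split /= sumr_const card_ord -mulr_sumr sumrB hs sumr_const card_ord.
  have -> : t *+ n = pi by rewrite -mulr_natr divfK// gt_eqF.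
  rewrite subrr mulr0 addr0 ce -[gain t *+ n]mulr_natl mulrAC mulVf ?mul1r//.
  by rewrite gt_eqF// mulr_gt0.
move=> i; have fE : f i = T i by apply: sum_eq_of_le => //; rewrite fs TA.
have e1 : f i = c * A * gain (h i).
  by apply/eqP; rewrite eq_le f1 /= fE (le_trans (f2 i)).
have e2 : gain (h i) * C i = T i.
  by apply/eqP; rewrite eq_le gC /= -fE e1 f2.
split=> //.
- have [_ h2] := hk (h i) (h0 i); apply: h2.
  by apply: (mulfI (_ : c * A != 0)); [rewrite gt_eqF|rewrite -e1].
- apply: (mulfI (_ : gain (h i) != 0)); first by rewrite gt_eqF// gain_gt0.
  by rewrite e2 -fE e1 mulrC.
Qed.

Lemma continuous_eq0_itv (f : R -> R) h : continuous f -> 0 < h ->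
  (forall s, 0 < s < h -> f s = 0) -> forall s, 0 <= s <= h -> f s = 0.
Proof.
move=> cf h0 fz s /andP[s0 sh].
(* The segment from [s] to the midpoint runs inside the open interval. *)
pose g (x : R) := f (s + x * (h / 2 - s)).
have cg : g x @[x --> 0^'+] --> f s.
  have -> : f s = g 0 by rewrite /g mul0r addr0.
  apply: cvg_at_right_filter; apply: (@continuous_comp _ _ _ (fun x => s + x * (h / 2 - s)) f); last exact: cf.
  by apply: cvgD; [exact: cvg_cst|apply: cvgM; [exact: cvg_id|exact: cvg_cst]].
have c0 : g x @[x --> 0^'+] --> (0 : R).
  apply: (@cvg_trans _ ((cst 0 : R -> R) x @[x --> (0 : R)^'+])); last exact: cvg_cst.
  apply: near_eq_cvg; near=> x.
  have x0 : 0 < x by near: x; exact: nbhs_right_gt.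
  have x1 : x < 1 by near: x; exact: nbhs_right_lt.
  rewrite /g fz//; have p1 : 0 <= s * (1 - x) by rewrite mulr_ge0// subr_ge0 ltW.
  have p2 : 0 <= (h - s) * (1 - x) by apply: mulr_ge0; rewrite subr_ge0 // ltW.
  have p3 : 0 < x * h by rewrite mulr_gt0.
  by apply/andP; split; lra.
exact: (cvg_unique _ cg c0).
Unshelve. all: by end_near. Qed.

End Averaging.

(** * Regular polygons: gauge, half-planes and convex hull *)

Section Polygon.
Variable R : realType.
Implicit Types (a b c d h m p r s t x y e T : R) (z w q v : plane R) (N : plane R -> R).
Implicit Types (i j k n : nat).

Definition normal n t0 k : R := t0 + k%:R * (2 * (pi / n%:R)).

(* The constraints recur modulo [n]. *)
Definition polygon n r t0 : set (plane R) :=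
  [set z | forall k, dot z (uvec (normal n t0 k)) <= r].

Lemma natdiv_gt0 n : (0 < n)%N -> 0 < pi / n%:R :> R.
Proof. by move=> n0; rewrite divr_gt0 ?pi_gt0// ltr0n. Qed.

Lemma natdiv_lt n : (2 < n)%N -> pi / n%:R < pi / 2 :> R.
Proof.
by move=> n2; rewrite ltr_pM2l ?pi_gt0// ltf_pV2 ?posrE// ?ltr_nat// ltr0n (ltn_trans _ n2).
Qed.

Lemma cos_small_gt0 n s : (2 < n)%N -> `|s| <= pi / n%:R -> 0 < cos s.
Proof.
move=> n2 h; have := le_lt_trans h (natdiv_lt n2); rewrite ltr_norml => /andP[s1 s2].
by apply: cos_gt0_pihalf; rewrite s1.
Qed.

Lemma normalD n t0 j k : normal n t0 (j + k) = normal n t0 j + k%:R * (2 * (pi / n%:R)).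
Proof. by rewrite /normal natrD mulrDl addrA. Qed.

Lemma full_turn n i : (0 < n)%N -> (i * n)%N%:R * (2 * (pi / n%:R)) = 2 * pi * (i : int)%:~R :> R.
Proof.
move=> n0; have nn : n%:R != 0 :> R by rewrite pnatr_eq0 -lt0n.
by rewrite natrM; field.
Qed.

(** After reducing [l] modulo [n] the difference is twice a product of two sines of angles in
    [[0, pi]]. Hence the binding constraint of the polygon is that of the nearest normal. *)
Lemma cos_step n (l : nat) s : (0 < n)%N -> `|s| <= pi / n%:R ->
  cos (s + l%:R * (2 * (pi / n%:R))) <= cos s.
Proof.
move=> n0; have t0 := natdiv_gt0 n0; have pi0 := pi_gt0 R; set t := pi / n%:R in t0 *.
rewrite ler_norml => /andP[s1 s2].
rewrite (divn_eq l n) natrD mulrDl addrCA addrC.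
have -> : (l %/ n * n)%N%:R * (2 * t) = 2 * pi * (l %/ n)%N%:Z%:~R by rewrite full_turn.
have -> x (i : int) : cos (x + 2 * pi * i%:~R) = cos x :> R.
  by have /= := congr1 fst (uvec_period x i).
have nt : n%:R * t = pi by rewrite /t mulrC divfK// pnatr_eq0 -lt0n.
case: (posnP (l %% n)) => [->|j0]; first by rewrite mul0r addr0.
have := ltn_pmod l n0; move: (l %% n)%N j0 => j j0 jn.
have j1 : t <= j%:R * t by rewrite ler_peMl ?(ltW t0)// ler1n.
have j2 : j%:R * t + t <= pi by rewrite -nt -[X in _ + X]mul1r -mulrDl natr1 ler_wpM2r ?(ltW t0)// ler_nat.
set x := j%:R * t in j1 j2.
have -> : s + j%:R * (2 * t) = (s + x) + x by rewrite /x; ring.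
rewrite -subr_ge0 -{1}(addrK x s).
have -> : cos (s + x - x) - cos (s + x + x) = 2 * (sin (s + x) * sin x).
  by move: (s + x) => y; rewrite cosB cosD; ring.
rewrite mulr_ge0// mulr_ge0// sin_ge0_pi//; apply/andP; split; lra.
Qed.

Lemma dot_normal_le n t0 j k s : (0 < n)%N -> `|s| <= pi / n%:R ->
  dot (uvec (normal n t0 k + s)) (uvec (normal n t0 j)) <= cos s.
Proof.
(* Modulo [n], the natural number [k + n.-1 * j] stands for [k - j]. *)
move=> n0 hs; apply: le_trans (cos_step (k + n.-1 * j) n0 hs).
rewrite dot_uvec -cosN le_eqVlt; apply/orP; left; apply/eqP.
have -> : - (normal n t0 j - (normal n t0 k + s)) =
    (s + (k + n.-1 * j)%N%:R * (2 * (pi / n%:R))) + 2 * pi * (- j%:Z)%:~R.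
  rewrite mulrNz mulrN -(full_turn j n0) /normal natrD.
  have -> : (j * n)%N%:R = (n.-1 * j)%N%:R + j%:R :> R by rewrite -natrD -mulSnr prednK// mulnC.
  by ring.
by have /= := congr1 fst (uvec_period (s + (k + n.-1 * j)%N%:R * (2 * (pi / n%:R))) (- j%:Z)).
Qed.

Lemma angle_sector n t0 t : (0 < n)%N -> exists k s,
  uvec t = uvec (normal n t0 k + s) /\ `|s| <= pi / n%:R.
Proof.
move=> n0; have th0 := natdiv_gt0 n0; set th := pi / n%:R in th0 *.
have [l] := angle_shift (t0 - th) t; set y := t + _ => /andP[y1 y2].
have yge : 0 <= (y - (t0 - th)) / (2 * th) by rewrite divr_ge0 ?subr_ge0// mulr_ge0// ltW.
have /andP[] := truncn_itv yge; set k := Num.trunc _.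
have th2 : 0 < 2 * th by rewrite mulr_gt0.
rewrite ler_pdivlMr// ltr_pdivrMr// -[k.+1%:R]natr1 mulrDl mul1r => k1 k2.
exists k, (y - normal n t0 k); rewrite addrC subrK uvec_period; split=> //.
by rewrite /normal -/th ler_norml; apply/andP; split; lra.
Qed.

Lemma body_polygon N n r t0 : gauge N -> (2 < n)%N -> 0 < r ->
  (forall k s, `|s| <= pi / n%:R -> N (uvec (normal n t0 k + s)) = r^-1 * cos s) ->
  body N = polygon n r t0.
Proof.
move=> hN n2 r0 h; have n0 : (0 < n)%N by exact: ltn_trans n2.
apply/seteqP; split=> z; rewrite /body /polygon /=.
  move=> Nz j; have [->|z0] := eqVneq z 0; first by rewrite -(scale0r (0 : plane R)) dotZl mul0r ltW.
  have [t [_ zE]] := polar_decomp 0 z0; have [k [s [ts hs]]] := angle_sector t0 t n0.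
  move: Nz; rewrite zE ts gaugeZ ?enorm_ge0// h// mulrCA mulrC ler_pdivrMr// mul1r dotZl.
  by apply: le_trans; rewrite ler_wpM2l ?enorm_ge0// dot_normal_le.
move=> hz; have [->|z0] := eqVneq z 0; first by rewrite gauge0.
have [t [_ zE]] := polar_decomp 0 z0; have [k [s [ts hs]]] := angle_sector t0 t n0.
rewrite zE ts gaugeZ ?enorm_ge0// h// mulrCA mulrC ler_pdivrMr// mul1r.
by have := hz k; rewrite {1}zE ts dotZl dot_uvec opprD addrA subrr add0r cosN.
Qed.

Lemma polygon_gauge N n r t0 : gauge N -> (2 < n)%N -> 0 < r -> body N = polygon n r t0 ->
  forall k s, `|s| <= pi / n%:R -> N (uvec (normal n t0 k + s)) = r^-1 * cos s.
Proof.
move=> hN n2 r0 bN k s hs; have n0 : (0 < n)%N by exact: ltn_trans n2.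
have c0 := cos_small_gt0 n2 hs; set u := uvec _.
have Nu : 0 < N u by exact: gauge_uvec_gt0.
have du : dot u (uvec (normal n t0 k)) = cos s.
  by rewrite dot_uvec opprD addrA subrr add0r cosN.
apply/eqP; rewrite eq_le; apply/andP; split.
  have : body N ((r / cos s) *: u).
    rewrite bN => j; rewrite dotZl mulrAC ler_pdivrMr// ler_pM2l//; exact: dot_normal_le.
  rewrite /body /= gaugeZ//; last by rewrite divr_ge0// ltW.
  by rewrite mulrAC ler_pdivrMr// mul1r mulrC -ler_pdivlMr// mulrC.
have : body N ((N u)^-1 *: u).
  by rewrite /body /= gaugeZ ?invr_ge0 ?(ltW Nu)// mulVf// gt_eqF.
by rewrite bN => /(_ k); rewrite dotZl du ler_pdivrMl// => h; rewrite ler_pdivrMl// mulrC.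
Qed.

Lemma convex_comb (M : set (plane R)) z w l : @convex_set R (plane R) M -> M z -> M w ->
  0 <= l <= 1 -> M (l *: z + (1 - l) *: w).
Proof.
move=> cM Mz Mw hl.
have := cM z w (Itv01 (proj1 (andP hl)) (proj2 (andP hl))) (mem_set Mz) (mem_set Mw).
by rewrite inE.
Qed.

Lemma chord_point r m d s : cos s != 0 -> sin d != 0 ->
  (r * cos d / cos s) *: uvec (m + s) =
  (sin (d - s) / (2 * sin d * cos s)) *: (r *: uvec (m - d)) +
  (sin (d + s) / (2 * sin d * cos s)) *: (r *: uvec (m + d)).
Proof.
move=> cs sd; apply: injective_projections;
  rewrite /= /GRing.scale /= ?cosD ?sinD ?cosN ?sinN; field; exact/andP.
Qed.

(* The summand 0 is the center in [regular_polygon n 0]. *)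
Lemma hull_polygon n r a : (2 < n)%N -> 0 < r ->
  convex_hull [set (0 + (r * cos (a + 2 * pi * k%:R / n%:R),
    r * sin (a + 2 * pi * k%:R / n%:R)) : plane R) | k in `I_n] =
  polygon n (r * cos (pi / n%:R)) (a + pi / n%:R).
Proof.
move=> n2 r0; have n0 : (0 < n)%N by exact: ltn_trans n2.
have t0 := natdiv_gt0 n0; have pi0 := pi_gt0 R; have tp := natdiv_lt n2.
set th := pi / n%:R in t0 tp *; set V := [set _ | _ in _].
have sth : 0 < sin th by rewrite sin_gt0_pihalf// t0.
have cth : 0 < cos th by apply: cos_gt0_pihalf; rewrite tp (lt_trans _ t0)// oppr_lt0 divr_gt0.
have vE k : (0 + (r * cos (a + 2 * pi * k%:R / n%:R), r * sin (a + 2 * pi * k%:R / n%:R)) : plane R) =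
    r *: uvec (normal n (a + th) k - th).
  rewrite add0r /normal -/th; have -> : a + 2 * pi * k%:R / n%:R = a + th + k%:R * (2 * th) - th.
    by rewrite /th; field; rewrite pnatr_eq0 -lt0n.
  by [].
apply/seteqP; split.
  apply: smallest_sub; last first.
    move=> _ [k kn <-] j; rewrite vE dotZl ler_pM2l//.
    have := @dot_normal_le n (a + th) j k (- th) n0; rewrite cosN normrN ger0_norm ?(ltW t0)//.
    by apply.
  move=> z w l /set_mem hz /set_mem hw; apply/mem_set => j.
  rewrite /conv /= dotDl !dotZl.
  have l0 : 0 <= l%:num by []. have l1 : 0 <= 1 - l%:num by rewrite subr_ge0.
  move: (l%:num) l0 l1 => x x0 x1.
  rewrite [leRHS](_ : _ = x * (r * cos th) + (1 - x) * (r * cos th)); last by ring.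
  by rewrite lerD// ler_wpM2l// ?hz// hw.
move=> z hz M [cM VM].
have MV k : M (r *: uvec (normal n (a + th) k - th)).
  have -> : uvec (normal n (a + th) k - th) = uvec (normal n (a + th) (k %% n) - th).
    rewrite {1}(divn_eq k n) addnC normalD full_turn// addrAC.
    exact: uvec_period.
  by rewrite -vE; apply: VM; exists (k %% n)%N => //=; rewrite ltn_mod.
have nE k : normal n (a + th) k.+1 - th = normal n (a + th) k + th.
  by rewrite -addn1 normalD mul1r -/th; ring.
have edge k s : `|s| <= th -> M ((r * cos th / cos s) *: uvec (normal n (a + th) k + s)).
  move=> hs; have cs := cos_small_gt0 n2 hs; move: hs; rewrite ler_norml => /andP[s1 s2].
  set m := normal n (a + th) k.
  pose l := sin (th - s) / (2 * sin th * cos s).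
  have den : 0 < 2 * sin th * cos s by rewrite !mulr_gt0.
  have l1 : 1 - l = sin (th + s) / (2 * sin th * cos s).
    by rewrite /l sinB sinD; field; rewrite !gt_eqF.
  have hl : 0 <= l <= 1.
    rewrite -[l <= 1]subr_ge0 l1 /l !divr_ge0 ?(ltW den)//.
      by apply: sin_ge0_pi; apply/andP; split; lra.
    by apply: sin_ge0_pi; apply/andP; split; lra.
  have := convex_comb cM (MV k) (MV k.+1) hl; rewrite nE -/m l1 /l.
  by rewrite -chord_point// gt_eqF.
(* The origin lies between a vertex and the boundary point in the opposite direction. *)
have M0 : M 0.
  have [k [s [ks hs]]] := angle_sector (a + th) (a + pi) n0.
  have cs := cos_small_gt0 n2 hs.
  have := edge k s hs; rewrite -ks; set l := r * cos th / cos s => Mp.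
  have l0 : 0 < l by rewrite divr_gt0// mulr_gt0.
  have hq : 0 <= l / (r + l) <= 1.
    have rl : 0 < r + l by rewrite addr_gt0.
    by rewrite divr_ge0 ?(ltW l0) ?(ltW rl)//= ler_pdivrMr// mul1r lerDr ltW.
  have := convex_comb cM (MV 0%N) Mp hq.
  suff -> : (l / (r + l)) *: (r *: uvec (normal n (a + th) 0 - th)) + (1 - l / (r + l)) *: (l *: uvec (a + pi)) = 0 by [].
  have rl : r + l != 0 by rewrite gt_eqF// addr_gt0.
  have -> : normal n (a + th) 0 - th = a by rewrite /normal mul0r addr0 addrK.
  by apply: injective_projections; rewrite /= /GRing.scale /= ?cosDpi ?sinDpi; field.
have [->//|z0] := eqVneq z 0.
have [t [_ zE]] := polar_decomp 0 z0; have [k [s [ts hs]]] := angle_sector (a + th) t n0.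
have cs := cos_small_gt0 n2 hs; have Me := edge k s hs.
set l := r * cos th / cos s in Me; have l0 : 0 < l by rewrite divr_gt0// mulr_gt0.
have zl : enorm z <= l.
  rewrite ler_pdivlMr//; have := hz k; rewrite {1}zE ts dotZl dot_uvec.
  by rewrite opprD addrA subrr add0r cosN.
have hq : 0 <= enorm z / l <= 1.
  by rewrite divr_ge0 ?enorm_ge0 ?(ltW l0)//= ler_pdivrMr// mul1r.
have := convex_comb cM Me M0 hq; rewrite scaler0 addr0 scalerA divfK ?gt_eqF//.
by rewrite -ts -zE.
Qed.

End Polygon.

(** * Areas in the regular polygon *)

Section PolygonArea.
Variable R : realType.
Implicit Types (a b c d h m p r s t x y e T : R) (z w q v : plane R) (N V : plane R -> R).
Implicit Types (i j k n : nat).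
Notation pmeasurable := (@measurable _ (R * R)%type).

(** The polar derivative is a multiple of [(cos s) ^- 2], the derivative of [tan]. *)
Lemma sarea_kite N r e t0 p h : gauge N -> 0 < r -> 0 < h -> h < pi / 2 ->
  (e = 1 /\ t0 = p) \/ (e = -1 /\ t0 = p + h) ->
  (forall s, 0 < s < h -> N (uvec (t0 + e * s)) = r^-1 * cos s) ->
  sarea N p (p + h) = polar_cst R * r ^+ 2 * tan h.
Proof.
move=> hN r0 h0 hp et hs; have pi0 := pi_gt0 R; have pi2 := pi_ge2 R.
have e1 : e ^+ 2 = 1 by case: et => -[-> _]; rewrite ?sqrrN expr1n.
have ee : e * e = 1 by rewrite -expr2.
pose k := polar_cst R * r ^+ 2; pose ph t := e * (t - t0).
have phi t : p <= t <= p + h -> 0 <= ph t <= h.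
  by case: et => -[ee' te]; rewrite /ph te ee' => /andP[h1 h2]; apply/andP; split; lra.
have phii t : p < t < p + h -> 0 < ph t < h.
  by case: et => -[ee' te]; rewrite /ph te ee' => /andP[h1 h2]; apply/andP; split; lra.
have cpos s : 0 <= s -> s <= h -> 0 < cos s.
  by move=> s0 sh; apply: cos_gt0_pihalf; apply/andP; split; lra.
have dtan t : p <= t <= p + h -> is_derive t 1 (fun t => k * (e * tan (ph t))) (k *: (e *: (cos (ph t) ^- 2 * e))).
  move=> /phi /andP[p1 p2]; have cn0 : cos (ph t) != 0 by rewrite gt_eqF// cpos.
  have dt := is_derive1_comp (is_derive_tan cn0) (is_derive_phase e t0 t).
  exact: is_deriveZ.
pose F t := sarea N p t - k * (e * tan (ph t)).
have DF t : t \in `]p, p + h[ -> is_derive t 1 F 0.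
  rewrite in_itv /= => tp; have /andP[p1 p2] := phii t tp.
  have t2 : p < t < p + 2 * pi by case/andP: tp => h1 h2; apply/andP; split; lra.
  have tc : p <= t <= p + h by case/andP: tp => h1 h2; rewrite !ltW.
  have d := is_deriveB (sarea_is_derive hN t2) (dtan t tc).
  apply: (is_derive_eq d).
  have Nt : N (uvec t) = r^-1 * cos (ph t).
    have pt : 0 < ph t < h by rewrite p1.
    by rewrite -(hs _ pt) /ph mulrA ee mul1r addrC subrK.
  have cn0 : cos (ph t) != 0 by rewrite gt_eqF// cpos ?ltW.
  rewrite Nt /GRing.scale /= /k; move: (cos _) cn0 => c c0; move: (polar_cst R) => pc.
  rewrite [e * _](_ : _ = e ^+ 2 * c ^- 2); last by ring.
  by rewrite e1 mul1r; field; rewrite c0 gt_eqF.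
have cF : {within `[p, p + h], continuous F}.
  have sub : `[p, p + h] `<=` `[p, p + 2 * pi].
    by apply: subset_itvl; rewrite bnd_simp; lra.
  have c1 := continuous_subspaceW sub (sarea_continuous (a := p) hN).
  have c2 : {within `[p, p + h], continuous (fun t => k * (e * tan (ph t)))}.
    apply: continuous_in_subspaceT => t; rewrite inE /= in_itv /= => tp.
    exact: is_derive_continuous (dtan t tp).
  by move=> x; apply: cvgB; [exact: c1|exact: c2].
have pph : p < p + h by rewrite ltrDl.
have [x _] := MVT pph DF cF; rewrite mul0r => /eqP; rewrite subr_eq0 => /eqP.
rewrite /F /ph sarea_id// -/k; case: et => -[-> ->].
  rewrite subrr !mulr0 tan0 !mulr0 subr0 !mul1r addrAC subrr add0r => /eqP.
  by rewrite subr_eq0 => /eqP.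
rewrite subrr mulr0 tan0 !mulr0 subr0 => ->; rewrite sub0r !mulN1r mulrN opprK.
by rewrite opprB addrAC subrr add0r.
Qed.

Lemma outside_area N V a b : gauge N -> gauge V -> b <= a + 2 * pi ->
  ((sarea N a b - sarea V a b)%:E <= area (body N `\` body V))%E.
Proof.
move=> hN hV ba.
have mD : pmeasurable (body N `\` body V) by apply: measurableD; exact: body_measurable.
have mV := bodyI_measurable hV ba; have mN := bodyI_measurable hN ba.
have disj : (body N `\` body V) `&` (body V `&` sector a b) = set0.
  by apply/seteqP; split=> // z [[_ nV] [Vz _]].
have sub : body N `&` sector a b `<=` (body N `\` body V) `|` (body V `&` sector a b).
  move=> z [Nz sz]; have [Vz|nV] := pselect (body V z); by [right|left].
have := le_area mN (measurableU _ _ mD mV) sub; rewrite areaU// !sareaE//.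
have /fineK <- : area (body N `\` body V) \is a fin_num.
  by apply: (body_area_fin hN) => // z [].
by rewrite -EFinD !lee_fin lerBlDr.
Qed.

Section RegularPolygon.
Variables (N : plane R -> R) (n : nat) (r t0 : R).
Hypotheses (hN : gauge N) (n2 : (2 < n)%N) (r0 : 0 < r).
Hypothesis hs : forall k s, `|s| <= pi / n%:R -> N (uvec (normal n t0 k + s)) = r^-1 * cos s.

Let th : R := pi / n%:R.
Let t k := normal n t0 k.

Lemma normalS k : normal n t0 k.+1 = normal n t0 k + 2 * (pi / n%:R).
Proof. by rewrite -addn1 normalD mul1r. Qed.

Lemma polygon_sarea k : sarea N (t k) (t k.+1) = 2 * (polar_cst R * r ^+ 2 * tan th).
Proof.
have n0 : (0 < n)%N by exact: ltn_trans n2.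
have th0 : 0 < th := natdiv_gt0 R n0; have thp : th < pi / 2 := natdiv_lt R n2.
have pi0 := pi_gt0 R; have m2 : t k.+1 = t k + th + th by rewrite /t normalS /th; ring.
rewrite m2 (@sarea_cat _ _ _ (t k + th)) ?lerDl ?(ltW th0)//; last by lra.
rewrite (sarea_kite (e := 1) (t0 := t k) hN r0 th0 thp); last 2 first.
- by left.
- by move=> s /andP[s0 s1]; rewrite mul1r hs// ger0_norm ltW.
rewrite (sarea_kite (e := -1) (t0 := t k.+1) hN r0 th0 thp); last 2 first.
- by right.
- by move=> s /andP[s0 s1]; rewrite mulN1r hs ?cosN// normrN ger0_norm ltW.
by ring.
Qed.

Lemma normal_le k : t k <= t k.+1.
Proof.
have n0 : (0 < n)%N by exact: ltn_trans n2.
by rewrite /t normalS lerDl mulr_ge0// ltW// natdiv_gt0.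
Qed.

Lemma polygon_area : area (body N) = (n%:R * (2 * (polar_cst R * r ^+ 2 * tan th)))%:E.
Proof.
have n0 : (0 < n)%N by exact: ltn_trans n2.
have tn : t n = t 0%N + 2 * pi.
  by have := full_turn R 1 n0; rewrite mul1n mulr1 /t -[n]add0n normalD !add0n => ->.
rewrite (sarea_total (t 0%N) hN) -tn (sarea_sum hN normal_le) ?tn//; congr (_%:E).
under eq_bigr do rewrite polygon_sarea.
by rewrite sumr_const card_ord -[LHS]mulr_natl.
Qed.

Lemma polygon_removed V : gauge V -> (forall z, N z <= V z) -> all_nondegenerate (body V) 0 ->
  (stable_points (body N) 0 #= `I_n)%card ->
  ~ (stable_points (body N) 0 #<= stable_points (body V) 0)%card ->
  ((2 * (polar_cst R * r ^+ 2 * (tan th - th)))%:E <= area (body N `\` body V))%E.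
Proof.
move=> hV NV nd fin ncard; have n0 : (0 < n)%N by exact: ltn_trans n2.
have th0 : 0 < th := natdiv_gt0 R n0; have pi0 := pi_gt0 R; have thp : th < pi / 2 := natdiv_lt R n2.
have tS k : t k.+1 = t k + 2 * th by rewrite /t normalS.
have Nt k : N (uvec (t k)) = r^-1.
  by have := hs k (s := 0); rewrite addr0 cos0 mulr1 normr0 => ->//; exact: ltW.
have [k hk] : exists k, forall x, t k < x < t k.+1 -> r^-1 <= V (uvec x).
  apply: contrapT => none; apply: ncard; rewrite (card_le_eql fin).
  have low k : exists x, t k < x < t k.+1 /\ V (uvec x) < r^-1.
    apply: contrapT => nx; apply: none; exists k => x hx.
    by rewrite leNgt; apply/negP => lt; apply: nx; exists x.
  (* Chosen on one period and continued by full turns, so that the [n] stable angles found between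
     these points lie within one turn and give distinct points. *)
  have [x0 hx0] := choice low; pose x k := x0 (k %% n)%N + (k %/ n * n)%N%:R * (2 * th).
  have hx j : t j < x j < t j.+1 /\ V (uvec (x j)) < r^-1.
    have [h1 h2] := hx0 (j %% n)%N; rewrite /x; split; last by rewrite full_turn// uvec_period.
    have -> : t j = t (j %% n)%N + (j %/ n * n)%N%:R * (2 * th).
      by rewrite {1}(divn_eq j n) addnC /t normalD.
    have -> : t j.+1 = t (j %% n).+1 + (j %/ n * n)%N%:R * (2 * th).
      by rewrite {1}(divn_eq j n) -addnS addnC /t normalD.
    by rewrite !ltrD2r.
  have xn : x n = x 0%N + 2 * pi.
    by rewrite /x modnn mod0n divnn n0 div0n !mul0n mul0r addr0 full_turn// mulr1.
  have xlt k : x k < x k.+1.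
    by have [/andP[_ h1] _] := hx k; have [/andP[h2 _] _] := hx k.+1; exact: lt_trans h1 h2.
  have st k : exists y, x k < y < x k.+1 /\ stable_angle V y.
    apply: contrapT => ny.
    have : V (uvec (t k.+1)) < Num.max (V (uvec (x k))) (V (uvec (x k.+1))).
      apply: between_lt_max => // [y hy sy|]; first by apply: ny; exists y.
      by have [/andP[_ h1] _] := hx k; have [/andP[h2 _] _] := hx k.+1; rewrite h1.
    apply/negP; rewrite -leNgt; apply: le_trans (NV _); rewrite Nt ge_max.
    by have [_ /ltW ->] := hx k; have [_ /ltW ->] := hx k.+1.
  have [y hy] := choice st.
  have ylt k : y k < y k.+1.
    by have [/andP[_ h1] _] := hy k; have [/andP[h2 _] _] := hy k.+1; exact: lt_trans h1 h2.
  have mono (f : nat -> R) : (forall i, f i < f i.+1) -> forall i j, (i < j)%N -> f i < f j.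
    move=> hf i j; elim: j => // j IH; rewrite ltnS leq_eqVlt => /orP[/eqP ->//|/IH/lt_trans]; exact.
  have yrange i : (i < n)%N -> y 0%N <= y i < y 0%N + 2 * pi.
    move=> ii; apply/andP; split.
      by case: i ii => // i _; apply/ltW/mono.
    have [/andP[_ h1] _] := hy i; have [/andP[h2 _] _] := hy 0%N.
    apply: lt_trans h1 _; apply: le_lt_trans (_ : x n < _); last by rewrite xn ltrD2r.
    by move: ii; rewrite leq_eqVlt => /orP[/eqP ->//|/(mono x xlt)/ltW].
  have yI : {in `I_n &, injective (bdpt V \o y)}.
    move=> i j /set_mem /= ii /set_mem /= jj /bdpt_eq /(_ hV) /(uvec_inj (yrange i ii) (yrange j jj)) e.
    by have [/(mono y ylt)|/(mono y ylt)|//] := ltngtP i j; rewrite e ltxx.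
  rewrite -(card_le_eql (inj_card_eq yI)); apply: subset_card_le => _ [i _ <-].
  by have [] := hy i.
have ba : t k.+1 <= t k + 2 * pi by rewrite tS; lra.
apply: le_trans (outside_area hN hV ba); rewrite lee_fin polygon_sarea.
have i0 : 0 < r^-1 by rewrite invr_gt0.
have dV : sarea V (t k) (t k.+1) <= polar_cst R * r ^+ 2 * (2 * th).
  have -> : polar_cst R * r ^+ 2 * (2 * th) = sarea (fun z => r^-1 * enorm z) (t k) (t k.+1).
    rewrite sarea_scaled ?normal_le// tS -exprVn invrK; congr (_ * _); ring.
  apply: le_sarea => //; first exact: gauge_scale (gauge_enorm R) i0.
  move=> x /andP[]; rewrite enorm_uvec mulr1 le_eqVlt => /orP[/eqP <- _|x1 x2].
    by rewrite -(Nt k).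
  by apply: hk; rewrite x1.
by rewrite mulrBr mulrBr lerD2l lerN2; apply: le_trans dV _; rewrite le_eqVlt; apply/orP; left; apply/eqP; ring.
Qed.

End RegularPolygon.

End PolygonArea.

(** * The extremal bound and its equality case *)

Section Robustness.
Variable R : realType.
Implicit Types (a b c d h m p r s t x y e T : R) (z w q v : plane R) (N V : plane R -> R).
Implicit Types (i j k n : nat).

Lemma gain_natdiv n : (2 < n)%N -> let t := pi / n%:R : R in
  (tan t - t) / (n%:R * tan t) = (n%:R * gain t)^-1.
Proof.
move=> n2 t; have n0 : (0 < n)%N by exact: ltn_trans n2.
have t0 : 0 < t := natdiv_gt0 R n0; have tp : t < pi / 2 := natdiv_lt R n2.
have tt : 0 < tan t by rewrite divr_gt0 ?sin_gt0_pihalf ?t0// cos_gt0_pihalf// tp (lt_trans _ t0)// oppr_lt0 divr_gt0 ?pi_gt0.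
rewrite /gain tp [RHS]invfM invrK [in LHS]invfM mulrCA; congr (_ * _).
by rewrite mulrBl divff// gt_eqF.
Qed.

Lemma fewer_stable_gauge N K' : gauge N -> fewer_stable (body N) 0 K' ->
  exists V, [/\ gauge V, K' = body V & forall z, N z <= V z].
Proof.
move=> hN [[cK' _] sub K'0 _ _]; have [V [hV K'E]] := convex_body_gauge cK' K'0.
exists V; split=> // z; have [->|z0] := eqVneq z 0; first by rewrite !gauge0.
have Vz := gauge_gt0 hV z0.
have : body N ((V z)^-1 *: z).
  by apply: sub; rewrite K'E /body /= gaugeZ ?invr_ge0 ?(ltW Vz)// mulVf// gt_eqF.
by rewrite /body /= gaugeZ ?invr_ge0 ?(ltW Vz)// ler_pdivrMl// mulr1.
Qed.

Lemma body_area_gt0 N A : gauge N -> area (body N) = A%:E -> 0 < A.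
Proof.
move=> hN; rewrite (sarea_total 0 hN) => -[<-]; have pi0 := pi_gt0 R.
have [b [b0 hb]] := gauge_bound hN.
have p2 : 0 < 2 * pi :> R by rewrite mulr_gt0.
apply: lt_le_trans (_ : polar_cst R * (2 * b) ^- 2 * (0 + 2 * pi - 0) <= _).
  by rewrite add0r subr0 mulr_gt0// divr_gt0 ?polar_cst_gt0// exprn_gt0// mulr_gt0.
apply: sarea_ge => //; first by rewrite add0r ltW.
move=> t _; have n0 := gauge_uvec_gt0 t hN; have b2 : 0 < 2 * b by rewrite mulr_gt0.
have h : N (uvec t) <= 2 * b.
  apply: le_trans (hb _) _; rewrite mulrC ler_pM2r//.
  have [h1 h2] := coord_le_enorm (uvec t); rewrite enorm_uvec in h1 h2.
  exact: le_trans (lerD h1 h2) _.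
by rewrite lef_pV2 ?posrE ?exprn_gt0// ler_pXn2r// nnegrE ltW.
Qed.

Section Arcs.
Variables (N : plane R -> R) (n : nat) (t : nat -> R).
Hypotheses (hN : gauge N) (kN : K2 (body N)) (nd : all_nondegenerate (body N) 0).
Hypotheses (n2 : (2 < n)%N) (fin : (stable_points (body N) 0 #= `I_n)%card).
Hypothesis st : forall i, stable_angle N (t i).
Hypothesis tS : forall i, t i < t i.+1.
Hypothesis no : forall i x, t i < x < t i.+1 -> ~ stable_angle N x.
Hypothesis per : forall i, t (i + n)%N = t i + 2 * pi.

(** The shift by one provides a neighbouring stable angle, [t i] and [t i.+3], on either side of the
    arc, as the cut needs a margin there. *)
Definition gap i := arc_gap N (arc_radius N (t i.+1) (t i.+2)) (t i.+1) (t i.+2).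

Lemma arc_increasing i j : (i < j)%N -> t i < t j.
Proof.
by elim: j => // j IH; rewrite ltnS leq_eqVlt => /orP[/eqP ->//|/IH/lt_trans]; exact.
Qed.

Lemma arc_short i : t i.+1 < t i + 2 * pi.
Proof. by rewrite -per arc_increasing// -addn1 ltn_add2l (ltn_trans _ n2). Qed.

Lemma arc_pinched i e : 0 < e -> exists K', fewer_stable (body N) 0 K' /\
  (area (body N `\` K') <= (gap i + e)%:E)%E.
Proof.
move=> e0.
have l1 : 0 < t i.+1 - t i by rewrite subr_gt0.
have l2 : 0 < t i.+3 - t i.+2 by rewrite subr_gt0.
have [l [l0 la lb]] := exists_lt_both l1 l2.
apply: (arc_fewer (l := l) hN kN nd fin (tS i.+1) (arc_short i.+1) (st _) (st _)) => //.
- exact: no.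
- by move=> x /andP[x1 x2]; apply: (no (i := i.+2)); rewrite x1 (lt_trans x2)// -ltrBrDl.
- by move=> x /andP[x1 x2]; apply: (no (i := i)); rewrite x2 andbT (lt_trans _ x1)// ltrBrDl -ltrBrDr.
Qed.

Let A := sarea N (t 1%N) (t 1%N + 2 * pi).
Let th : R := pi / n%:R.
Let c := (n%:R * gain th)^-1.

(** The hypotheses of [gain_average]: the half-angles telescope to [pi], and the sector areas add up
    to the total area. *)
Lemma arcs_optimal : (forall i, c * A <= gap i) ->
  forall i, (i < n)%N -> [/\ t i.+2 - t i.+1 = 2 * th, gap i = c * A &
    gain ((t i.+2 - t i.+1) / 2) * gap i = sarea N (t i.+1) (t i.+2)].
Proof.
move=> hC i ii; have tn : t n.+1 = t 1%N + 2 * pi by rewrite -per.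
have AE : \sum_(j < n) sarea N (t j.+1) (t j.+2) = A.
  by rewrite -(@sarea_sum R N (fun j => t j.+1) n hN) ?tn// => j; exact: ltW.
have A0 : 0 < A by apply: (body_area_gt0 hN); exact: sarea_total.
have hsum : \sum_(j < n) (t j.+2 - t j.+1) / 2 = pi.
  rewrite -mulr_suml -(big_mkord predT (fun j => t j.+2 - t j.+1)).
  rewrite (telescope_sumr (fun j => t j.+1) (leq0n n)) tn; by field.
have h0 (j : 'I_n) : 0 < (t j.+2 - t j.+1) / 2 by rewrite divr_gt0// subr_gt0.
have gC (j : 'I_n) : gain ((t j.+2 - t j.+1) / 2) * gap j <= sarea N (t j.+1) (t j.+2).
  have [h _] := arc_gap_le hN (stable_angle_critical hN (st j.+1))
    (stable_angle_critical hN (st j.+2)) (tS _) (arc_short _); exact: h.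
have [h1 h2 h3] := gain_average n2 A0 (erefl c) h0 hsum gC AE (fun j : 'I_n => hC j) (Ordinal ii).
split=> //; by rewrite /th -h1 /= mulrC divfK.
Qed.

(** Equality fixes the gauge on each arc with a radius of its own; consecutive arcs share a stable
    angle, so the radii agree. *)
Lemma optimal_polygon : (forall i, c * A <= gap i) ->
  exists r, 0 < r /\ body N = polygon n r (t 1%N).
Proof.
move=> hC; have opt := arcs_optimal hC.
have n0 : (0 < n)%N by exact: ltn_trans n2.
have th0 : 0 < th := natdiv_gt0 R n0; have thp : th < pi / 2 := natdiv_lt R n2.
have tE k : t k.+1 = normal n (t 1%N) k.
  have step j : t j.+2 = t j.+1 + 2 * th.
    have pm i l : t (i + l * n)%N = t i + l%:R * (2 * pi).
      elim: l => [|l IH]; first by rewrite mul0n addn0 mul0r addr0.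
      by rewrite mulSn addnCA addnC per IH -[l.+1%:R]natr1; ring.
    have [h _ _] := opt (j %% n)%N (ltn_pmod j n0).
    rewrite (divn_eq j n) addnC -!addSn !pm -h; ring.
  elim: k => [|k IH]; first by rewrite /normal mul0r addr0.
  by rewrite step IH normalS.
have arc i : (i < n)%N -> exists r, 0 < r /\ forall s, 0 <= s <= th ->
    N (uvec (t i.+1 + s)) = r^-1 * cos s /\ N (uvec (t i.+2 - s)) = r^-1 * cos s.
  move=> ii; have [h1 h2 h3] := opt i ii.
  have e2 : (t i.+2 - t i.+1) / 2 = th by rewrite h1 mulrC mulKf.
  have [_ h] := arc_gap_le hN (stable_angle_critical hN (st i.+1))
    (stable_angle_critical hN (st i.+2)) (tS _) (arc_short _).
  rewrite e2 in h h3; have {}h := h thp h3.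
  exists (arc_radius N (t i.+1) (t i.+2)); split.
    by rewrite lt_max radius_gt0.
  set r := arc_radius _ _ _ in h *.
  have cts (u : R -> R) : continuous u -> continuous (fun s => N (uvec (u s)) - r^-1 * cos s).
    move=> cu s; apply: cvgB; first exact: cvg_comp (cu s) (gauge_uvec_continuous hN (x := _)).
    by apply: cvgM; [exact: cvg_cst|exact: continuous_cos].
  have c1 : continuous (fun s : R => t i.+1 + s).
    by move=> s; apply: cvgD; [exact: cvg_cst|exact: cvg_id].
  have c2 : continuous (fun s : R => t i.+2 - s).
    by move=> s; apply: cvgB; [exact: cvg_cst|exact: cvg_id].
  move=> s hs; split; apply/eqP; rewrite -subr_eq0; apply/eqP.
    by apply: (continuous_eq0_itv (cts _ c1) th0) => // x /h[-> _]; rewrite subrr.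
  by apply: (continuous_eq0_itv (cts _ c2) th0) => // x /h[_ ->]; rewrite subrr.
have z0 : 0 <= (0 : R) <= th by apply/andP; split=> //; exact: ltW.
pose r := (N (uvec (t 1%N)))^-1.
have r0 : 0 < r by rewrite invr_gt0 gauge_uvec_gt0.
have Nt i : (i <= n)%N -> N (uvec (t i.+1)) = r^-1.
  elim: i => [|i IH] ii; first by rewrite /r invrK.
  have [r' [_ h]] := arc i ii; have [h1 h2] := h 0 z0.
  by rewrite subr0 in h2; rewrite h2 -h1 addr0 IH// ltnW.
have right i s : (i < n)%N -> 0 <= s <= th -> N (uvec (t i.+1 + s)) = r^-1 * cos s.
  move=> ii hs; have [r' [_ h]] := arc i ii; have [-> _] := h s hs; congr (_ * _).
  by have [h1 _] := h 0 z0; rewrite -(Nt i (ltnW ii)) -[t _]addr0 h1 cos0 mulr1.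
have left i s : (i < n)%N -> 0 <= s <= th -> N (uvec (t i.+2 - s)) = r^-1 * cos s.
  move=> ii hs; have [r' [_ h]] := arc i ii; have [_ ->] := h s hs; congr (_ * _).
  by have [h1 _] := h 0 z0; rewrite -(Nt i (ltnW ii)) -[t _]addr0 h1 cos0 mulr1.
exists r; split=> //; apply: body_polygon => // k s hs.
have -> : uvec (normal n (t 1%N) k + s) = uvec (t (k %% n).+1 + s).
  rewrite {1}(divn_eq k n) addnC normalD full_turn// addrAC uvec_period.
  by rewrite (tE (k %% n)%N).
have kn := ltn_pmod k n0; move: (k %% n)%N kn => j jn.
have [s0|s0] := leP 0 s; first by apply: right => //; rewrite s0 -[s]ger0_norm.
have sn : 0 <= - s <= th by rewrite oppr_ge0 ltW//= -[- s]ltr0_norm.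
case: j jn => [|j] jn; last by rewrite -[s]opprK cosN left// ltnW.
(* Angles just before [t 1] belong to the last arc, one turn later. *)
have -> : uvec (t 1%N + s) = uvec (t n.-1.+2 - - s).
  rewrite prednK// opprK -(uvec_period (t 1%N + s) 1) -[n.+1]/(1 + n)%N per.
  by congr uvec; ring.
by rewrite left ?cosN// prednK.
Qed.

End Arcs.

End Robustness.

Theorem theorem1 (R : realType) (S : nat) (K : set (plane R))
    (hS : (3 <= S)%N)
    (hK : K2 K)
    (h0 : (K°) 0)
    (hnondeg : all_nondegenerate K 0)
    (hstable : (stable_points K 0 #= `I_S)%card) :
  (external_robustness K 0%R
     <= ((tan (pi / S%:R) - pi / S%:R) / (S%:R * tan (pi / S%:R)))%:E)%E /\
  (external_robustness K 0%R
     = ((tan (pi / S%:R) - pi / S%:R) / (S%:R * tan (pi / S%:R)))%:E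
   <-> regular_polygon S 0 K).
Proof.
have [N [hN KE]] := convex_body_gauge hK.1 h0.
move: hS hK hnondeg hstable; rewrite {K h0}KE => n2 kK nd fin.
have n0 : (0 < S)%N by exact: ltn_trans n2.
have [t [st tS no per]] := stable_enum hN n0 fin.
have cth : 0 < cos (pi / S%:R : R).
  by apply: (cos_small_gt0 n2); rewrite ger0_norm// ltW// natdiv_gt0.
rewrite gain_natdiv//; set c := (_ * gain _)^-1.
set A := sarea N (t 1%N) (t 1%N + 2 * pi).
have aK : area (body N) = A%:E := sarea_total _ hN.
have A0 : 0 < A := body_area_gt0 hN aK.
set E := [set area (body N `\` K') | K' in fewer_stable (body N) 0].
have le_gap i : (ereal_inf E <= (gap N t i)%:E)%E.
  apply/lee_addgt0Pr => e e0.
  have [K' [fK' aK']] := arc_pinched hN kK nd n2 fin st tS no per i e0.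
  by apply: le_trans aK'; apply: ereal_inf_lbound; exists K'.
have inf0 : (0 <= ereal_inf E)%E.
  apply: le_ereal_inf_tmp => _ [K' fK' <-]; have [V [hV -> _]] := fewer_stable_gauge hN fK'.
  by apply: area_ge0; apply: measurableD; exact: body_measurable.
have [x xE] : exists x, ereal_inf E = x%:E.
  exists (fine (ereal_inf E)); rewrite fineK// ge0_fin_numE//.
  by apply: le_lt_trans (le_gap 0%N) (ltry _).
have rob : external_robustness (body N) 0 = (x / A)%:E.
  by rewrite /external_robustness -/E xE aK inver gt_eqF// -EFinM.
have xgap i : x <= gap N t i by rewrite -lee_fin -xE.
(* Otherwise all gaps exceed [c * A], and then [arcs_optimal] forces the gap 0 to equal it. *)
have xc : x <= c * A.
  rewrite leNgt; apply/negP => lt.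
  have hC i : c * A <= gap N t i by apply: le_trans (ltW lt) _.
  have [_ e _] := arcs_optimal hN n2 st tS per hC n0.
  by have := lt_le_trans lt (xgap 0%N); rewrite e ltxx.
rewrite rob; split; first by rewrite lee_fin ler_pdivrMr.
split.
  move=> [/(canRL (divfK (_ : A != 0)))] xcA.
  have hC i : c * A <= gap N t i by rewrite -xcA// gt_eqF.
  have [r [r0 bE]] := optimal_polygon hN n2 st tS per hC.
  (* From the inradius and a foot direction to the circumradius and a vertex. *)
  exists (r / cos (pi / S%:R)), (t 1%N - pi / S%:R); split; first by rewrite divr_gt0.
  by rewrite hull_polygon ?divr_gt0// divfK ?gt_eqF// subrK.
move=> [r [a [r0 bE]]]; rewrite hull_polygon// in bE.
have rc : 0 < r * cos (pi / S%:R) by rewrite mulr_gt0.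
have hs := polygon_gauge hN n2 rc bE.
have := polygon_area hN n2 rc hs; rewrite aK => -[AE].
congr (_%:E); apply/eqP; rewrite eq_le ler_pdivrMr// xc /= ler_pdivlMr//.
rewrite -lee_fin -xE; apply: le_ereal_inf_tmp => _ [K' fK' <-].
have [V [hV VE NV]] := fewer_stable_gauge hN fK'; case: fK' => _ _ _ ndV [_ ncard].
rewrite VE in ndV ncard *.
apply: le_trans (polygon_removed hN n2 rc hs hV NV ndV fin ncard).
rewrite lee_fin /c -gain_natdiv// AE.
have tt : 0 < tan (pi / S%:R) :> R.
  by rewrite divr_gt0// sin_gt0_pihalf// natdiv_gt0// natdiv_lt.
rewrite le_eqVlt; apply/orP; left; apply/eqP; field.
by rewrite pnatr_eq0 -lt0n n0 gt_eqF.
Qed.
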